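(* Let $(X,\mu)$ be a measure space with a (separable) ball-basis $\mathscr B$, $r\ge1$, and $\mathbb U$ a Banach space. Let $\phi=\{\phi_B:B\in\mathscr B\}$ be an $\omega$-regular family of functions, where the modulus of continuity $\omega$ satisfies $\|\omega\|=1+\int_0^1\frac{\omega(t)\log(1/t)}{t}dt<\infty$, and let $\mathscr G=\bigcup_{x\in X}\mathscr G(x)$, where each $\mathscr G(x)$ is a family of balls complete at $x$. If the ball-basis $\mathscr B$ is doubling, then for any $f\in L^r(X,\mathbb U)$ and a ball $B$ there exist a ball $B'\supset B$, a sparse collection of balls $\mathscr A$ and a martingale type collection of measurable sets $\bar{\mathscr A}\Subset\mathscr A$ such that $$\bigcup_{G\in\mathscr A}G\subset B',\qquad\mu(B')\lesssim\mu(B),$$ $$\mu\Big\{x\in X:\sum_{G\in\mathscr A}\mathbf 1_{\bar G}(x)>\lambda\Big\}\lesssim\exp(-c\lambda)\mu(B),\quad\lambda>0,$$ $$|\mathcal M^{\phi,\mathscr G}f(x)-m(B)|\lesssim\|\omega\|\sum_{G\in\mathscr A}\langle f\rangle^*_{\#,G}\,\mathbf 1_{\bar G}(x),\quad x\in B,$$ where $c>0$ is an admissible constant and $m(B)$ is a median of the real function $\mathcal M^{\phi,\mathscr G}(f)$ on $B$.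
   Context: Ball-basis. Let $(X,\mathfrak M,\mu)$ be a measure space. A family $\mathscr B$ of measurable sets (balls) is a ball-basis if: (B1) $0<\mu(B)<\infty$ for $B\in\mathscr B$; (B2) any two points lie in a common ball; (B3) for any $E\in\mathfrak M$, $\varepsilon>0$ there is a finite or infinite sequence of balls $B_k$ with $\mu(E\triangle\bigcup_kB_k)<\varepsilon$; (B4) for any $B\in\mathscr B$ there is a ball $[B]\in\mathscr B$ with $B^*:=\bigcup_{A\in\mathscr B:\ \mu(A)\le2\mu(B),\ A\cap B\ne\varnothing}A\subset[B]$ and $\mu([B])\le\mathcal K\mu(B)$, $\mathcal K$ independent of $B$. All ball-bases are assumed separable (arbitrary unions of balls are measurable). $\mathscr B$ is doubling if there is $\eta>1$ such that for every ball $B$ with $B^*\ne X$ there is a ball $B'\supsetneq B$ with $\mu(B')\le\eta\mu(B)$. Notation. $f_B=\frac1{\mu(B)}\int_Bf$, $\langle f\rangle_{\#,B}=\big(\frac1{\mu(B)}\int_B\|f-f_B\|_{\mathbb U}^r\big)^{1/r}$, $\langle f\rangle^*_{\#,B}=\sup_{A\in\mathscr B,A\supset B}\langle f\rangle_{\#,A}$. $\mathrm{OSC}_E(g)=\operatorname{esssup}_{x,x'\in E}|g(x)-g(x')|$, $\mathrm{OSC}_{B,\beta}(g)=\inf_{E\subset B:\,\mu(E)>\beta\mu(B)}\mathrm{OSC}_E(g)$, $0<\beta<1$. Median: let $M_g(B)\subset B$ be the union of all measurable $E\subset B$ with $\mu(E)>\mu(B)/2$ and $\mathrm{OSC}_E(g)\le2\,\mathrm{OSC}_{B,1/2}(g)$;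 $m$ is a median of $g$ on $B$ if there is a point $x\in M_g(B)$ with $g(x)=m$. Volume distance: $d(x,B)=\inf\{\mu(A):A\in\mathscr B,\ A\supset B\cup\{x\}\}$. A modulus of continuity is a monotone increasing and subadditive function $\omega:(0,1]\to(0,1]$. A family of non-negative real valued functions $\phi=\{\phi_B:B\in\mathscr B\}\subset L^1(X)$ is $\omega$-regular if (1) $\|\phi_B\|_{L^1(X)}=1$; (2) there is an increasing function $\gamma:[1,\infty)\to[1,\infty)$ with $\phi_B(x)\le\gamma(\mu(A)/\mu(B))\phi_A(x)$ for every two balls $B\subset A$; (3) there are positive constants $c_1,c_2$ such that for any ball $B$, $c_1\frac{\mathbf 1_B(x)}{\mu(B)}\le\phi_B(x)\le c_2\,\omega\big(\frac{\mu(B)}{d(x,B)}\big)\frac1{d(x,B)}$, $x\in X$. A family of balls $\mathscr G(x)\subset\mathscr B$ is complete at $x$ if $x\in B$ for any $B\in\mathscr G(x)$ and for any ball $A\ni x$ there is a ball $\bar A\in\mathscr G(x)$ with $\bar A\supset A$, $\mu(\bar A)\le\eta\mu(A)$, where $\eta\ge1$ is a constant (denoted by the same letter as the doubling constant). $\langle f\rangle_{\phi_B}=\int_X\|f\|_{\mathbb U}\phi_B$ and $\mathcal M^{\phi,\mathscr G}f(x)=\sup_{B\in\mathscr G(x)}\langle f\rangle_{\phi_B}$, an operator acting from $L^r(X,\mathbb U)$ to the space $L^0(X,\mathbb R)$ of measurable functions. Families of sets. A collection $\mathcal S$ of measurable sets is sparse, with a constant $0<\gamma_0<1$, if for any $B\in\mathcal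 S$ there is a set $E_B\subset B$ with $\mu(E_B)\ge\gamma_0\mu(B)$ and the sets $E_B$, $B\in\mathcal S$, are pairwise disjoint. A family is of martingale type if any two members are disjoint or one contains the other. $\bar{\mathcal S}\Subset\mathcal S$ means that there is a one-to-one mapping from $\mathcal S$ to $\bar{\mathcal S}$ taking every $A\in\mathcal S$ to a set $\bar A\in\bar{\mathcal S}$ with $\bar A\subset A$. Admissible constants are positive constants depending only on $\mathcal K,\eta,r$; $a\lesssim b$ means $a\le c\,b$ with $c$ admissible.
   Formalization: The constant in the last estimate may also depend on γ, c1, c2 of the ω-regular family (it cannot depend on K, η, r alone); since a median may fail to exist, the estimate holds for some median whenever one exists, and for almost every median value on each set defining M_g(B). *)

(* Defs.v *)
From HB Require Import structures.
From mathcomp Require Import all_boot all_order all_algebra.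
From mathcomp Require Import all_classical all_reals all_analysis.
From mathcomp Require Import measurable_realfun.

Set Implicit Arguments.
Unset Strict Implicit.
Unset Printing Implicit Defensive.

Import Order.TTheory GRing.Theory Num.Theory.
Import numFieldNormedType.Exports.

Local Open Scope classical_set_scope.
Local Open Scope ring_scope.
Local Open Scope ereal_scope.

Section BallBasis.
Context {d : measure_display} {T : measurableType d} {R : realType}.
Variables (mu : {measure set T -> \bar R}) (BB : set (set T)).
Implicit Types (A B E : set T).

Definition ball_star B : set T :=
  \bigcup_(A in [set A | [/\ BB A, mu A <= 2%:E * mu B & A `&` B !=set0]]) A.

(* In (B3) a finite or infinite sequence of balls is represented by its
   countable (possibly empty) set of terms. *)
Record ball_basis (K : R) : Prop := BallBasisProp {
  ball_measurable : forall B, BB B -> measurable B ;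
  ball_measure : forall B, BB B -> 0 < mu B < +oo ;
  ball_pair : forall x y : T, exists2 B, BB B & B x /\ B y ;
  ball_approx : forall E (e : R), measurable E -> (0 < e)%R ->
    exists C : set (set T), [/\ countable C, C `<=` BB &
      mu (E `+` \bigcup_(A in C) A) < e%:E] ;
  ball_hull : forall B, BB B ->
    exists B1, [/\ BB B1, ball_star B `<=` B1 & mu B1 <= K%:E * mu B] ;
  ball_separable : forall C : set (set T),
    C `<=` BB -> measurable (\bigcup_(A in C) A) }.

Definition doubling (eta : R) : Prop :=
  (1 < eta)%R /\
  forall B, BB B -> ball_star B <> [set: T] ->
    exists B', [/\ BB B', B `<` B' & mu B' <= eta%:E * mu B].

(* On a ball-basis the infimum is a real number, at least mu B. *)
Definition vol_dist (x : T) B : R :=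
  fine (ereal_inf [set mu A | A in [set A | [/\ BB A, B `<=` A & A x]]]).

Definition complete_at (eta : R) (G : set (set T)) (x : T) : Prop :=
  [/\ G `<=` BB, forall B, G B -> B x &
    forall A, BB A -> A x ->
      exists A', [/\ G A', A `<=` A' & mu A' <= eta%:E * mu A]].

End BallBasis.

Section Modulus.
Context {R : realType}.

Record modulus (w : R -> R) : Prop := ModulusProp {
  modulus_range : forall t : R, (0 < t <= 1 -> 0 < w t <= 1)%R ;
  modulus_mono : forall s t : R, (0 < s -> s <= t -> t <= 1 -> w s <= w t)%R ;
  modulus_subadd : forall s t : R,
    (0 < s -> 0 < t -> s + t <= 1 -> w (s + t) <= w s + w t)%R }.

Definition modulus_norm (w : R -> R) : \bar R :=
  1 + \int[lebesgue_measure]_(t in `]0%R, 1%R]) (w t * ln t^-1 / t)%:E.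

Definition growth_fun (gam : R -> R) : Prop :=
  (forall s : R, 1 <= s -> 1 <= gam s)%R /\
  (forall s t : R, 1 <= s -> s <= t -> gam s <= gam t)%R.

End Modulus.

Section RegularFamily.
Context {d : measure_display} {T : measurableType d} {R : realType}.
Variables (mu : {measure set T -> \bar R}) (BB : set (set T)).
Implicit Types (A B : set T) (phi : set T -> T -> R).

Record regular_family (w gam : R -> R) (c1 c2 : R) phi : Prop :=
  RegularFamilyProp {
  regular_ge0 : forall B x, BB B -> (0 <= phi B x)%R ;
  regular_integrable : forall B, BB B ->
    mu.-integrable [set: T] (EFin \o phi B) ;
  regular_norm1 : forall B, BB B -> \int[mu]_x (phi B x)%:E = 1 ;
  regular_growth : forall A B x, BB A -> BB B -> B `<=` A ->
    (phi B x <= gam (fine (mu A) / fine (mu B)) * phi A x)%R ;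
  regular_bounds : forall B x, BB B ->
    (c1 * (\1_B x / fine (mu B)) <= phi B x <=
     c2 * w (fine (mu B) / vol_dist mu BB x B) / vol_dist mu BB x B)%R }.

End RegularFamily.

Section Bochner.
Context {d : measure_display} {T : measurableType d} {R : realType}.
Context {U : completeNormedModType R}.
Variable mu : {measure set T -> \bar R}.
Implicit Types (D : set T) (f s : T -> U).

Definition simple_fun s : Prop :=
  finite_set (range s) /\ forall u, measurable (s @^-1` [set u]).

(* Pointwise limit everywhere, not just a.e.: every class of L^r has such a
   representative, and it makes the norm of f measurable even when mu is not
   complete. *)
Definition strongly_measurable f : Prop :=
  exists s : (T -> U)^nat, (forall n, simple_fun (s n)) /\
    forall x, (fun n => s n x) @ \oo --> f x.

Definition in_Lr (r : R) f : Prop :=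
  strongly_measurable f /\ \int[mu]_x (`|f x| `^ r)%:E < +oo.

Definition simple_integral D s : U :=
  (\sum_(u \in range s) fine (mu (D `&` s @^-1` [set u])) *: u)%R.

Definition is_bochner_integral D f (v : U) : Prop :=
  exists s : (T -> U)^nat,
    [/\ forall n, simple_fun (s n),
        forall n, \int[mu]_(x in D) `|s n x|%:E < +oo,
        (fun n => \int[mu]_(x in D) `|f x - s n x|%R%:E) @ \oo --> (0 : \bar R) &
        (fun n => simple_integral D (s n)) @ \oo --> v].

(* The value is 0 when f is not Bochner integrable on D. *)
Definition bochner_integral D f : U := xget 0%R (is_bochner_integral D f).

End Bochner.

Section Oscillation.
Context {d : measure_display} {T : measurableType d} {R : realType}.
Context {U : completeNormedModType R}.
Variables (mu : {measure set T -> \bar R}) (BB : set (set T)).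
Implicit Types (A B : set T) (f : T -> U).

Definition average B f : U := ((fine (mu B))^-1 *: bochner_integral mu B f)%R.

Definition sharp (r : R) f B : \bar R :=
  ((fine (mu B))^-1%:E *
   \int[mu]_(x in B) (`|f x - average B f| `^ r)%R%:E) `^ r^-1.

Definition sharp_star (r : R) f B : \bar R :=
  ereal_sup [set sharp r f A | A in [set A | BB A /\ B `<=` A]].

Definition phi_average (phi : set T -> T -> R) f B : \bar R :=
  \int[mu]_x (`|f x| * phi B x)%:E.

Definition maximal (phi : set T -> T -> R) (G : T -> set (set T)) f (x : T)
  : \bar R :=
  ereal_sup [set phi_average phi f B | B in G x].

End Oscillation.

Section Median.
Context {d : measure_display} {T : measurableType d} {R : realType}.
Variable mu : {measure set T -> \bar R}.
Implicit Types (B E N : set T) (g : T -> \bar R).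

(* The essential supremum over pairs (x, x') in E x E: the least supremum
   obtained by deleting a null set from E.  It coincides with the essential
   supremum for the product measure. *)
Definition OSC g E : \bar R :=
  ereal_inf [set ereal_sup [set `|g xx.1 - g xx.2| |
                              xx in (E `\` N) `*` (E `\` N)] |
             N in mu.-negligible].

Definition OSC_beta (beta : R) g B : \bar R :=
  ereal_inf [set OSC g E |
    E in [set E | [/\ measurable E, E `<=` B & beta%:E * mu B < mu E]]].

Definition median_cell g B E : Prop :=
  [/\ measurable E, E `<=` B, (2^-1)%:E * mu B < mu E &
      OSC g E <= 2%:E * OSC_beta 2^-1 g B].

Definition median_set g B : set T := \bigcup_(E in median_cell g B) E.

(* OSC ignores null sets, so adding a null set to a member of median_cell gives
   another member: when points are null sets, median_set g B is empty or all
   of B.  It is empty when OSC_beta 2^-1 g B = 0 is not attained. *)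
Definition is_median g B (m : R) : Prop :=
  exists2 x, median_set g B x & g x = m%:E.

End Median.

Section Families.
Context {d : measure_display} {T : measurableType d} {R : realType}.
Variable mu : {measure set T -> \bar R}.
Implicit Type S : set (set T).

Definition sparse (gam0 : R) S : Prop :=
  exists E : set T -> set T,
    [/\ forall B, S B -> [/\ measurable (E B), E B `<=` B &
                             gam0%:E * mu B <= mu (E B)] &
        trivIset S E].

Definition martingale_type S : Prop :=
  forall A B, S A -> S B -> [\/ A `&` B = set0, A `<=` B | B `<=` A].

Definition shrinking (bar : set T -> set T) S (S' : set (set T)) : Prop :=
  set_bij S S' bar /\ forall A, S A -> bar A `<=` A.

End Families.

(* Main.v *)
Require Import Defs.
From HB Require Import structures.
From mathcomp Require Import all_boot all_order all_algebra.
From mathcomp Require Import all_classical all_reals all_analysis.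
From mathcomp Require Import measurable_realfun.
From mathcomp Require Import ring lra.

Set Implicit Arguments.
Unset Strict Implicit.
Unset Printing Implicit Defensive.

Import Order.TTheory GRing.Theory Num.Theory.
Import numFieldNormedType.Exports.

Local Open Scope classical_set_scope.
Local Open Scope ring_scope.

(* Let [osc S] be the largest mean of |f - f_A| over A, for balls A containing
   the ball S; it is at most the sharp function of S.  Doubling bounds the
   difference of the means of f over two intersecting balls by [osc] times the
   logarithm of the ratio of their sizes, and summing this over the level sets
   of the volume distance gives

     int |f - f_A| phi_A <= C |w| osc A.

   Hence the maximal function at x is the supremum of the norms |f_A| over the
   balls A of G x, up to errors |w| osc A, and the family can be built from
   f alone: a ball A is a stopping ball for S when the mean of |f - f_S| over A
   exceeds a large multiple of [osc S].

   Stopping balls are chosen greedily, by decreasing size, over all balls chosen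
   before, and a point is always followed by the last chosen ball close to it.
   Because of this reassignment two chosen balls can only meet when one descends
   from the other or from a disjoint neighbour of it; as the children of S have
   total size at most a small multiple of the size of S, the family is sparse.

   Every point of B gets a path in the resulting tree.  A path ends at a ball
   for which the point is not bad, or is infinite: a point which is bad for S
   lies in finitely many children of S only, so that Koenig's lemma applies and
   there is no exceptional null set.  The set [bar S] consists of the points
   whose path goes through S.  Telescoping along the path of x bounds the
   maximal function at x by the sum over the path.

   Off the bad set of the top ball the maximal function is constant up to
   C |w| osc, which locates all the medians. *)

(** * Greedy selection *)

(** Every selected ball [A k] is used at three scales: the cores [A k] carry disjointness and
    sparseness, the zones [H (A k)] govern reassignment, and the hulls [H (H (A k))] are nested
    along the tree. Each use of [H] costs a factor [L], so the powers of [L] in the constants count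
    hulls. The operator [H] is made to more than double the size of a ball unless it reaches the
    whole space; the number of steps between two scales is then logarithmic.

    Two thresholds differing by a factor [L] occur: selection uses the lower one and badness the
    higher one, because a ball near a stopping ball is compared with it only through its own hull.

    The one-to-one map of the theorem asks for distinct sets [bar k], whereas sets defined by paths
    alone could coincide, for instance by being empty. A nonempty part [Y k] of each core is
    therefore assigned to [k] by decree. It exists because later cores and the bad set each take at
    most a quarter of the size of [A k]. *)

Lemma greedy_sequence (R : realType) (I : Type) (cand : seq (option I) -> I -> Prop)
    (sz : I -> R) (M : R) :
  (forall s x, cand s x -> 0 < sz x <= M) ->
  exists u : nat -> option I, forall n,
    match u n with
    | Some x => cand (mkseq u n) x /\
        forall y, cand (mkseq u n) y -> sz y <= 2 * sz x
    | None => forall y, ~ cand (mkseq u n) y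
    end.
Proof.
move=> szM.
have step s : exists o : option I, match o with
    | Some x => cand s x /\ forall y, cand s y -> sz y <= 2 * sz x
    | None => forall y, ~ cand s y
    end.
  have [[x0 cx0]|no] := pselect (exists x, cand s x); last first.
    by exists None => y cy; apply: no; exists y.
  (* The supremum of the sizes need not be attained; accepting more than half of it is the origin of
     the factor 2 in the maximality clause. *)
  pose E := [set sz x | x in cand s].
  have supE : has_sup E.
    split; first by exists (sz x0), x0.
    by exists M => _ [x cx <-]; case/andP: (szM _ _ cx).
  have E0 : 0 < sup E.
    apply: (@lt_le_trans _ _ (sz x0)); first by case/andP: (szM _ _ cx0).
    by apply: sup_upper_bound => //; exists x0.
  have [|_ [x cx <-] xlt] := @sup_adherent _ E (sup E / 2) _ supE.
    by rewrite divr_gt0.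
  exists (Some x); split => // y cy.
  have : sz y <= sup E by apply: sup_upper_bound => //; exists y.
  lra.
have [F FP] := choice step.
pose s n := iter n (fun s => rcons s (F s)) [::].
exists (fun n => F (s n)) => n.
suff -> : mkseq (fun n => F (s n)) n = s n by exact: FP.
elim: n => // n IH.
by rewrite mkseqS IH.
Qed.

(** * Axioms for hulls and stopping balls; existence of the greedy tree *)

Section Tree.
Context {T : Type} {R : realType}.
Variables (BB : set (set T)) (m : set T -> R) (H : set T -> set T) (L : R).
Implicit Types (A B S Q C : set T).

(** The measure enters the tree argument only through [exp_disjoint], so that everything reduces to
    finite sums of real sizes. [exp_swallow] stems from (B4) and [exp_double] from the doubling
    property. *)
Record expansion : Prop := Expansion {
  exp_ge2 : 2 <= L ;
  exp_gt0 : forall A, BB A -> 0 < m A ;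
  exp_mono : forall A Q, BB A -> BB Q -> A `<=` Q -> m A <= m Q ;
  exp_ball : forall A, BB A -> BB (H A) ;
  exp_sub : forall A, BB A -> A `<=` H A ;
  exp_le : forall A, BB A -> m (H A) <= L * m A ;
  exp_swallow : forall A C, BB A -> BB C -> C `&` A !=set0 ->
    m C <= 2 * m A -> C `<=` H A ;
  exp_double : forall A, BB A -> 2 * m A < m (H A) \/ H A = setT ;
  exp_disjoint : forall (A : nat -> set T) (P : pred nat) n Q, BB Q ->
    (forall k, (k < n)%N -> P k -> BB (A k) /\ A k `<=` Q) ->
    (forall j k, (j < k)%N -> (k < n)%N -> P j -> P k -> A j `&` A k = set0) ->
    \sum_(0 <= k < n | P k) m (A k) <= m Q }.

Variable st : set T -> set T -> Prop.

(** Of the factor [L ^+ 4], two powers pay for the hulls around a selected ball and two remain as a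
    gain per generation. Likewise [L ^+ 6] leaves [L ^+ 4] once hulls are replaced by cores, which
    is what [later_cores_sum] consumes. *)
Record stopping : Prop := Stopping {
  stop_ball : forall S A, BB S -> st S A -> BB A ;
  stop_size : forall S A, BB S -> st S A -> L ^+ 4 * m A <= m S ;
  stop_sum : forall S (A : nat -> set T) (P : pred nat) n, BB S ->
    (forall k, (k < n)%N -> P k -> st S (A k)) ->
    (forall j k, (j < k)%N -> (k < n)%N -> P j -> P k -> A j `&` A k = set0) ->
    16 * L ^+ 6 * \sum_(0 <= k < n | P k) m (A k) <= m S }.

(* A point follows the last chosen ball [A i] whose zone [H (A i)] contains it;
   the ball of the node [i] is [H (H (A i))]. *)
Definition candidate (act : pred nat) (A : nat -> set T) (t : nat) A' (j : nat) :=
  [/\ (j < t)%N, act j, st (H (H (A j))) A' &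
    exists x, [/\ A' x, H (A j) x &
      forall i, (j < i < t)%N -> act i -> ~ H (A i) x]].

Record greedy_tree B (act : pred nat) (A : nat -> set T) (l : nat -> nat) : Prop :=
  GreedyTree {
  greedy0 : act 0%N ;
  greedy_root : A 0%N = B ;
  greedy_ball : forall k, act k -> BB (A k) ;
  greedy_cand : forall k, (0 < k)%N -> act k -> candidate act A k (A k) (l k) ;
  greedy_max : forall k A' j, (0 < k)%N -> act k -> candidate act A k A' j ->
    m A' <= 2 * m (A k) ;
  greedy_stop : forall k A' j, (0 < k)%N -> ~~ act k -> ~ candidate act A k A' j }.

Hypothesis HE : expansion.
Hypothesis HS : stopping.

Let L2 := exp_ge2 HE.
Let m_gt0 := exp_gt0 HE.

Lemma stop_child_size A A' : BB A -> st (H (H A)) A' -> L ^+ 2 * m A' <= m A.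
Proof.
move=> bA sA; have bH := exp_ball HE bA; have bHH := exp_ball HE bH.
have := stop_size HS bHH sA.
have := exp_le HE bA; have := exp_le HE bH.
have := m_gt0 bA; have := m_gt0 bH; have := m_gt0 (stop_ball HS bHH sA).
move: L2 => hL h1 h2 h3 h4 h5 h6.
have h : L ^+ 4 * m A' <= L ^+ 2 * m A.
  apply: (le_trans h6); apply: (le_trans h4).
  by rewrite expr2 -mulrA ler_pM2l //; lra.
have L20 : 0 < L ^+ 2 by rewrite exprn_gt0 //; lra.
rewrite -(ler_pM2l L20); apply: le_trans h.
by rewrite mulrA -exprD.
Qed.

Lemma greedy_tree_exists B : BB B -> exists act (A : nat -> set T) l, greedy_tree B act A l.
Proof.
move=> bB.
(* A choice is a ball together with the index of its parent, and the first choice is forced to be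
   the root. The bound by [m B] is what [greedy_sequence] requires; it holds automatically by
   [stop_child_size]. *)
pose cand (s : seq (option (set T * nat))) (aj : set T * nat) : Prop :=
  if size s == 0%N then aj.1 = B else
  [/\ (aj.2 < size s)%N, m aj.1 <= m B &
   exists a l, [/\ nth None s aj.2 = Some (a, l), BB a, st (H (H a)) aj.1 &
     exists x, [/\ aj.1 x, H a x & forall i, (aj.2 < i < size s)%N ->
       forall b k, nth None s i = Some (b, k) -> ~ H b x]]].
have [|u uP] := @greedy_sequence R _ cand (fun aj => m aj.1) (m B).
  move=> s [a j]; rewrite /cand; case: ifP => _ /=.
    by move=> ->; rewrite m_gt0 //=.
  case=> _ -> [b] [k] [_ bb sb _]; rewrite m_gt0 //.
  by apply: (stop_ball HS _ sb); do 2 apply: (exp_ball HE).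
pose act k := isSome (u k).
pose A k := if u k is Some (a, _) then a else set0.
pose l k := if u k is Some (_, j) then j else 0%N.
have actE k : act k -> u k = Some (A k, l k).
  by rewrite /act /A /l; case: (u k) => // -[].
have nE n i : (i < n)%N -> nth None (mkseq u n) i = u i by move=> ?; rewrite nth_mkseq.
have act0 : act 0%N.
  rewrite /act; have := uP 0%N; case: (u 0%N) => [//|] h.
  by exfalso; apply: (h (B, 0%N)).
have A0 : A 0%N = B.
  by have := uP 0%N; rewrite (actE _ act0) /cand /= => -[].
have ball k : act k -> BB (A k) /\ m (A k) <= m B.
  move=> ak; have := uP k; rewrite (actE _ ak) /cand size_mkseq /=.
  case: ifP => [_|k0]; first by case=> -> _.
  case=> -[lk mk [a [j [_ ba sa _]]]] _; split => //.
  by apply: (stop_ball HS _ sa); do 2 apply: (exp_ball HE).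
have candE k A' j : (0 < k)%N -> candidate act A k A' j <-> cand (mkseq u k) (A', j).
  move=> k0; rewrite /candidate /cand size_mkseq /= (gtn_eqF k0); split.
    case=> jk aj sj [x [Ax Hx nx]]; split => //.
      apply: le_trans (ball _ aj).2; apply: le_trans (stop_child_size (ball _ aj).1 sj).
      rewrite ler_peMl //.
        rewrite ltW //; apply: m_gt0; apply: (stop_ball HS _ sj).
        by do 2 apply: (exp_ball HE); apply: (ball _ aj).1.
      by rewrite exprn_ege1 //; move: L2; lra.
    exists (A j), (l j); split => //; first by rewrite nE // actE.
      exact: (ball _ aj).1.
    exists x; split => // i ij b n; rewrite nE; last by case/andP: ij.
    move=> ui; have ai : act i by rewrite /act ui.
    by have := nx _ ij ai; rewrite /A ui.
  case=> jk mA [a [n [nj ba sa [x [Ax Hx nx]]]]].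
  move: nj; rewrite nE // => uj; have aj : act j by rewrite /act uj.
  have Aj : A j = a by rewrite /A uj.
  split => //; rewrite ?Aj //; exists x; split => // i ij ai.
  apply: (nx _ ij _ (l i)); rewrite nE; last by case/andP: ij.
  exact: actE.
exists act, A, l; split => //.
- by move=> k /ball[].
- move=> k k0 ak; apply/candE => //.
  by have := uP k; rewrite (actE _ ak) => -[].
- move=> k A' j k0 ak /candE => /(_ k0) c.
  by have := uP k; rewrite (actE _ ak) => -[_ /(_ _ c)].
- move=> k A' j k0 ak /candE => /(_ k0) c.
  have := uP k; move: ak; rewrite /act; case: (u k) => [//|_ h].
  exact: (h _ c).
Qed.

End Tree.

Lemma ler_sum_subpred (R : numDomainType) (I : Type) (r : seq I) (P Q : pred I)
    (F : I -> R) : (forall i, P i -> Q i) -> (forall i, Q i -> 0 <= F i) ->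
  \sum_(i <- r | P i) F i <= \sum_(i <- r | Q i) F i.
Proof.
move=> PQ F0; rewrite big_mkcond [leRHS]big_mkcond; apply: ler_sum => i _.
by case: ifPn => [/PQ -> //|_]; case: ifPn => // /F0.
Qed.

(** An empty ball taken twice would be a disjoint family, and [exp_disjoint] would give
    [2 * m A <= m A]. *)
Lemma ball_nonempty (T : Type) (R : realType) (BB : set (set T)) m H (L : R) A :
  expansion BB m H L -> BB A -> A !=set0.
Proof.
move=> HE bA; apply/set0P/eqP => A0.
have : \sum_(0 <= k < 2 | predT k) m A <= m A.
  apply: (exp_disjoint HE (A := fun=> A)) => //.
    by move=> k _ _; split.
  by move=> j k _ _ _ _; rewrite A0 setI0.
by rewrite big_const_nat /= addr0; have := exp_gt0 HE bA; lra.
Qed.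

(** * Geometry of the greedy tree *)

Section GreedyTree.
Context {T : Type} {R : realType}.
Variables (BB : set (set T)) (m : set T -> R) (H : set T -> set T) (L : R).
Variables (st : set T -> set T -> Prop) (B : set T).
Variables (act : pred nat) (A : nat -> set T) (l : nat -> nat).
Hypothesis HE : expansion BB m H L.
Hypothesis HS : stopping BB m L st.
Hypothesis G : greedy_tree BB m H st B act A l.

Let Z k := H (A k).
Let S k := H (H (A k)).
Let L2 : 2 <= L := exp_ge2 HE.
Let m_gt0 := exp_gt0 HE.
Let ballA := greedy_ball G.
Let ballZ k (ak : act k) : BB (Z k) := exp_ball HE (ballA ak).
Let ballS k (ak : act k) : BB (S k) := exp_ball HE (ballZ ak).

Let LL4 : 4 <= L ^+ 2.
Proof. by rewrite expr2; move: L2 => h; nra. Qed.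

Lemma greedy_parent k : (0 < k)%N -> act k ->
  [/\ (l k < k)%N, act (l k) & st (S (l k)) (A k)].
Proof. by move=> k0 ak; have [? ? ? _] := greedy_cand G k0 ak. Qed.

Lemma core_sub_zone k : act k -> A k `<=` Z k.
Proof. by move=> /ballA; apply: (exp_sub HE). Qed.

Lemma zone_sub_hull k : act k -> Z k `<=` S k.
Proof. by move=> /ballZ; apply: (exp_sub HE). Qed.

Lemma core_sub_hull k : act k -> A k `<=` S k.
Proof. by move=> ak x /(core_sub_zone ak); apply: zone_sub_hull. Qed.

Lemma core_le_hull k : act k -> m (A k) <= m (S k).
Proof.
by move=> ak; apply: (exp_mono HE (ballA ak) (ballS ak)); apply: core_sub_hull.
Qed.

Lemma hull_le_core k : act k -> m (S k) <= L ^+ 2 * m (A k).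
Proof.
move=> ak; have h1 := exp_le HE (ballA ak); have h2 := exp_le HE (ballZ ak).
apply: (le_trans h2); rewrite expr2 -mulrA ler_pM2l //; move: L2; lra.
Qed.

Lemma core_step k : (0 < k)%N -> act k -> L ^+ 2 * m (A k) <= m (A (l k)).
Proof.
move=> k0 ak; have [_ al sl] := greedy_parent k0 ak.
exact: (stop_child_size HE HS (ballA al) sl).
Qed.

(** If the parent of [k] precedes [j], then [A k] was already a candidate at time [j] and lost to
    [A j]. Otherwise the bound is inherited from the parent, which is at least [L ^+ 2] times
    larger. *)
Lemma core_decreasing j k : (j <= k)%N -> act j -> act k -> m (A k) <= 2 * m (A j).
Proof.
move=> + aj; elim/ltn_ind: k => k IH; rewrite leq_eqVlt => /orP[/eqP <- _|jk ak].
  by have := m_gt0 (ballA aj); lra.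
have k0 : (0 < k)%N by apply: leq_ltn_trans jk.
have [lk al sl] := greedy_parent k0 ak.
have [lj|jl] := ltnP (l k) j.
  apply: (greedy_max G (j := l k)) => //; first exact: leq_ltn_trans lj.
  have [_ _ _ [x [Ax Zx nx]]] := greedy_cand G k0 ak.
  split => //; exists x; split => // i /andP[i1 i2] ai; apply: nx => //.
  by rewrite i1 (ltn_trans i2).
have h1 := IH _ lk jl al; have h2 := core_step k0 ak.
have h3 := m_gt0 (ballA ak); move: LL4 => h4.
have : 4 * m (A k) <= L ^+ 2 * m (A k) by rewrite ler_wpM2r // ltW.
lra.
Qed.

Lemma hull_step k : (0 < k)%N -> act k -> L ^+ 2 * m (S k) <= m (S (l k)).
Proof.
move=> k0 ak; have [_ al sl] := greedy_parent k0 ak.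
apply: le_trans (stop_size HS (ballS al) sl).
have -> : L ^+ 4 = L ^+ 2 * L ^+ 2 by rewrite -exprD.
by rewrite -mulrA ler_pM2l ?hull_le_core //; move: LL4; lra.
Qed.

(** This is why the ball of a node is a double hull: the small ball [S k] meets the zone of the
    parent, and one more hull of that zone swallows it. *)
Lemma hull_nested k : (0 < k)%N -> act k -> S k `<=` S (l k).
Proof.
move=> k0 ak; have [_ al sl] := greedy_parent k0 ak.
apply: (exp_swallow HE (ballZ al) (ballS ak)).
  have [_ _ _ [x [Ax Zx _]]] := greedy_cand G k0 ak.
  by exists x; split => //; apply: core_sub_hull.
apply: (le_trans (hull_le_core ak)); apply: (le_trans (core_step k0 ak)).
have := exp_mono HE (ballA al) (ballZ al) (core_sub_zone al).
have := m_gt0 (ballZ al); lra.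
Qed.

(** The candidate [A k] owns a point outside the zone of [j]. Were it to meet [A j], being at most
    twice as large, it would lie entirely in that zone. *)
Lemma cores_disjoint j k : (l k < j)%N -> (j < k)%N -> act j -> act k ->
  A j `&` A k = set0.
Proof.
move=> lj jk aj ak; have [//|/set0P ne] := eqVneq (A j `&` A k) set0.
have k0 : (0 < k)%N by apply: leq_ltn_trans jk.
have [_ _ _ [x [Ax Zx nx]]] := greedy_cand G k0 ak.
exfalso; apply: (nx j); rewrite ?lj //.
apply: (exp_swallow HE (ballA aj) (ballA ak)) => //; first by rewrite setIC.
exact: core_decreasing (ltnW jk) aj ak.
Qed.

(** Siblings are compared through the ball of their parents, since one ball may be selected at
    several indices. If they met, [j] could not exceed [l k] by [cores_disjoint], so the core of
    [l k] would have at most twice the size of [A j], whereas [A j] is far smaller than the common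
    parent ball. *)
Lemma siblings_disjoint j k : (0 < j)%N -> (j < k)%N -> act j -> act k ->
  S (l j) = S (l k) -> A j `&` A k = set0.
Proof.
move=> j0 jk aj ak eqS; apply: contrapT => ne.
have k0 : (0 < k)%N by apply: leq_ltn_trans jk.
have [lk al _] := greedy_parent k0 ak; have [_ alj sl] := greedy_parent j0 aj.
have jl : (j <= l k)%N by rewrite leqNgt; apply/negP => lj; apply: ne; exact: cores_disjoint.
have h1 := core_decreasing jl aj al.
have h2 := hull_le_core al.
have h3 := stop_size HS (ballS alj) sl; rewrite eqS in h3.
have h4 := m_gt0 (ballS al); have h5 := m_gt0 (ballA aj).
have e4 : L ^+ 4 = L ^+ 2 * L ^+ 2 by rewrite -exprD.
rewrite e4 in h3; move: LL4 h1 h2 h3 h4 h5.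
move: (L ^+ 2) (m (A (l k))) (m (S (l k))) (m (A j)) => {eqS ne} a x y z *; nra.
Qed.

Lemma children_sum j n : act j ->
  16 * L ^+ 6 * \sum_(0 <= k < n | [&& (0 < k)%N, act k & `[< S (l k) = S j >]]) m (A k)
    <= m (S j).
Proof.
move=> aj; apply: (stop_sum HS (ballS aj)).
  by move=> k _ /and3P[k0 ak /asboolP <-]; have [] := greedy_parent k0 ak.
move=> i k ik _ /and3P[i0 ai /asboolP Si] /and3P[_ ak /asboolP Sk].
by apply: siblings_disjoint => //; rewrite Si Sk.
Qed.

(** Summing [children_sum] over the parents in [W] bounds the non-roots by a small part of the whole
    of [W]; absorbing them leaves the roots of [W] alone. *)
Lemma tree_sum (W : pred nat) n : (forall k, W k -> act k) ->
  15 * L ^+ 4 * \sum_(0 <= k < n | [&& W k, (0 < k)%N & W (l k)]) m (A k) <=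
  \sum_(0 <= k < n | W k && ~~ ((0 < k)%N && W (l k))) m (A k).
Proof.
move=> Wa.
set N := \sum_(0 <= k < n | _) _; set Rt := \sum_(0 <= k < n | _) _.
have WE : \sum_(0 <= k < n | W k) m (A k) = N + Rt.
  by rewrite (bigID (fun k => (0 < k)%N && W (l k))).
have Rt0 : 0 <= Rt.
  by apply: sumr_ge0 => k /andP[/Wa ak _]; apply/ltW/m_gt0/ballA.
have N0 : 0 <= N.
  by apply: sumr_ge0 => k /and3P[/Wa ak _ _]; apply/ltW/m_gt0/ballA.
have L40 : 0 < L ^+ 4 by rewrite exprn_gt0 //; move: L2; lra.
have L41 : 1 <= L ^+ 4 by rewrite exprn_ege1 //; move: L2; lra.
suff : 16 * L ^+ 4 * N <= N + Rt.
  by move: (L ^+ 4) L41 L40 => a *; nra.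
rewrite -WE /N big_mkord.
(* The sum is grouped by parents; since [l k < k < n], the default of [insubd] does not occur. *)
rewrite (partition_big (fun k : 'I_n => insubd k (l k)) (fun i : 'I_n => W i)); last first.
  move=> k /and3P[Wk k0 Wl]; rewrite val_insubd; case: ifP => //.
rewrite big_mkord mulr_sumr; apply: ler_sum => i Wi.
have L20 : 0 < L ^+ 2 by move: LL4; lra.
have Si := hull_le_core (Wa _ Wi).
rewrite -(ler_pM2l L20); apply: le_trans Si.
apply: le_trans (children_sum n (Wa _ Wi)).
rewrite mulrA [L ^+ 2 * _]mulrCA -exprD ler_pM2l; last first.
  by rewrite mulr_gt0 // exprn_gt0 //; move: L2; lra.
rewrite [leRHS]big_mkord; apply: ler_sum_subpred.
  move=> k /andP[/and3P[Wk k0 Wl] /eqP <-]; rewrite k0 Wa //=; apply/asboolP.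
  have [lk _ _] := greedy_parent k0 (Wa _ Wk).
  by rewrite val_insubd (ltn_trans lk).
by move=> k /and3P[_ ak _]; apply/ltW/m_gt0/ballA.
Qed.

Lemma core_sum n : \sum_(0 <= k < n | act k) m (A k) <= 2 * m B.
Proof.
have B0 : 0 < m B by rewrite -(greedy_root G); apply/m_gt0/ballA/(greedy0 G).
have L41 : 1 <= L ^+ 4 by rewrite exprn_ege1 //; move: L2; lra.
have := @tree_sum act n (fun _ => id).
rewrite [leLHS in _ -> leLHS <= _](bigID (fun k => (0 < k)%N && act (l k))) /=.
set N := \sum_(0 <= k < n | _) _; set Rt := \sum_(0 <= k < n | _) _ => h.
have N0 : 0 <= N.
  by apply: sumr_ge0 => k /and3P[ak _ _]; apply/ltW/m_gt0/ballA.
have Rt1 : Rt <= m B.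
  have E k : act k && ~~ ((0 < k)%N && act (l k)) -> k = 0%N.
    case/andP => ak; case: (posnP k) => //= k0.
    by have [_ -> _] := greedy_parent k0 ak.
  rewrite /Rt; case: (n) => [|n']; first by rewrite big_geq // ltW.
  rewrite big_mkcond big_nat_recl //= (greedy0 G) /= (greedy_root G) big1 ?addr0 //.
  by move=> k _; case: ifP => // /E.
by move: (L ^+ 4) L41 h N0 Rt1 => a *; nra.
Qed.

(** Infinitely many cores of size at least [e] would force every index to be active with size at
    least [e / 2], against the bounded total of [core_sum]. *)
Lemma core_small (e : R) : 0 < e -> exists n, forall k, (n <= k)%N -> act k -> m (A k) < e.
Proof.
move=> e0; apply: contrapT => /forallNP no.
have big n : exists k, [/\ (n <= k)%N, act k & e <= m (A k)].
  apply: contrapT => h; apply: (no n) => k nk ak.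
  by rewrite ltNge; apply/negP => ek; apply: h; exists k.
(* A ball chosen at time [n] was already a candidate at every time after its parent, so active
   indices form an initial segment. *)
have down n k : (k <= n)%N -> act n -> act k.
  elim/ltn_ind: n => n IH; rewrite leq_eqVlt => /orP[/eqP -> //|kn] an.
  case: (boolP (act k)) => // nk; exfalso.
  have n0 : (0 < n)%N by apply: leq_ltn_trans kn.
  have [ln al sl] := greedy_parent n0 an.
  have [kl|lk] := leqP k (l n); first by move: nk; rewrite (IH _ ln kl al).
  apply: (greedy_stop G (leq_ltn_trans _ lk) nk (A' := A n) (j := l n)) => //.
  have [_ _ _ [x [Ax Zx nx]]] := greedy_cand G n0 an.
  split => //; exists x; split => // i /andP[i1 i2] ai; apply: nx => //.
  by rewrite i1 (ltn_trans i2).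
have low k : act k /\ e / 2 <= m (A k).
  have [k' [kk' ak' ek']] := big k; have ak := down _ _ kk' ak'.
  by split => //; have := core_decreasing kk' ak ak'; lra.
pose n := (Num.truncn (4 * m B / e)).+1.
have B0 : 0 < m B by rewrite -(greedy_root G); apply/m_gt0/ballA/(greedy0 G).
have := core_sum n.
have : \sum_(0 <= k < n | act k) (e / 2) <= \sum_(0 <= k < n | act k) m (A k).
  by apply: ler_sum => k ak; case: (low k).
rewrite (eq_bigl predT); last by move=> k; case: (low k).
rewrite sumr_const_nat subn0 => h1 h2.
have : 4 * m B / e < n%:R by rewrite truncnS_gt.
rewrite ltr_pdivrMr // => h3.
move: (le_trans h1 h2); rewrite -mulr_natr => h4.
by nra.
Qed.

(** A stopping ball [D] containing [x] would remain a candidate at all later times, so every later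
    choice would exist and have at least half its size, contradicting [core_small]. *)
Lemma uncovered_not_stopping k x : act k -> Z k x ->
  (forall i, (k < i)%N -> act i -> ~ Z i x) -> forall D, st (S k) D -> ~ D x.
Proof.
move=> ak Zx nx D sD Dx.
have D0 := m_gt0 (stop_ball HS (ballS ak) sD).
have [|n nP] := @core_small (m D / 2); first by rewrite divr_gt0.
pose t := (maxn n k.+1).
have t0 : (0 < t)%N by rewrite leq_max orbT.
have c : candidate H st act A t D k.
  split => //; first by rewrite leq_max leqnn orbT.
  by exists x; split => // i /andP[ki _]; apply: nx.
case: (boolP (act t)) => [at_|nt]; last exact: (greedy_stop G t0 nt c).
have := greedy_max G t0 at_ c; have := nP t; rewrite leq_maxl => /(_ isT at_).
lra.
Qed.

(** The nodes [W] are those from [j] on whose hull meets [A j]. Roots of [W] have a parent before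
    [j], hence disjoint cores, and these fit into one ball of size at most [2 * L ^+ 4 * m (A j)].
    The later cores meeting [A j] are non-roots, which [tree_sum] makes smaller by a factor
    [15 * L ^+ 4]. *)
Lemma later_cores_sum j n : act j ->
  4 * \sum_(0 <= k < n | [&& (j < k)%N, act k & `[< A k `&` A j !=set0 >]]) m (A k)
    <= m (A j).
Proof.
move=> aj; have Aj0 := m_gt0 (ballA aj).
have [nj|jn] := leqP n j.
  rewrite big_nat_cond big1 ?mulr0 ?ltW // => k /and3P[/andP[_ kn] jk _].
  by move: (leq_trans (ltn_trans jk kn) nj); rewrite ltnn.
pose W k := [&& (j <= k)%N, act k & `[< S k `&` A j !=set0 >]].
have Wj : W j.
  rewrite /W leqnn aj /=; apply/asboolP; rewrite setIidr; last exact: core_sub_hull.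
  exact: (ball_nonempty HE (ballA aj)).
have Wa k : W k -> act k by case/and3P.
pose Rt k := W k && ~~ ((0 < k)%N && W (l k)).
have RtP k : Rt k -> (0 < k)%N -> (l k < j)%N.
  case/andP => /and3P[jk ak /asboolP[x [Sx Ax]]] nW k0; move: nW; rewrite k0 /=.
  have [lk al _] := greedy_parent k0 ak.
  rewrite /W al /= ltnNge; apply: contra => ->; apply/asboolP; exists x; split => //.
  exact: (hull_nested k0 ak).
have sumRt : \sum_(0 <= k < n | Rt k) m (A k) <= 2 * L ^+ 4 * m (A j).
  (* The largest hull of [W] swallows [A j] after one [H]; a second [H] then swallows every other
     hull of [W]. *)
  case: (@arg_maxP _ R 'I_n (Ordinal jn) W (fun k => m (S k)) Wj) => i /= Wi imax.
  have ai := Wa _ Wi.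
  have AjSi : A j `<=` H (S i).
    apply: (exp_swallow HE (ballS ai) (ballA aj)).
      by have /and3P[_ _ /asboolP] := Wi; rewrite setIC.
    have := imax (Ordinal jn) Wj; have := core_le_hull aj; rewrite /=.
    by have := m_gt0 (ballS ai); lra.
  have bHSi := exp_ball HE (ballS ai).
  have RtQ k : (k < n)%N -> Rt k -> BB (A k) /\ A k `<=` H (H (S i)).
    move=> kn /andP[Wk _]; have ak := Wa _ Wk; split; first exact: ballA.
    apply: (@subset_trans _ (S k)); first exact: core_sub_hull.
    apply: (exp_swallow HE bHSi (ballS ak)).
      have /and3P[_ _ /asboolP[x [Sx Ax]]] := Wk; exists x; split => //.
      exact: AjSi.
    have := imax (Ordinal kn) Wk; rewrite /=.
    have := exp_mono HE (ballS ai) bHSi (exp_sub HE (ballS ai)).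
    have := m_gt0 bHSi; lra.
  have := exp_disjoint HE (exp_ball HE bHSi) RtQ.
  move=> /(_ _)/le_trans; apply.
    move=> k k' kk' kn Rk Rk'; apply: cores_disjoint => //.
    - apply: leq_trans (RtP _ Rk' _) _; first exact: leq_ltn_trans kk'.
      by case/andP: Rk => /and3P[].
    - by case/andP: Rk => /Wa.
    - by case/andP: Rk' => /Wa.
  apply: (le_trans (exp_le HE bHSi)).
  have L0 : 0 < L by move: L2; lra.
  have h1 := exp_le HE (ballS ai); have h2 := hull_le_core ai.
  have h3 : m (A i) <= 2 * m (A j).
    by apply: core_decreasing => //; case/and3P: Wi.
  have -> : 2 * L ^+ 4 * m (A j) = L * (L * (L ^+ 2 * (2 * m (A j)))) by ring.
  rewrite ler_pM2l //; apply: (le_trans h1); rewrite ler_pM2l //.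
  by apply: (le_trans h2); rewrite ler_pM2l //; move: LL4; lra.
(* A root of [W] after [j] has its parent before [j], so [cores_disjoint] separates its core from
   [A j]. *)
have sumN : \sum_(0 <= k < n | [&& (j < k)%N, act k & `[< A k `&` A j !=set0 >]]) m (A k)
    <= \sum_(0 <= k < n | [&& W k, (0 < k)%N & W (l k)]) m (A k).
  apply: ler_sum_subpred => k; last by case/and3P => /Wa ak _ _; apply/ltW/m_gt0/ballA.
  case/and3P => jk ak /asboolP[x [Akx Ajx]].
  have Wk : W k.
    rewrite /W (ltnW jk) ak; apply/asboolP; exists x; split => //.
    exact: core_sub_hull.
  have k0 : (0 < k)%N by apply: leq_ltn_trans jk.
  rewrite Wk k0 /=; case: (boolP (W (l k))) => // nW.
  have lj : (l k < j)%N by apply: RtP => //; rewrite /Rt Wk k0.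
  by have := cores_disjoint lj jk aj ak; rewrite -subset0 => /(_ x (conj Ajx Akx)).
have L41 : 0 < L ^+ 4 by rewrite exprn_gt0 //; move: L2; lra.
have := le_trans (tree_sum n Wa) sumRt.
have -> : 15 * L ^+ 4 * \sum_(0 <= k < n | [&& W k, (0 < k)%N & W (l k)]) m (A k) =
  L ^+ 4 * (15 * \sum_(0 <= k < n | [&& W k, (0 < k)%N & W (l k)]) m (A k)) by ring.
have -> : 2 * L ^+ 4 * m (A j) = L ^+ 4 * (2 * m (A j)) by ring.
rewrite ler_pM2l // => h.
have : 0 <= \sum_(0 <= k < n | [&& W k, (0 < k)%N & W (l k)]) m (A k).
  by apply: sumr_ge0 => k /and3P[/Wa ak _ _]; apply/ltW/m_gt0/ballA.
by move: h sumN; lra.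
Qed.

End GreedyTree.

(** * The tree of distinct selected balls *)

Record node_tree {T : Type} {R : realType} (BB : set (set T)) (m : set T -> R)
    (H : set T -> set T) (L : R) (st : set T -> set T -> Prop) (B : set T)
    (node : pred nat) (A : nat -> set T) (p : nat -> nat) : Prop := NodeTree {
  node0 : node 0%N ;
  node_root : A 0%N = B ;
  node_ball : forall k, node k -> BB (A k) ;
  node_parent : forall k, (0 < k)%N -> node k ->
    [/\ (p k < k)%N, node (p k) & st (H (H (A (p k)))) (A k)] ;
  node_nested : forall k, (0 < k)%N -> node k -> H (H (A k)) `<=` H (H (A (p k))) ;
  node_step : forall k, (0 < k)%N -> node k ->
    L ^+ 2 * m (H (H (A k))) <= m (H (H (A (p k)))) ;
  node_inj : forall j k, node j -> node k -> H (H (A j)) = H (H (A k)) -> j = k ;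
  node_children : forall j n, node j ->
    16 * L ^+ 6 * \sum_(0 <= k < n | [&& (0 < k)%N, node k & p k == j]) m (A k)
      <= m (H (H (A j))) ;
  node_small : forall e : R, 0 < e ->
    exists n, forall k, (n <= k)%N -> node k -> m (A k) < e ;
  node_later : forall j n, node j ->
    4 * \sum_(0 <= k < n | [&& (j < k)%N, node k & `[< A k `&` A j !=set0 >]]) m (A k)
      <= m (A j) ;
  node_cover : forall x, B x ->
    (exists k, [/\ node k, H (H (A k)) x &
        forall D, st (H (H (A k))) D -> ~ D x]) \/
    (forall n, exists k, [/\ (n <= k)%N, node k & H (H (A k)) x]) }.

Section NodeTree.
Context {T : Type} {R : realType}.
Variables (BB : set (set T)) (m : set T -> R) (H : set T -> set T) (L : R).
Variables (st : set T -> set T -> Prop) (B : set T).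
Hypothesis HE : expansion BB m H L.
Hypothesis HS : stopping BB m L st.

(* The same ball may be selected several times; only its first occurrence
   becomes a node, as [bar] has to be indexed by distinct balls. *)
Lemma node_tree_exists : BB B ->
  exists node (A : nat -> set T) p, node_tree BB m H L st B node A p.
Proof.
move=> /(greedy_tree_exists HE HS)[act [A [l G]]].
pose S k := H (H (A k)).
pose a k := find (fun i => act i && `[< S i = S k >]) (iota 0 k.+1).
have aP k : act k -> [/\ act (a k), S (a k) = S k, (a k <= k)%N &
    forall i, (i < a k)%N -> act i -> S i <> S k].
  move=> ak; have hs : has (fun i => act i && `[< S i = S k >]) (iota 0 k.+1).
    by apply/hasP; exists k; rewrite ?mem_iota ?ltnSn // ak; apply/asboolP.
  have ak1 : (a k < k.+1)%N by have := hs; rewrite has_find size_iota.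
  have := nth_find 0%N hs; rewrite -/(a k) nth_iota // add0n => /andP[-> /asboolP ->].
  split => // i ia ai Si; have ik : (i < k.+1)%N by apply: ltn_trans ak1.
  have := before_find 0%N ia; rewrite nth_iota // add0n ai /= => /asboolP; exact.
pose node k := act k && (a k == k).
pose p k := a (l k).
have nodeA k : node k -> act k by case/andP.
have node_a k : act k -> node (a k).
  move=> /[dup] ak /aP[aak Sak _ mn]; rewrite /node aak eqn_leq.
  have [aaak Saak -> _] := aP _ aak; rewrite leqNgt /=; apply/negP => lt.
  by apply: (mn _ lt) => //; rewrite Saak.
have parent k : (0 < k)%N -> node k -> [/\ act (l k), S (p k) = S (l k), (p k < k)%N &
    node (p k)].
  move=> k0 /nodeA ak; have [lk al _] := greedy_parent G k0 ak.
  have [_ Sl le _] := aP _ al; split => //; last exact: node_a.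
  exact: leq_ltn_trans le lk.
have L0 : 2 <= L := exp_ge2 HE.
have posL n : 0 < L ^+ n by rewrite exprn_gt0 //; lra.
have ballA k : act k -> BB (A k) := @greedy_ball _ _ _ _ _ _ _ _ _ _ G k.
exists node, A, p; split.
- rewrite /node (greedy0 G); have [_ _] := aP _ (greedy0 G).
  by rewrite leqn0 => ->.
- exact: greedy_root G.
- by move=> k /nodeA; exact: ballA.
- move=> k k0 nk; have [al Sp pk np] := parent _ k0 nk; split => //.
  by rewrite -/(S _) Sp; have [] := greedy_parent G k0 (nodeA _ nk).
- move=> k k0 nk; have [al Sp pk np] := parent _ k0 nk; rewrite -!/(S _) Sp.
  exact: (hull_nested HE HS G k0 (nodeA _ nk)).
- move=> k k0 nk; have [al Sp pk np] := parent _ k0 nk; rewrite -!/(S _) Sp.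
  exact: (hull_step HE HS G k0 (nodeA _ nk)).
- have le j k : node j -> node k -> S j = S k -> (j <= k)%N.
    move=> nj nk Sjk; rewrite leqNgt; apply/negP => kj.
    case/andP: nj => aj /eqP ajj; have [_ _ _] := aP _ aj; rewrite ajj => /(_ _ kj).
    by move/(_ (nodeA _ nk)); rewrite Sjk.
  move=> j k nj nk Sjk; apply/eqP; rewrite eqn_leq !le //.
- move=> j n nj; apply: le_trans (children_sum HE HS G n (nodeA _ nj)).
  rewrite ler_pM2l; last by apply: mulr_gt0 (posL _).
  apply: ler_sum_subpred => k.
    case/and3P => k0 nk /eqP pk; have [al Sp _ _] := parent _ k0 nk.
    by rewrite k0 nodeA //=; apply/asboolP; rewrite -/(S _) -Sp pk.
  by case/and3P => _ ak _; apply/ltW/(exp_gt0 HE)/ballA.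
- move=> e e0; have [n nP] := core_small HE HS G e0.
  by exists n => k nk /nodeA; apply: nP.
- move=> j n nj; apply: le_trans (later_cores_sum HE HS G n (nodeA _ nj)).
  rewrite ler_pM2l //; apply: ler_sum_subpred => k.
    by case/and3P => -> /nodeA -> ->.
  by case/and3P => _ ak _; apply/ltW/(exp_gt0 HE)/ballA.
- move=> x Bx.
  have Z0 : H (A 0%N) x by apply: (core_sub_zone HE G (greedy0 G)); rewrite (greedy_root G).
  (* Either [x] lies in a last zone, whose node has no stopping ball through [x], or it lies in
     zones of arbitrarily late indices. *)
  have [[N NP]|un] := pselect (exists N, forall k, (N < k)%N -> act k -> ~ H (A k) x).
    left; have exk : exists k, act k && `[< H (A k) x >].
      by exists 0%N; rewrite (greedy0 G); apply/asboolP.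
    have ubk k : act k && `[< H (A k) x >] -> (k <= N)%N.
      by case/andP => ak /asboolP Zk; rewrite leqNgt; apply/negP => /NP /(_ ak).
    case: (ex_maxnP exk ubk) => k /andP[ak /asboolP Zk] kmax.
    have [_ Sak _ _] := aP _ ak.
    exists (a k); split; first exact: node_a.
      by rewrite -/(S _) Sak; apply: (zone_sub_hull HE G ak).
    rewrite -/(S _) Sak; apply: (uncovered_not_stopping HE HS G ak Zk).
    move=> i ki ai Zi; have := kmax i; rewrite ai leqNgt ki => /(_ _)/negP; apply => //.
    by apply/asboolP.
  right=> n.
  (* The hulls at the first [n] indices have sizes bounded below, so the hull of a sufficiently late
     zone is a ball whose first occurrence is beyond [n]. *)
  have [e e0 eP] : exists2 e, 0 < e & forall i, (i < n)%N -> act i -> e <= m (S i).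
    elim: n => [|n [e e0 IH]]; first by exists 1.
    have [an|nan] := boolP (act n); last first.
      exists e => // i; rewrite ltnS leq_eqVlt => /orP[/eqP ->|]; last exact: IH.
      by rewrite (negPf nan).
    have Sn0 : 0 < m (S n) by apply: (exp_gt0 HE); do 2 apply: (exp_ball HE); exact: ballA.
    exists (Num.min e (m (S n))); first by rewrite lt_min e0.
    move=> i; rewrite ltnS leq_eqVlt => /orP[/eqP ->|ni ai]; first by rewrite ge_min lexx orbT.
    by rewrite ge_min IH.
  have [|N NP] := core_small HE HS G (e := e / L ^+ 2); first by rewrite divr_gt0 ?posL.
  have [k [Nk ak Zk]] : exists k, [/\ (N <= k)%N, act k & H (A k) x].
    apply: contrapT => h; apply: un; exists N => k Nk ak Zk; apply: h; exists k; split => //.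
    exact: ltnW.
  have [_ Sak _ _] := aP _ ak.
  exists (a k); split; [|exact: node_a|].
    rewrite leqNgt; apply/negP => an; have [aak _ _ _] := aP _ ak.
    have := eP _ an aak; rewrite Sak; apply/negP; rewrite -ltNge.
    apply: le_lt_trans (hull_le_core HE G ak) _.
    by have := NP _ Nk ak; rewrite ltr_pdivlMr // mulrC.
  by rewrite -/(S _) Sak; apply: (zone_sub_hull HE G ak).
Qed.

End NodeTree.

(** * Paths in the tree *)

Section TreePaths.
Context {d : measure_display} {T : measurableType d} {R : realType}.
Variables (BB : set (set T)) (m : set T -> R) (H : set T -> set T) (L : R).
Variables (st : set T -> set T -> Prop) (B : set T) (bad : set T -> set T).
Variables (node : pred nat) (A : nat -> set T) (p : nat -> nat).
Hypothesis HE : expansion BB m H L.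
Hypothesis NT : node_tree BB m H L st B node A p.

Let S k := H (H (A k)).
(** The points reserved for [k]. Removing later cores makes these sets disjoint, and removing the
    bad set allows a path to end at [k] there. *)
Let Y k := A k `\` (\bigcup_(t in [set t | (k < t)%N && node t]) A t `|` bad (S k)).

Hypothesis ball_meas : forall C, BB C -> measurable C.
Hypothesis bad_meas : forall k, node k -> measurable (bad (S k)).
Hypothesis bad_stop : forall k x, node k -> S k x ->
  (forall D, st (S k) D -> ~ D x) -> ~ bad (S k) x.
Hypothesis bad_finite : forall k x, node k -> bad (S k) x ->
  exists n, forall i, (n <= i)%N -> (0 < i)%N -> node i -> p i = k -> ~ S i x.
Hypothesis Y_nonempty : forall k, node k -> Y k !=set0.

Let q k := if k == 0%N then 0%N else p k.
Definition ancestor j k := exists n, iter n q k = j.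

Let ballA k : node k -> BB (A k) := @node_ball _ _ _ _ _ _ _ _ _ _ _ NT k.
Let ballS k : node k -> BB (S k).
Proof. by move=> nk; do 2 apply: (exp_ball HE); apply: ballA. Qed.

Let A_sub_S k : node k -> A k `<=` S k.
Proof.
move=> /ballA bA; apply: subset_trans (exp_sub HE (exp_ball HE bA)).
exact: (exp_sub HE bA).
Qed.

Let measA k : node k -> measurable (A k). Proof. by move/ballA/ball_meas. Qed.
Let measS k : node k -> measurable (S k). Proof. by move/ballS/ball_meas. Qed.

Let q_pos k : (0 < k)%N -> q k = p k. Proof. by rewrite /q; case: k. Qed.

Let node_q k : node k -> node (q k).
Proof.
case: (posnP k) => [-> //|k0] nk; rewrite q_pos //.
by have [] := node_parent NT k0 nk.
Qed.

Let q_le k : node k -> (q k <= k)%N.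
Proof.
case: (posnP k) => [-> //|k0] nk; rewrite q_pos //.
by have [/ltnW] := node_parent NT k0 nk.
Qed.

Lemma ancestor_refl k : ancestor k k. Proof. by exists 0%N. Qed.

Lemma ancestor_trans i j k : ancestor i j -> ancestor j k -> ancestor i k.
Proof. by move=> [a <-] [b <-]; exists (a + b)%N; rewrite iterD. Qed.

Lemma ancestor_parent k : (0 < k)%N -> ancestor (p k) k.
Proof. by move=> k0; exists 1%N; rewrite /= q_pos. Qed.

Lemma ancestor_node j k : node k -> ancestor j k -> node j.
Proof. by move=> nk [n <-]; elim: n => //= n; apply: node_q. Qed.

Lemma ancestor_le j k : node k -> ancestor j k -> (j <= k)%N.
Proof.
move=> nk [n <-]; elim: n => //= n IH; apply: leq_trans IH.
by apply: q_le; apply: (ancestor_node nk); exists n.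
Qed.

Lemma ancestorP j k : ancestor j k -> j = k \/ ((0 < k)%N /\ ancestor j (p k)).
Proof.
case=> n; elim: n k => [|n IH] k; first by left.
rewrite iterSr; case: (posnP k) => [->|k0].
  have it0 i : iter i q 0 = 0%N by elim: i => //= i ->.
  by rewrite -iterSr it0 => <-; left.
by rewrite q_pos // => e; right; split => //; exists n.
Qed.

Lemma ancestor0 k : node k -> ancestor 0%N k.
Proof.
elim/ltn_ind: k => k IH nk; case: (posnP k) => [->|k0]; first exact: ancestor_refl.
have [pk np _] := node_parent NT k0 nk.
exact: (ancestor_trans (IH _ pk np) (ancestor_parent k0)).
Qed.

Lemma ancestor_total i j k : node k -> ancestor i k -> ancestor j k -> (i <= j)%N ->
  ancestor i j.
Proof.
move=> nk [a ia] [b jb] ij; have [ab|ba] := leqP b a.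
  by exists (a - b)%N; rewrite -jb -iterD subnK.
have ji : ancestor j i by exists (b - a)%N; rewrite -ia -iterD subnK // ltnW.
have ni : node i by apply: (ancestor_node nk); exists a.
have : (i == j) by rewrite eqn_leq ij (ancestor_le ni ji).
by move/eqP->; apply: ancestor_refl.
Qed.

Lemma ancestor_child j k : node k -> ancestor j k -> j <> k ->
  exists i, [/\ (0 < i)%N, node i, p i = j & ancestor i k].
Proof.
elim/ltn_ind: k => k IH nk jk ne; have [//|[k0 jpk]] := ancestorP jk.
have [pk np _] := node_parent NT k0 nk.
have [e|ne'] := eqVneq (p k) j; first by exists k; split => //; exact: ancestor_refl.
have [|i [i0 ni pi ipk]] := IH _ pk np jpk; first by move/esym/eqP; rewrite (negPf ne').
exists i; split => //; apply: (ancestor_trans ipk); exact: ancestor_parent.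
Qed.

Lemma ancestor_nested j k : node k -> ancestor j k -> S k `<=` S j.
Proof.
elim/ltn_ind: k => k IH nk jk; have [->//|[k0 jpk]] := ancestorP jk.
have [pk np _] := node_parent NT k0 nk.
exact: subset_trans (node_nested NT k0 nk) (IH _ pk np jpk).
Qed.

(* The points of [S k] from which a path below [k] can be continued: either some
   descendant is a legitimate end point, or there are infinitely many
   descendants and a path is found by Koenig's argument. *)
Definition viable k : set T := S k `&`
  (\bigcup_(i in [set i | node i /\ ancestor k i]) (S i `\` bad (S i)) `|`
   \bigcap_n \bigcup_(i in [set i | [/\ (n <= i)%N, node i & ancestor k i]]) S i).

(** From a bad point the path moves to the viable child of least index. This choice is measurable
    and makes the path unique. *)
Definition step k : set T := (bad (S (p k)) `&` viable k) `\`
  \bigcup_(i in [set i | [/\ (0 < i)%N, (i < k)%N, node i & p i = p k]]) viable i.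

Definition greedy_path k : set T :=
  B `&` \bigcap_(j in [set j | (0 < j)%N /\ ancestor j k]) step j.

(** Reserved points do not follow their greedy path: a point of [Y i] is sent down the branch
    leading to [i], hence belongs to the bars of all ancestors of [i] and to no others. *)
Definition bar k : set T :=
  (greedy_path k `\` \bigcup_(i in node) Y i) `|`
  \bigcup_(i in [set i | node i /\ ancestor k i]) Y i.

Let measB : measurable B.
Proof. by rewrite -(node_root NT); apply: measA; exact: node0 NT. Qed.

Let measY k : node k -> measurable (Y k).
Proof.
move=> nk; apply: measurableD; first exact: measA.
apply: measurableU; last exact: bad_meas.
by apply: bigcup_measurable => i /andP[_ ni]; exact: measA.
Qed.

Lemma measurable_viable k : node k -> measurable (viable k).
Proof.
move=> nk; apply: measurableI; first exact: measS.
apply: measurableU.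
  by apply: bigcup_measurable => i [ni _]; apply: measurableD; [exact: measS|exact: bad_meas].
apply: bigcap_measurable => [|n _]; first by exists 0%N.
by apply: bigcup_measurable => i [_ ni _]; exact: measS.
Qed.

Lemma measurable_bar k : node k -> measurable (bar k).
Proof.
move=> nk; apply: measurableU; last first.
  by apply: bigcup_measurable => i [ni _]; exact: measY.
apply: measurableD; last by apply: bigcup_measurable => i ni; exact: measY.
apply: measurableI => //.
have [->|] := eqVneq [set j | (0 < j)%N /\ ancestor j k] set0.
  by rewrite bigcap_set0.
move=> /set0P ne; apply: bigcap_measurable => // j [j0 jk].
have nj := ancestor_node nk jk; have [_ np _] := node_parent NT j0 nj.
apply: measurableD.
  by apply: measurableI; [exact: bad_meas|exact: measurable_viable].
by apply: bigcup_measurable => i [_ _ ni _]; exact: measurable_viable.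
Qed.

Let Y_disjoint j k x : node j -> node k -> Y j x -> Y k x -> j = k.
Proof.
have lt i l : node l -> (i < l)%N -> Y i x -> Y l x -> False.
  by move=> nl il [_ n1] [Al _]; apply: n1; left; exists l => //=; rewrite il.
move=> nj nk Yj Yk; case: (ltngtP j k) => // h; exfalso.
  exact: (lt _ _ nk h).
exact: (lt _ _ nj h).
Qed.

Lemma bar_sub_hull k : node k -> bar k `<=` S k.
Proof.
move=> nk x [[[Bx px] _]|[i [ni ki] [Ai _]]]; last first.
  by apply: (ancestor_nested ni ki); apply: A_sub_S.
case: (posnP k) => [->|k0].
  by apply: (A_sub_S (node0 NT)); rewrite (node_root NT).
by have [] := px k (conj k0 (ancestor_refl k)) => -[_ []].
Qed.

Lemma bar_root : B `<=` bar 0%N.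
Proof.
move=> x Bx; have [[i ni Yi]|nY] := pselect ((\bigcup_(i in node) Y i) x).
  by right; exists i => //; split => //; exact: ancestor0.
left; split => //; split => // j [j0 j0'].
by have := ancestor_le (node0 NT) j0'; rewrite leqNgt j0.
Qed.

Lemma bar_parent k : (0 < k)%N -> node k -> bar k `<=` bar (p k).
Proof.
move=> k0 nk x [[[Bx px] nY]|[i [ni ki] Yi]].
  left; split => //; split => // j [j0 jk]; apply: px; split => //.
  by apply: (ancestor_trans jk); exact: ancestor_parent.
right; exists i => //; split => //; apply: ancestor_trans ki.
exact: ancestor_parent.
Qed.

(** On greedy paths, if [j] were not an ancestor of [k], the branch of [j] would contain a sibling
    of an ancestor of [k], viable at [x] and of smaller index, against the minimality in [step]. *)
Lemma bar_ancestor j k x : node j -> node k -> (j <= k)%N -> bar j x -> bar k x ->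
  ancestor j k.
Proof.
move=> nj nk jk [[Pj nYj]|[i [ni ji] Yi]] [[Pk nYk]|[i' [ni' ki] Yi']]; last first.
- have e : i = i' by exact: Y_disjoint Yi Yi'.
  by rewrite -e in ki; exact: (ancestor_total ni ji ki jk).
- by exfalso; apply: nYk; exists i.
- by exfalso; apply: nYj; exists i'.
elim/ltn_ind: k j nj nk jk Pj {nYj nYk} Pk => k IH j nj nk; rewrite leq_eqVlt.
move=> /orP[/eqP -> _ _|jk [Bx Pj] [_ Pk]]; first exact: ancestor_refl.
have k0 : (0 < k)%N by apply: leq_ltn_trans jk.
have [pk np _] := node_parent NT k0 nk.
have Pp : greedy_path (p k) x.
  split => // i [i0 ip]; apply: Pk; split => //.
  by apply: (ancestor_trans ip); exact: ancestor_parent.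
have [jp|pj] := leqP j (p k).
  apply: ancestor_trans (ancestor_parent k0).
  by apply: IH.
have pja : ancestor (p k) j by apply: IH => //; exact: ltnW.
have [|i [i0 ni pi ij]] := ancestor_child nj pja.
  by move=> e; move: pj; rewrite e ltnn.
have [[_ Vi] _] := Pj i (conj i0 ij).
have [_ nV] := Pk k (conj k0 (ancestor_refl k)); exfalso; apply: nV.
exists i => //; split => //; apply: leq_ltn_trans jk; exact: ancestor_le ij.
Qed.

(** A reserved point of [i] lies in [bar l] only if [l] is an ancestor of [i], which excludes
    [i < l]. *)
Lemma bar_inj j k : node j -> node k -> bar j = bar k -> j = k.
Proof.
have lt i l : node i -> (i < l)%N -> bar i <> bar l.
  move=> ni il e; have [y Yy] := Y_nonempty ni.
  have : bar i y by right; exists i => //; split => //; exact: ancestor_refl.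
  rewrite e => -[[_ nY]|[i' [ni' li] Yi']]; first by apply: nY; exists i.
  have := ancestor_le ni' li; rewrite -(Y_disjoint ni ni' Yy Yi').
  by rewrite leqNgt il.
move=> nj nk e; case: (ltngtP j k) => // h; exfalso.
  exact: (lt _ _ nj h).
by apply: (lt _ _ nk h).
Qed.

(** The step of Koenig's lemma. An end point below [k] cannot be [k] itself, where [x] is bad, so it
    lies below a child. With infinitely many descendants around [x], one of the finitely many
    children containing [x] inherits infinitely many. *)
Lemma viable_child k x : node k -> bad (S k) x -> viable k x ->
  exists i, [/\ (0 < i)%N, node i, p i = k & viable i x].
Proof.
move=> nk bx [Sx [[k' [nk' kk'] [Sk' nb]]|inf]].
  have [|i [i0 ni pi ik']] := ancestor_child nk' kk'.
    by move=> e; apply: nb; rewrite -e.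
  exists i; split => //; split; first exact: (ancestor_nested nk' ik').
  by left; exists k'.
have [n nP] := bad_finite nk bx.
apply: contrapT => no.
have fin i : exists N, forall k', (N <= k')%N -> node k' -> ancestor i k' ->
    (0 < i)%N -> node i -> p i = k -> ~ S k' x.
  apply: contrapT => h; apply: no; exists i.
  have h1 N : exists k', [/\ (N <= k')%N, node k', ancestor i k' & S k' x] /\
      [/\ (0 < i)%N, node i & p i = k].
    apply: contrapT => h2; apply: h; exists N => k' Nk' nk' ik' i0 ni pi Sk'.
    by apply: h2; exists k'.
  have [k' [[_ nk' ik' Sk'] [i0 ni pi]]] := h1 0%N; split => //; split.
    exact: (ancestor_nested nk' ik').
  right=> N _; have [k'' [[? ? ? ?] _]] := h1 N.
  by exists k''.
(* If no child were viable, each would have only finitely many descendants around [x]; [N] exceeds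
   them all for the children of index below [n], the only ones containing [x]. *)
have [N NP] : exists N, forall i, (i < n)%N -> forall k', (N <= k')%N -> node k' ->
    ancestor i k' -> (0 < i)%N -> node i -> p i = k -> ~ S k' x.
  elim: n {nP} => [|n [N NP]]; first by exists 0%N.
  have [N' N'P] := fin n; exists (maxn N N') => i; rewrite ltnS leq_eqVlt.
  move=> /orP[/eqP ->|ni] k'; rewrite geq_max => /andP[h1 h2]; [exact: N'P|exact: NP].
have [k' [Nk' nk' kk'] Sk'] := inf (maxn N k.+1) I.
move: Nk'; rewrite geq_max => /andP[Nk' ltk].
have [|i [i0 ni pi ik']] := ancestor_child nk' kk'.
  by move=> e; move: ltk; rewrite e ltnn.
have [ini|ni'] := leqP n i.
  by apply: (nP i) => //; apply: (ancestor_nested nk' ik').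
exact: (NP _ ni' k').
Qed.

(** A reserved point ends at its own node. Any other point follows viable children, and as long as
    it is bad the path can be continued. *)
Lemma bar_path x : B x ->
  (exists k, [/\ node k, bar k x & ~ bad (S k) x]) \/
  (forall n, exists k, [/\ (n <= k)%N, node k & bar k x]).
Proof.
move=> Bx; have [[i ni Yi]|nY] := pselect ((\bigcup_(i in node) Y i) x).
  left; exists i; split => //.
    by right; exists i => //; split => //; exact: ancestor_refl.
  by have [_ h] := Yi => b; apply: h; right.
have [ex|no] := pselect (exists k, [/\ node k, bar k x & ~ bad (S k) x]); [by left|right].
have badx k : node k -> greedy_path k x -> bad (S k) x.
  move=> nk pk; apply: contrapT => nb; apply: no; exists k; split => //.
  by left.
have V0 : viable 0%N x.
  split; first by apply: (A_sub_S (node0 NT)); rewrite (node_root NT).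
  have [[k [nk Sk sk]]|inf] := node_cover NT Bx.
    left; exists k; first by split => //; exact: ancestor0.
    by split => //; apply: bad_stop.
  right=> n _; have [k [nk ? ?]] := inf n; exists k => //; split => //.
  exact: ancestor0.
have P0 : greedy_path 0%N x.
  split => // j [j0 j0'].
  by have := ancestor_le (node0 NT) j0'; rewrite leqNgt j0.
have next k : node k -> greedy_path k x -> viable k x ->
    exists i, [/\ (k < i)%N, node i, greedy_path i x & viable i x].
  move=> nk pk Vk; have [i [i0 ni pi Vi]] := viable_child nk (badx _ nk pk) Vk.
  have ex : exists i, [&& (0 < i)%N, node i, p i == k & `[< viable i x >]].
    by exists i; rewrite i0 ni pi eqxx; apply/asboolP.
  case: (ex_minnP ex) => {i i0 ni pi Vi} i /and4P[i0 ni /eqP pi /asboolP Vi] imin.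
  exists i; split => //; first by have [] := node_parent NT i0 ni; rewrite pi.
  split => // j [j0 ji]; have [->|[_ jp]] := ancestorP ji; last first.
    by rewrite pi in jp; apply: (proj2 pk).
  split; first by split => //; rewrite pi; exact: badx.
  move=> [i' [i'0 i'i ni' pi'] Vi'].
  have := imin i'; rewrite i'0 ni' pi' pi eqxx /= leqNgt i'i => /(_ _)/negP.
  by apply => //; apply/asboolP.
suff h n : exists k, [/\ (n <= k)%N, node k, greedy_path k x & viable k x].
  by move=> n; have [k [? ? ? _]] := h n; exists k; split => //; left.
elim: n => [|n [k [nk nok pk Vk]]]; first by exists 0%N; split => //; exact: node0 NT.
have [i [ki ni pi Vi]] := next _ nok pk Vk; exists i; split => //.
exact: leq_ltn_trans ki.
Qed.

End TreePaths.

(** * Expansion of balls in a doubling ball-basis *)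

Section DisjointIntegral.
Context {d : measure_display} {T : measurableType d} {R : realType}.
Variable mu : {measure set T -> \bar R}.
Local Open Scope ereal_scope.

Lemma disjoint_integral_le (h : T -> \bar R) (A : nat -> set T) (P : pred nat) n Q :
  measurable Q -> measurable_fun Q h -> (forall x, Q x -> 0 <= h x) ->
  (forall k, (k < n)%N -> P k -> measurable (A k) /\ A k `<=` Q) ->
  (forall j k, (j < k)%N -> (k < n)%N -> P j -> P k -> A j `&` A k = set0) ->
  \sum_(0 <= k < n | P k) \int[mu]_(x in A k) h x <= \int[mu]_(x in Q) h x.
Proof.
move=> mQ mh h0 AQ dA.
pose F k := if (k < n)%N && P k then A k else set0.
have mF k : measurable (F k).
  rewrite /F; case: ifPn => [/andP[kn Pk]|_]; last exact: measurable0.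
  by have [] := AQ _ kn Pk.
have FQ k : F k `<=` Q.
  rewrite /F; case: ifPn => [/andP[kn Pk]|_]; last exact: sub0set.
  by have [] := AQ _ kn Pk.
have -> : \sum_(0 <= k < n | P k) \int[mu]_(x in A k) h x =
    \sum_(k <- index_iota 0 n) \int[mu]_(x in F k) h x.
  rewrite big_mkcond /= !big_nat; apply: eq_bigr => k /andP[_ kn].
  by rewrite /F kn /=; case: ifP => //; rewrite integral_set0.
have UQ : \big[setU/set0]_(k <- index_iota 0 n) F k `<=` Q.
  by move=> x; rewrite -bigcup_seq => -[k _ /FQ].
rewrite -ge0_integral_bigsetU //.
- apply: ge0_subset_integral => //; exact: bigsetU_measurable.
- exact: iota_uniq.
- apply/trivIsetP => i j _ _ ij; wlog lt : i j ij / (i < j)%N.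
    move=> H; case: (ltngtP i j) => [|ji|e]; first exact: H.
      by rewrite setIC; apply: H => //; rewrite eq_sym.
    by rewrite e eqxx in ij.
  rewrite /F; case: ifP => [/andP[_ Pi]|]; last by rewrite set0I.
  by case: ifP => [/andP[jn Pj]|]; [exact: dA|rewrite setI0].
- exact: measurable_funS mh.
- by move=> x /UQ; exact: h0.
Qed.

End DisjointIntegral.

Section BallExpansion.
Context {d : measure_display} {T : measurableType d} {R : realType}.
Variables (mu : {measure set T -> \bar R}) (BB : set (set T)) (K eta : R).
Hypothesis hB : ball_basis mu BB K.
Hypothesis hD : doubling mu BB eta.

Definition ball_size (A : set T) : R := fine (mu A).
Local Notation m := ball_size.

Lemma ball_sizeE A : BB A -> mu A = (m A)%:E.
Proof.
by move=> bA; have /andP[h1 h2] := ball_measure hB bA; rewrite fineK // ge0_fin_numE // ltW.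
Qed.

Lemma ball_size_gt0 A : BB A -> 0 < m A.
Proof.
by move=> bA; have /andP[h1 h2] := ball_measure hB bA; rewrite fine_gt0 // h1.
Qed.

Lemma ball_size_mono A Q : BB A -> BB Q -> A `<=` Q -> m A <= m Q.
Proof.
move=> bA bQ AQ; rewrite -lee_fin -!ball_sizeE //.
by apply: le_measure => //; rewrite inE; exact: (ball_measurable hB).
Qed.

Lemma basis_nonempty A : BB A -> A !=set0.
Proof.
move=> bA; apply/set0P/eqP => A0; have /andP[] := ball_measure hB bA.
by rewrite A0 measure0 ltxx.
Qed.

(** One factor [ball_growth] pays for the ball of (B4) and a further [2 * ball_growth] for doubling
    it, whence [expansion_factor]. *)
Definition ball_growth : R := Num.max 2 (Num.max K eta).
Definition expansion_factor : R := 2 * ball_growth ^+ 2.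
Local Notation L0 := ball_growth.

Lemma hull_exists A : BB A -> exists Q, [/\ BB Q, A `<=` Q, m Q <= L0 * m A &
  forall C, BB C -> C `&` A !=set0 -> m C <= 2 * m A -> C `<=` Q].
Proof.
move=> bA; have [Q [bQ starQ mQ]] := ball_hull hB bA.
have sw C : BB C -> C `&` A !=set0 -> m C <= 2 * m A -> C `<=` Q.
  move=> bC CA mC; apply: subset_trans starQ => x Cx; exists C => //; split => //.
  by rewrite !ball_sizeE // -EFinM lee_fin.
exists Q; split => //.
  apply: sw => //; first by rewrite setIid; exact: basis_nonempty.
  by have := ball_size_gt0 bA; lra.
move: mQ; rewrite !ball_sizeE // -EFinM lee_fin => /le_trans; apply.
by rewrite ler_wpM2r ?(ltW (ball_size_gt0 bA)) // /L0 !le_max lexx orbT.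
Qed.

(** If the hull [Q] of [A] does not already more than double [A], the doubling property supplies a
    ball strictly larger than [Q]. It must exceed twice the size of [A], for otherwise [Q] would
    have swallowed it. When [ball_star] of [Q] is everything, (B4) gives the whole space as a
    ball. *)
Lemma doubling_exists A : BB A -> exists Q, [/\ BB Q, A `<=` Q, m Q <= 2 * L0 * m A &
  2 * m A < m Q \/ Q = setT].
Proof.
move=> bA; have [Q [bQ AQ mQ sw]] := hull_exists bA.
have L02 : 2 <= L0 by rewrite /L0 le_max lexx.
have mA := ball_size_gt0 bA.
have [lt|le] := ltP (2 * m A) (m Q).
  by exists Q; split => //; [nra|left].
have [starT|/(proj2 hD _ bQ)[Q' [bQ' [QQ' nQ] mQ']]] := pselect (ball_star mu BB Q = [set: T]).
  have [Q' [bQ' starQ' mQ']] := ball_hull hB bQ.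
  have Q'T : Q' = setT by apply/seteqP; split => // x _; apply: starQ'; rewrite starT.
  exists Q'; split => //; first by rewrite Q'T.
    move: mQ'; rewrite !ball_sizeE // -EFinM lee_fin => /le_trans; apply.
    have : K <= L0 by rewrite /L0 !le_max lexx orbT.
    have := ball_size_gt0 bQ; nra.
  by right.
exists Q'; split => //; first exact: subset_trans QQ'.
  move: mQ'; rewrite !ball_sizeE // -EFinM lee_fin => /le_trans; apply.
  have : eta <= L0 by rewrite /L0 !le_max lexx !orbT.
  have := ball_size_gt0 bQ; nra.
left; rewrite ltNge; apply/negP => le'; apply: nQ; apply: sw => //.
have [x Ax] := basis_nonempty bA; exists x; split => //; exact/QQ'/AQ.
Qed.

Lemma expansion_exists : exists H, expansion BB m H expansion_factor.
Proof.
have L02 : 2 <= L0 by rewrite /L0 le_max lexx.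
have ex A : exists Q, BB A -> [/\ BB Q, A `<=` Q, m Q <= expansion_factor * m A,
    2 * m A < m Q \/ Q = setT &
    forall C, BB C -> C `&` A !=set0 -> m C <= 2 * m A -> C `<=` Q].
  have [bA|nA] := pselect (BB A); last by exists set0.
  have [Q [bQ AQ mQ sw]] := hull_exists bA.
  have [Q' [bQ' QQ' mQ' big]] := doubling_exists bQ.
  have mA := ball_size_gt0 bA.
  exists Q' => _; split => //.
  - exact: subset_trans QQ'.
  - by apply: (le_trans mQ'); rewrite /expansion_factor expr2; nra.
  - case: big; [left|by right].
    by have := ball_size_mono bA bQ AQ; lra.
  - by move=> C bC CA mC; apply: subset_trans QQ'; exact: sw.
have [H HP] := choice ex.
exists H; split.
- by rewrite /expansion_factor expr2; nra.
- exact: ball_size_gt0.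
- exact: ball_size_mono.
- by move=> A /HP[].
- by move=> A /HP[].
- by move=> A /HP[].
- by move=> A C bA; have [_ _ _ _] := HP _ bA; exact.
- by move=> A /HP[].
- move=> A P n Q bQ AQ dA; rewrite -lee_fin -sumEFin -(ball_sizeE bQ).
  have -> : (\sum_(0 <= k < n | P k) (m (A k))%:E =
      \sum_(0 <= k < n | P k) \int[mu]_(x in A k) (cst 1 x))%E.
    rewrite big_nat_cond [RHS]big_nat_cond; apply: eq_bigr => k /andP[/andP[_ kn] Pk].
    have [bA _] := AQ _ kn Pk; rewrite integral_cst ?mul1e ?ball_sizeE //.
    exact: (ball_measurable hB).
  apply: le_trans (_ : _ <= \int[mu]_(x in Q) (cst 1 x))%E _; last first.
    by rewrite integral_cst ?mul1e //; exact: (ball_measurable hB).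
  apply: disjoint_integral_le => //; first exact: (ball_measurable hB).
  by move=> k kn Pk; have [bA AkQ] := AQ _ kn Pk; split => //; exact: (ball_measurable hB).
Qed.

End BallExpansion.

(** * Bochner integrals *)

Section SimpleIntegral.
Context {d : measure_display} {T : measurableType d} {R : realType}.
Context {U : completeNormedModType R}.
Variable mu : {measure set T -> \bar R}.
Implicit Types (D : set T) (f s t : T -> U).
Local Open Scope ereal_scope.

Lemma ereal_cvg0_lt (a : nat -> \bar R) (e : R) : a @ \oo --> 0 -> (0 < e)%R ->
  \forall n \near \oo, a n < e%:E.
Proof.
move=> c e0; apply: (c [set y | y < e%:E]); apply: open_nbhs_nbhs; split.
  exact: open_ereal_lt_ereal.
by rewrite /= lte_fin.
Qed.

Lemma measurable_simple2 (s t : T -> U) (F : U -> U -> R) :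
  simple_fun s -> simple_fun t -> measurable_fun setT (fun x => F (s x) (t x)).
Proof.
move=> [fs ms] [ft mt] _ Y _; rewrite setTI.
have -> : (fun x => F (s x) (t x)) @^-1` Y =
    \bigcup_(u in range s) \bigcup_(v in [set v | range t v /\ Y (F u v)])
      (s @^-1` [set u] `&` t @^-1` [set v]).
  apply/seteqP; split => x /=.
    by move=> Yx; exists (s x); [exists x|exists (t x) => //; split => //; exists x].
  by move=> [u _ [v [_ Yuv] [-> ->]]].
apply: fin_bigcup_measurable => // u _; apply: fin_bigcup_measurable.
  by apply: sub_finite_set ft => v [].
by move=> v _; apply: measurableI.
Qed.

Lemma measurable_norm_sub_simple f s : strongly_measurable f -> simple_fun s ->
  measurable_fun setT (fun x => `|f x - s x|%R).
Proof.
move=> [u [su uf]] ss; apply/measurable_EFinP.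
apply: (@emeasurable_fun_cvg _ _ _ _ (fun n x => `|u n x - s x|%:E)).
  by move=> n; apply/measurable_EFinP; apply: (measurable_simple2 (fun a b => `|a - b|%R)).
move=> x _; apply: cvg_EFin; first exact: nearW.
by apply: cvg_norm; apply: cvgB; [exact: uf|exact: cvg_cst].
Qed.

Lemma simple_cst (c : U) : simple_fun (fun _ : T => c).
Proof.
split; first by apply: sub_finite_set (finite_set1 c) => _ [x _ <-].
move=> u; have [->|/eqP ne] := eqVneq u c.
  by rewrite (_ : _ @^-1` _ = setT) //; apply/seteqP; split.
rewrite (_ : _ @^-1` _ = set0) //; apply/seteqP; split => // x /= e.
by apply: ne; rewrite e.
Qed.

Lemma measurable_norm_sub f (c : U) : strongly_measurable f ->
  measurable_fun setT (fun x => `|f x - c|%R).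
Proof. by move=> mf; apply: (measurable_norm_sub_simple mf (simple_cst c)). Qed.

Lemma simple_partition D s (h : T -> \bar R) : measurable D -> simple_fun s ->
  measurable_fun setT h -> (forall x, 0 <= h x) ->
  \int[mu]_(x in D) h x =
  \sum_(u <- finmap.enum_fset (fset_set (range s))) \int[mu]_(x in D `&` s @^-1` [set u]) h x.
Proof.
move=> mD [fs ms] mh h0.
have E : D = \big[setU/set0]_(u <- finmap.enum_fset (fset_set (range s)))
    (D `&` s @^-1` [set u]).
  rewrite -bigcup_seq; apply/seteqP; split => x.
    move=> Dx; exists (s x) => //=; rewrite in_fset_set // inE; by exists x.
  by case=> u _ [].
rewrite [in LHS]E ge0_integral_bigsetU //.
- by move=> u; apply: measurableI.
- by move=> u v _ _ [x [[_ <-] [_ <-]]].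
- exact: measurable_funTS.
Qed.

Lemma simple_integralE D s : simple_fun s ->
  simple_integral mu D s =
  (\sum_(u <- finmap.enum_fset (fset_set (range s))) fine (mu (D `&` s @^-1` [set u])) *: u)%R.
Proof. by move=> [fs _]; rewrite /simple_integral fsbig_finite. Qed.

Lemma simple_integral_dist D s (c : U) : measurable D -> mu D < +oo -> simple_fun s ->
  (`|simple_integral mu D s - fine (mu D) *: c|)%:E <= \int[mu]_(x in D) `|s x - c|%:E.
Proof.
move=> mD fD ss; have [_ ms] := ss.
have mDs u : measurable (D `&` s @^-1` [set u]) by apply: measurableI.
have fDs u : mu (D `&` s @^-1` [set u]) = (fine (mu (D `&` s @^-1` [set u])))%:E.
  rewrite fineK // ge0_fin_numE //; apply: le_lt_trans fD.
  by apply: le_measure; rewrite ?inE // => x [].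
have -> : fine (mu D) = (\sum_(u <- finmap.enum_fset (fset_set (range s)))
    fine (mu (D `&` s @^-1` [set u])))%R.
  have -> : mu D = \int[mu]_(x in D) cst 1 x by rewrite integral_cst ?mul1e.
  rewrite (simple_partition mD ss) //.
  under eq_bigr do rewrite integral_cst // mul1e fDs.
  by rewrite sumEFin.
rewrite (simple_partition mD ss) //; last first.
  apply/measurable_EFinP; apply: (measurable_simple2 (fun a _ => `|a - c|%R) ss ss).
rewrite simple_integralE // scaler_suml -sumrB.
have -> : (\sum_(u <- finmap.enum_fset (fset_set (range s)))
      \int[mu]_(x in D `&` s @^-1` [set u]) `|s x - c|%:E =
    \sum_(u <- finmap.enum_fset (fset_set (range s)))
      (`|u - c| * fine (mu (D `&` s @^-1` [set u])))%:E)%E.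
  apply: eq_bigr => u _.
  transitivity (\int[mu]_(x in D `&` s @^-1` [set u]) (`|u - c|%R)%:E).
    by apply: eq_integral => x; rewrite inE => -[_ /= <-].
  by rewrite integral_cst // fDs.
rewrite sumEFin lee_fin; apply: (le_trans (ler_norm_sum _ _ _)).
apply: ler_sum => u _; rewrite -scalerBr normrZ mulrC.
by rewrite ger0_norm // fine_ge0.
Qed.

Lemma simple_integral_partition D s t : measurable D -> mu D < +oo ->
  simple_fun s -> simple_fun t ->
  simple_integral mu D s =
  (\sum_(v <- finmap.enum_fset (fset_set (range t))) simple_integral mu (D `&` t @^-1` [set v]) s)%R.
Proof.
move=> mD fD ss st; rewrite simple_integralE //.
under [RHS]eq_bigr do rewrite simple_integralE //.
rewrite exchange_big /=; apply: eq_bigr => u _; rewrite -scaler_suml; congr (_ *: _).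
have [_ ms] := ss; have [_ mt] := st.
have mDs : measurable (D `&` s @^-1` [set u]) by apply: measurableI.
have fDs v : mu (D `&` t @^-1` [set v] `&` s @^-1` [set u]) =
    (fine (mu (D `&` t @^-1` [set v] `&` s @^-1` [set u])))%:E.
  rewrite fineK // ge0_fin_numE //; apply: le_lt_trans fD.
  apply: le_measure; rewrite ?inE //; last by move=> x [[]].
  by do 2 apply: measurableI => //.
have -> : mu (D `&` s @^-1` [set u]) = \int[mu]_(x in D `&` s @^-1` [set u]) cst 1 x.
  by rewrite integral_cst ?mul1e.
rewrite (simple_partition mDs st) //.
under eq_bigr => v _.
  rewrite integral_cst ?mul1e; last by apply: measurableI.
  rewrite setIAC fDs; over.
by rewrite sumEFin.
Qed.

(** On each level set of [t] the second function is constant, which is the case treated by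
    [simple_integral_dist]. *)
Lemma simple_integral_sub D s t : measurable D -> mu D < +oo ->
  simple_fun s -> simple_fun t ->
  (`|simple_integral mu D s - simple_integral mu D t|)%:E <=
  \int[mu]_(x in D) `|s x - t x|%:E.
Proof.
move=> mD fD ss st; have [_ mt] := st.
have mDt v : measurable (D `&` t @^-1` [set v]) by apply: measurableI.
rewrite (simple_integral_partition mD fD ss st) (simple_integralE D st) -sumrB.
rewrite (simple_partition mD st) //; last first.
  by apply/measurable_EFinP; apply: (measurable_simple2 (fun a b => `|a - b|%R) ss st).
apply: (@le_trans _ _ (\sum_(v <- finmap.enum_fset (fset_set (range t)))
   (`|simple_integral mu (D `&` t @^-1` [set v]) s -
      fine (mu (D `&` t @^-1` [set v])) *: v|)%:E)).
  by rewrite sumEFin lee_fin; exact: ler_norm_sum.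
apply: lee_sum => v _.
rewrite (_ : \int[mu]_(x in _) _ =
  \int[mu]_(x in D `&` t @^-1` [set v]) `|s x - v|%:E); last first.
  by apply: eq_integral => x; rewrite inE => -[_ /= ->].
apply: simple_integral_dist => //; apply: le_lt_trans fD.
by apply: le_measure; rewrite ?inE // => x [].
Qed.

End SimpleIntegral.

Section Bochner.
Context {d : measure_display} {T : measurableType d} {R : realType}.
Context {U : completeNormedModType R}.
Variable mu : {measure set T -> \bar R}.
Implicit Types (D : set T) (f s t : T -> U).
Local Open Scope ereal_scope.

Lemma simple_truncation f s (E : set T) : measurable E -> simple_fun s ->
  simple_fun (fun x => if x \in E then s x else 0%R : U).
Proof.
move=> mE [fs ms]; split.
  apply: (@sub_finite_set _ _ (range s `|` [set 0%R])); last by rewrite finite_setU.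
  by move=> _ [x _ <-]; case: ifP => _; [left; exists x|right].
move=> u.
have -> : (fun x => if x \in E then s x else 0%R : U) @^-1` [set u] =
    (E `&` s @^-1` [set u]) `|` (~` E `&` (fun=> 0%R : U) @^-1` [set u]).
  apply/seteqP; split => x /=.
    by case: ifPn; rewrite ?inE ?notin_setE => Ex e; [left|right].
  case=> -[Ex e]; first by rewrite mem_set.
  by rewrite memNset.
apply: measurableU; first exact: measurableI.
apply: measurableI; first exact: measurableC.
by have [] := simple_cst (T := T) (0%R : U).
Qed.

Lemma integral_dist_triangle D (f : T -> U) (a b c : T -> U) :
  measurable D -> measurable_fun setT (fun x => `|a x - b x|%R) ->
  measurable_fun setT (fun x => `|b x - c x|%R) ->
  measurable_fun setT (fun x => `|a x - c x|%R) ->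
  \int[mu]_(x in D) `|a x - c x|%:E <=
  \int[mu]_(x in D) `|a x - b x|%:E + \int[mu]_(x in D) `|b x - c x|%:E.
Proof.
move=> mD m1 m2 m3; rewrite -ge0_integralD //; try by
  apply/measurable_EFinP; exact: measurable_funTS.
apply: ge0_le_integral => //.
- by apply/measurable_EFinP; exact: measurable_funTS.
- apply/measurable_EFinP; apply: measurable_funTS.
  exact: (measurable_funD m1 m2).
- by move=> x _; rewrite -EFinD lee_fin ler_distD.
Qed.

Lemma bochner_integral_exists f D : measurable D -> mu D < +oo ->
  strongly_measurable f -> \int[mu]_(x in D) `|f x|%:E < +oo ->
  exists v, is_bochner_integral mu D f v.
Proof.
move=> mD fD mf ifin; have [s [ss sf]] := mf.
have mnf : measurable_fun setT (fun x => `|f x|%R).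
  by have := measurable_norm_sub 0%R mf; under eq_fun do rewrite subr0.
have mns n : measurable_fun setT (fun x => `|s n x|%R).
  exact: (measurable_simple2 (fun a _ => `|a|%R) (ss n) (ss n)).
(* Cutting the approximations off where they exceed twice the norm of [f] gives the integrable
   majorant [3 * |f|] for dominated convergence. *)
pose E n : set T := [set x | (`|s n x| <= 2 * `|f x|)%R].
have mE n : measurable (E n).
  have -> : E n = [set: T] `&` (fun x => 2 * `|f x| - `|s n x|)%R @^-1` `[0%R, +oo[.
    apply/seteqP; split => x /=; rewrite in_itv /= andbT subr_ge0; first by move=> ?; split.
    by case.
  have : measurable_fun setT (fun x => (2 * `|f x| - `|s n x|)%R).
    by apply: measurable_funB => //; apply: measurable_funM.
  by apply => //; exact: measurable_itv.
pose t n x : U := if x \in E n then s n x else 0%R.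
have st n : simple_fun (t n) by apply: simple_truncation.
have tle n x : (`|t n x| <= 2 * `|f x|)%R.
  rewrite /t; case: ifPn; first by rewrite inE.
  by rewrite normr0 mulr_ge0.
have tf x : t n x @[n --> \oo] --> f x.
  have [f0|f0] := eqVneq (f x) 0%R.
    have t0 n : t n x = 0%R.
      by apply/eqP; rewrite -normr_le0; have := tle n x; rewrite f0 normr0 mulr0.
    by rewrite f0; under eq_fun do rewrite t0; exact: cvg_cst.
  have fx0 : (0 < `|f x|)%R by rewrite normr_gt0.
  apply: cvg_trans (sf x); apply: near_eq_cvg.
  have /cvgrPdist_lt/(_ _ fx0) := sf x; apply: filterS => n h.
  rewrite /t mem_set //=; have := ler_normB (f x) (f x - s n x)%R.
  rewrite opprB addrCA subrr addr0 => h1; apply: (le_trans h1).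
  by rewrite mulr2n mulrDl mul1r lerD2l ltW.
have mft n : measurable_fun setT (fun x => `|f x - t n x|%R).
  exact: measurable_norm_sub_simple.
have cv : (fun n => \int[mu]_(x in D) `|f x - t n x|%R%:E) @ \oo --> (0 : \bar R).
  have [] := @dominated_convergence _ _ _ mu D mD (fun n x => `|f x - t n x|%:E)
    (cst 0) (fun x => (3 * `|f x|)%:E).
  - by move=> n; apply/measurable_EFinP; exact: measurable_funTS.
  - exact: measurable_cst.
  - apply: aeW => x Dx; apply: cvg_EFin; first exact: nearW.
    rewrite -(normr0 U) -(subrr (f x)); apply: cvg_norm; apply: cvgB => //.
    exact: cvg_cst.
  - apply/integrableP; split.
      apply/measurable_EFinP; apply: measurable_funTS; exact: measurable_funM.
    under eq_integral do rewrite abse_EFin normrM normr_id ger0_norm // EFinM.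
    rewrite ge0_integralZl_EFin //; last by apply/measurable_EFinP; exact: measurable_funTS.
    by rewrite lte_mul_pinfty // lee_fin.
  - apply: aeW => x n _; rewrite abse_EFin normr_id lee_fin.
    apply: (le_trans (ler_normB _ _)); have := tle n x; lra.
  - by move=> _ _; rewrite integral0.
have fint n : \int[mu]_(x in D) `|t n x|%:E < +oo.
  apply: (@le_lt_trans _ _ (\int[mu]_(x in D) (2 * `|f x|)%:E)).
    apply: ge0_le_integral => //.
    - apply/measurable_EFinP; apply: measurable_funTS.
      exact: (measurable_simple2 (fun a _ => `|a|%R) (st n) (st n)).
    - by apply/measurable_EFinP; apply: measurable_funTS; exact: measurable_funM.
    - by move=> x _; rewrite lee_fin.
  under eq_integral do rewrite EFinM.
  rewrite ge0_integralZl_EFin //; last by apply/measurable_EFinP; exact: measurable_funTS.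
  by rewrite lte_mul_pinfty // lee_fin.
have : cvg (simple_integral mu D (t n) @[n --> \oo]).
  apply: cauchy_cvg; apply: cauchy_exP => e e0.
  have e20 : (0 < e / 2)%R by rewrite divr_gt0.
  have [N _ NP] := ereal_cvg0_lt cv e20.
  exists (simple_integral mu D (t N)); exists N => // n /= Nn.
  rewrite -ball_normE /ball_ /= -lte_fin.
  apply: (le_lt_trans (simple_integral_sub mD fD (st N) (st n))).
  have h1 := NP n Nn; have h2 := NP N (leqnn N).
  apply: (@le_lt_trans _ _ (\int[mu]_(x in D) `|t N x - f x|%:E + \int[mu]_(x in D) `|f x - t n x|%:E)).
    apply: integral_dist_triangle => //.
    - by under eq_fun do rewrite distrC; exact: mft.
    - exact: (measurable_simple2 (fun a b => `|a - b|%R) (st N) (st n)).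
  under [X in X + _]eq_integral do rewrite distrC.
  by rewrite [e]splitr EFinD lteD.
move=> /cvg_ex[v vP]; exists v, t; split => //.
Qed.

(** The inequality passes to the limit from simple functions, for the value picked by [xget]. All
    later estimates of averages rest on it. *)
Lemma bochner_integral_dist f D (c : U) : measurable D -> mu D < +oo ->
  strongly_measurable f -> \int[mu]_(x in D) `|f x|%:E < +oo ->
  (`|bochner_integral mu D f - fine (mu D) *: c|)%:E <=
  \int[mu]_(x in D) `|f x - c|%:E.
Proof.
move=> mD fD mf ifin; have [v0 v0P] := bochner_integral_exists mD fD mf ifin.
have : is_bochner_integral mu D f (bochner_integral mu D f).
  exact: (@xgetPex _ 0%R _ (ex_intro _ v0 v0P)).
set v := bochner_integral _ _ _ => -[s [ss _ cv sv]].
apply/lee_addgt0Pr => e e0.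
have e20 : (0 < e / 2)%R by rewrite divr_gt0.
have n1 := ereal_cvg0_lt cv e20.
have n2 : \forall n \near \oo, (`|v - simple_integral mu D (s n)| < e / 2)%R.
  by move/cvgrPdist_lt: sv; apply.
have [n [h1 h2]] : exists n, \int[mu]_(x in D) `|f x - s n x|%:E < (e / 2)%:E /\
    (`|v - simple_integral mu D (s n)| < e / 2)%R.
  by have [N _ NP] := filterI n1 n2; exists N; apply: NP => /=.
have h3 := simple_integral_dist c mD fD (ss n).
have h4 : \int[mu]_(x in D) `|s n x - c|%:E <=
    \int[mu]_(x in D) `|s n x - f x|%:E + \int[mu]_(x in D) `|f x - c|%:E.
  apply: (@integral_dist_triangle D f (s n) f (fun=> c)) => //.
  - under eq_fun do rewrite distrC; exact: measurable_norm_sub_simple.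
  - exact: measurable_norm_sub.
  - exact: (measurable_simple2 (fun a b => `|a - c|%R) (ss n) (ss n)).
move: h4; under [X in X + _]eq_integral do rewrite distrC.
move=> h4.
apply: (@le_trans _ _ ((`|v - simple_integral mu D (s n)|)%:E +
    (`|simple_integral mu D (s n) - fine (mu D) *: c|)%:E)).
  by rewrite -EFinD lee_fin ler_distD.
rewrite [e]splitr EFinD addeA [leRHS]addeC.
apply: leeD; first by rewrite lee_fin ltW.
apply: (le_trans h3); apply: (le_trans h4); rewrite addeC; apply: leeD => //.
exact: ltW.
Qed.

End Bochner.

(** * Mean oscillation *)

(** The tangent of the power function at 1, obtained from Young's inequality with second factor
    1. *)
Lemma bernoulli_powR (R : realType) (r t : R) : 1 <= r -> 0 <= t ->
  r * t <= t `^ r + (r - 1).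
Proof.
rewrite le_eqVlt => /orP[/eqP <- t0|r1 t0].
  by rewrite powRr1 // subrr addr0 mul1r.
have r0 : 0 < r by lra.
have q0 : 0 < r / (r - 1) by rewrite divr_gt0 // subr_gt0.
have := @conjugate_powR R t 1 r (r / (r - 1)) t0 ler01 r0 q0.
have -> : r^-1 + (r / (r - 1))^-1 = 1.
  by rewrite invf_div; field; rewrite gt_eqF.
move=> /(_ erefl); rewrite mulr1 powR1 => h.
have : r * t <= r * (t `^ r / r + 1 / (r / (r - 1))) by rewrite ler_pM2l.
congr (_ <= _); field; apply/andP; split; rewrite gt_eqF // subr_gt0 //.
Qed.

Lemma le_1D_powR (R : realType) (r t : R) : 1 <= r -> 0 <= t -> t <= 1 + t `^ r.
Proof.
move=> r1 t0; have [t1|t1] := leP t 1.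
  by have := powR_ge0 t r; lra.
rewrite -[leLHS](powRr1 t0); have := ler_powR (ltW t1) r1; lra.
Qed.

Section Oscillation.
Context {d : measure_display} {T : measurableType d} {R : realType}.
Context {U : completeNormedModType R}.
Variables (mu : {measure set T -> \bar R}) (BB : set (set T)) (K r : R).
Variable f : T -> U.
Hypothesis hB : ball_basis mu BB K.
Hypothesis r1 : 1 <= r.
Hypothesis Lrf : in_Lr mu r f.
Implicit Types (A Q S : set T) (c : U).
Local Notation m := (ball_size mu).

Definition mass c A : R := fine (\int[mu]_(x in A) (`|f x - c|)%:E)%E.
Definition mean_dist c A : R := mass c A / m A.
Definition osc S : R :=
  sup [set mean_dist (average mu A f) A | A in [set A | BB A /\ S `<=` A]].
Local Notation fa A := (average mu A f).

Let smf : strongly_measurable f. Proof. by case: Lrf. Qed.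
Let meas A (bA : BB A) : measurable A := ball_measurable hB bA.
Let m_gt0 A (bA : BB A) : 0 < m A := ball_size_gt0 hB bA.
Let finA A : BB A -> (mu A < +oo)%E.
Proof. by move=> bA; have /andP[] := ball_measure hB bA. Qed.

Lemma measurable_dist c : measurable_fun setT (fun x => (`|f x - c|)%:E).
Proof. by apply/measurable_EFinP; exact: measurable_norm_sub. Qed.

Lemma measurable_norm_powR : measurable_fun setT (fun x => (`|f x| `^ r)%:E).
Proof.
apply/measurable_EFinP.
apply: (measurableT_comp (f := (@powR R ^~ r))) => //.
by have := measurable_norm_sub 0 smf; under eq_fun do rewrite subr0.
Qed.

Definition Lr_mass : R := fine (\int[mu]_x (`|f x| `^ r)%:E)%E.

Lemma integral_norm_le A : BB A ->
  (\int[mu]_(x in A) (`|f x|)%:E <= (m A + Lr_mass)%:E)%E.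
Proof.
move=> bA; have [_ fin] := Lrf.
have mn : measurable_fun setT (fun x => (`|f x|)%:E).
  by have := measurable_dist 0; under eq_fun do rewrite subr0.
apply: (@le_trans _ _ (\int[mu]_(x in A) (cst 1 x + (`|f x| `^ r)%:E))%E).
  apply: ge0_le_integral => //; first exact: meas.
  - exact: measurable_funTS.
  - apply: emeasurable_funD; first exact: measurable_cst.
    by apply: measurable_funTS; exact: measurable_norm_powR.
  - by move=> x _; rewrite -EFinD lee_fin le_1D_powR.
rewrite ge0_integralD //; first last.
- by apply: measurable_funTS; exact: measurable_norm_powR.
- exact: meas.
rewrite integral_cst ?mul1e; last exact: meas.
rewrite EFinD (ball_sizeE hB) //; apply: leeD => //.
rewrite /Lr_mass fineK; last first.
  by rewrite ge0_fin_numE //; apply: integral_ge0 => x _; rewrite lee_fin powR_ge0.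
apply: ge0_subset_integral => //; first exact: meas.
exact: measurable_norm_powR.
Qed.

Lemma integral_norm_fin A : BB A -> (\int[mu]_(x in A) (`|f x|)%:E < +oo)%E.
Proof. by move=> /integral_norm_le/le_lt_trans; apply; rewrite ltry. Qed.

Lemma massE c A : BB A -> (\int[mu]_(x in A) (`|f x - c|)%:E = (mass c A)%:E)%E.
Proof.
move=> bA; rewrite fineK // ge0_fin_numE; last exact: integral_ge0.
apply: (@le_lt_trans _ _ (\int[mu]_(x in A) ((`|f x|)%:E + cst (`|c|%:E) x))%E).
  apply: ge0_le_integral => //; first exact: meas.
  - by apply: measurable_funTS; exact: measurable_dist.
  - apply: emeasurable_funD => //; apply: measurable_funTS.
    by have := measurable_dist 0; under eq_fun do rewrite subr0.
  - by move=> x _; rewrite -EFinD lee_fin ler_normB.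
rewrite ge0_integralD //; first last.
- by move=> x _; rewrite /= lee_fin.
- by apply: measurable_funTS; have := measurable_dist 0; under eq_fun do rewrite subr0.
- exact: meas.
rewrite integral_cst; last exact: meas.
by rewrite lte_add_pinfty // ?integral_norm_fin // (ball_sizeE hB) // -EFinM ltry.
Qed.

Lemma mass_ge0 c A : 0 <= mass c A.
Proof. by apply/fine_ge0/integral_ge0. Qed.

Lemma mean_dist_ge0 c A : BB A -> 0 <= mean_dist c A.
Proof. by move=> bA; rewrite divr_ge0 ?mass_ge0 // ltW // m_gt0. Qed.

Lemma mass_mean c A : BB A -> mass c A = m A * mean_dist c A.
Proof. by move=> bA; rewrite /mean_dist mulrCA divff ?mulr1 // gt_eqF // m_gt0. Qed.

Lemma mass_mono c A Q : BB A -> BB Q -> A `<=` Q -> mass c A <= mass c Q.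
Proof.
move=> bA bQ AQ; rewrite -lee_fin -!massE //.
by apply: ge0_subset_integral => //; [exact: meas|exact: meas|exact: measurable_funTS (measurable_dist c)].
Qed.

Lemma mean_dist_sub c A Q : BB A -> BB Q -> A `<=` Q ->
  m A * mean_dist c A <= m Q * mean_dist c Q.
Proof. by move=> bA bQ AQ; rewrite -!mass_mean // mass_mono. Qed.

Lemma mean_dist_tri c c' A : BB A -> mean_dist c A <= mean_dist c' A + `|c' - c|.
Proof.
move=> bA; have mA := m_gt0 bA.
rewrite ler_pdivrMr // mulrDl [mean_dist _ _ * _]mulrC -mass_mean // -lee_fin EFinD -!massE //.
have -> : ((`|c' - c| * m A)%:E = \int[mu]_(x in A) cst (`|c' - c|%:E) x)%E.
  by rewrite integral_cst ?(ball_sizeE hB) ?EFinM //; exact: meas.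
rewrite -ge0_integralD //; first last.
- by move=> x _; rewrite /= lee_fin.
- by apply: measurable_funTS; exact: measurable_dist.
- exact: meas.
apply: ge0_le_integral => //; first exact: meas.
- by apply: measurable_funTS; exact: measurable_dist.
- by apply: emeasurable_funD => //; apply: measurable_funTS; exact: measurable_dist.
- by move=> x _; rewrite -EFinD lee_fin ler_distD.
Qed.

Lemma average_dist c A : BB A -> `|fa A - c| <= mean_dist c A.
Proof.
move=> bA; have mA := m_gt0 bA.
have := bochner_integral_dist c (meas bA) (finA bA) smf (integral_norm_fin bA).
rewrite massE // lee_fin -/(m A) => h; rewrite /mean_dist ler_pdivlMr //.
apply: le_trans h; rewrite /average -/(m A) -[X in _ * X](ger0_norm (ltW mA)) mulrC -normrZ.
by rewrite scalerBr scalerA divff ?scale1r // gt_eqF.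
Qed.

(** The bound depends on [S] only. It makes the suprema over all balls containing [S] finite, so
    that [osc] and [base_value] can be real numbers. *)
Lemma mean_dist0_le A S : BB A -> BB S -> S `<=` A -> mean_dist 0 A <= 1 + Lr_mass / m S.
Proof.
move=> bA bS SA; have mA := m_gt0 bA; have mS := m_gt0 bS.
have F0 : 0 <= Lr_mass by apply/fine_ge0/integral_ge0 => x _; rewrite lee_fin powR_ge0.
have : mass 0 A <= m A + Lr_mass.
  rewrite -lee_fin -massE //; under eq_integral do rewrite subr0.
  exact: integral_norm_le.
rewrite /mean_dist ler_pdivrMr // mulrDl mul1r => /le_trans; apply.
rewrite lerD2l mulrAC ler_pdivlMr // ler_wpM2l //.
exact: (ball_size_mono hB).
Qed.

Lemma average_norm_le A S : BB A -> BB S -> S `<=` A -> `|fa A| <= 1 + Lr_mass / m S.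
Proof.
move=> bA bS SA; rewrite -[fa A]subr0; apply: (le_trans (average_dist 0 bA)).
exact: mean_dist0_le.
Qed.

Lemma has_sup_osc S : BB S ->
  has_sup [set mean_dist (fa A) A | A in [set A | BB A /\ S `<=` A]].
Proof.
move=> bS; split; first by exists (mean_dist (fa S) S); exists S => //; split.
exists (2 * (1 + Lr_mass / m S)) => _ [A [bA SA] <-].
apply: (le_trans (mean_dist_tri (fa A) 0 bA)); rewrite sub0r normrN.
have := mean_dist0_le bA bS SA; have := average_norm_le bA bS SA; lra.
Qed.

Lemma mean_dist_le_osc S A : BB S -> BB A -> S `<=` A -> mean_dist (fa A) A <= osc S.
Proof.
by move=> bS bA SA; apply: sup_upper_bound; [exact: has_sup_osc|exists A => //; split].
Qed.

Lemma osc_ge0 S : BB S -> 0 <= osc S.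
Proof.
move=> bS; apply: (le_trans (mean_dist_ge0 (fa S) bS)); exact: mean_dist_le_osc.
Qed.

Lemma osc_anti S S' : BB S -> BB S' -> S `<=` S' -> osc S' <= osc S.
Proof.
move=> bS bS' SS'; apply: ge_sup => [|_ [A [bA SA] <-]].
  by have [] := has_sup_osc bS'.
by apply: mean_dist_le_osc => //; exact: subset_trans SA.
Qed.

(** The comparison of the mean with the r-th power mean: [bernoulli_powR] is rescaled to the tangent
    at the mean [a] and integrated over [A], and the terms in [r] cancel. *)
Lemma mean_dist_le_sharp A : BB A -> ((mean_dist (fa A) A)%:E <= sharp mu r f A)%E.
Proof.
move=> bA; have mA := m_gt0 bA; set a := mean_dist _ _.
have a_ge0 : 0 <= a by exact: mean_dist_ge0.
have r0 : 0 < r by apply: lt_le_trans r1.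
rewrite /sharp -/(m A); set W := (\int[mu]_(x in A) _)%E.
have W0 : (0 <= W)%E by apply: integral_ge0 => x _; rewrite lee_fin powR_ge0.
have mp : measurable_fun setT (fun x => (`|f x - fa A| `^ r)%:E).
  apply/measurable_EFinP; apply: (measurableT_comp (f := (@powR R ^~ r))) => //.
  exact: measurable_norm_sub.
(* If the integral is infinite, so is the sharp function, and nothing is to be shown. *)
case WE : W => [w| |]; last by move: W0; rewrite WE.
  2: by rewrite gt0_muley ?lte_fin ?invr_gt0 // poweRyr ?leey // invr_eq0 gt_eqF.
rewrite -EFinM poweR_EFin lee_fin.
have w0 : 0 <= w by rewrite -lee_fin -WE.
have [a0|an0] := eqVneq a 0; first by rewrite a0 powR_ge0.
have ap : 0 < a by rewrite lt_neqAle eq_sym an0.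
have key : a `^ r <= (m A)^-1 * w.
  have pt t : 0 <= t -> a `^ r * (r / a) * t <= t `^ r + a `^ r * (r - 1).
    move=> t0; have := bernoulli_powR r1 (divr_ge0 t0 (ltW ap)) => h.
    have e : t `^ r = a `^ r * (t / a) `^ r.
      rewrite -powRM; [by rewrite mulrC divfK|exact: ltW|].
      by apply: divr_ge0 => //; exact: ltW.
    rewrite e -mulrDr -mulrA ler_pM2l ?powR_gt0 //.
    by apply: le_trans h; rewrite mulrAC mulrA.
  have c0 : 0 <= a `^ r * (r - 1) by rewrite mulr_ge0 ?powR_ge0 // subr_ge0.
  have c1 : 0 <= a `^ r * (r / a) by rewrite mulr_ge0 ?powR_ge0 // divr_ge0 // ltW.
  have : (\int[mu]_(x in A) ((a `^ r * (r / a))%:E * (`|f x - fa A|)%:E) <=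
      \int[mu]_(x in A) ((`|f x - fa A| `^ r)%:E + cst (a `^ r * (r - 1))%:E x))%E.
    apply: ge0_le_integral => //; first exact: meas.
    - by move=> x _; rewrite -EFinM lee_fin mulr_ge0.
    - apply: measurable_funTS; apply: measurable_funeM; exact: measurable_dist.
    - by apply: measurable_funTS; apply: emeasurable_funD.
    - by move=> x _; rewrite -EFinM -EFinD lee_fin pt.
  rewrite ge0_integralZl_EFin //; first last.
  - by apply: measurable_funTS; exact: measurable_dist.
  - exact: meas.
  rewrite massE // ge0_integralD //; first last.
  - exact: measurable_funTS.
  - exact: meas.
  rewrite -/W WE integral_cst; last exact: meas.
  rewrite (ball_sizeE hB) // -!EFinM -EFinD lee_fin mass_mean // -/a.
  have -> : a `^ r * (r / a) * (m A * a) = a `^ r * r * m A by field.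
  rewrite ler_pdivlMl //; lra.
rewrite -[a]powRr1 // -[X in a `^ X](mulfV (lt0r_neq0 r0)) powRrM.
apply: ge0_ler_powR => //; first by rewrite invr_ge0 ltW.
- by rewrite nnegrE powR_ge0.
- by rewrite nnegrE mulr_ge0 // invr_ge0 ltW.
Qed.

Lemma osc_le_sharp_star S : BB S -> ((osc S)%:E <= sharp_star mu BB r f S)%E.
Proof.
move=> bS; set y := sharp_star _ _ _ _ _.
have le A : BB A -> S `<=` A -> ((mean_dist (fa A) A)%:E <= y)%E.
  move=> bA SA; apply: (le_trans (mean_dist_le_sharp bA)).
  by apply: ereal_sup_ubound; exists A => //; split.
case yE : y => [z| |]; [|by rewrite leey|].
  rewrite lee_fin; apply: ge_sup; first by have [] := has_sup_osc bS.
  by move=> _ [A [bA SA] <-]; rewrite -lee_fin -yE le.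
by have := le _ bS (@subset_refl _ S); rewrite yE.
Qed.

End Oscillation.

(** * Stopping balls *)

Lemma nneseries_le_bound (R : realType) (a : nat -> \bar R) (M : \bar R) :
  (forall k, (0 <= a k)%E) -> (forall n, (\sum_(0 <= k < n) a k <= M)%E) ->
  (\sum_(0 <= k <oo) a k <= M)%E.
Proof.
move=> a0 aM; apply: lime_le; first exact: is_cvg_nneseries.
by apply: nearW => n; exact: aM.
Qed.

Section Stopping.
Context {d : measure_display} {T : measurableType d} {R : realType}.
Context {U : completeNormedModType R}.
Variables (mu : {measure set T -> \bar R}) (BB : set (set T)) (K r L : R).
Variables (H : set T -> set T) (f : T -> U).
Hypothesis hB : ball_basis mu BB K.
Hypothesis r1 : 1 <= r.
Hypothesis Lrf : in_Lr mu r f.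
Hypothesis HE : expansion BB (ball_size mu) H L.
Implicit Types (A D Q S : set T) (c : U).
Local Notation m := (ball_size mu).
Local Notation fa A := (average mu A f).
Local Notation md c A := (mean_dist mu f c A).
Local Notation osc := (osc mu BB f).

Let L2 : 2 <= L := exp_ge2 HE.
Let m_gt0 A (bA : BB A) : 0 < m A := ball_size_gt0 hB bA.
Let bH A (bA : BB A) : BB (H A) := exp_ball HE bA.
Let md_ge0 c A (bA : BB A) : 0 <= md c A := mean_dist_ge0 f hB c bA.
Let md_sub c A Q (bA : BB A) (bQ : BB Q) : A `<=` Q -> m A * md c A <= m Q * md c Q :=
  mean_dist_sub hB r1 Lrf c bA bQ.
Let md_tri c c' A (bA : BB A) : md c A <= md c' A + `|c' - c| :=
  mean_dist_tri hB r1 Lrf c c' bA.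
Let osc0 S (bS : BB S) : 0 <= osc S := osc_ge0 hB r1 Lrf bS.
Let md_osc S A (bS : BB S) (bA : BB A) : S `<=` A -> md (fa A) A <= osc S :=
  mean_dist_le_osc hB r1 Lrf bS bA.
Let powL0 n : 0 < L ^+ n. Proof. by rewrite exprn_gt0 //; move: L2; lra. Qed.
Let powL1 n : 1 <= L ^+ n. Proof. by rewrite exprn_ege1 //; move: L2; lra. Qed.

Let LL : L <= L ^+ 2. Proof. by move: L2 => h; rewrite expr2; nra. Qed.
Let L1L : 1 + L <= 2 * L ^+ 2. Proof. by move: L2 => h; rewrite expr2; nra. Qed.
Let LL1 : L * (1 + L) <= 2 * L ^+ 2. Proof. by move: L2 => h; rewrite expr2; nra. Qed.
Let L0 : 0 < L. Proof. by move: L2 => h; lra. Qed.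
Let L1 : 1 <= L. Proof. by move: L2 => h; lra. Qed.

Lemma average_sub A Q (s N : R) : BB A -> BB Q -> A `<=` Q -> m Q <= s * m A ->
  md (fa Q) Q <= N -> `|fa A - fa Q| <= s * N.
Proof.
move=> bA bQ AQ mQ mdN; have mA := m_gt0 bA; have mQ0 := m_gt0 bQ.
apply: (le_trans (average_dist hB r1 Lrf (fa Q) bA)).
rewrite -(ler_pM2l mA); apply: (le_trans (md_sub (fa Q) bA bQ AQ)).
have h := md_ge0 (fa Q) bQ.
apply: (@le_trans _ _ (s * m A * md (fa Q) Q)); first by rewrite ler_wpM2r.
rewrite mulrAC mulrC ler_pM2l // ler_wpM2l //.
by rewrite -(pmulr_lge0 _ mA) (le_trans _ mQ) // ltW.
Qed.

(** Replacing [A] by [H A] costs at most [L * N] and halves the remaining ratio of sizes, so [n]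
    steps reach the scale of [A'], where [H A] swallows [A']. A step is taken only while [A] is
    smaller than [A'], which preserves [m A <= L * m A']. *)
Lemma average_chain n A A' (N : R) : BB A -> BB A' ->
  (forall Q, BB Q -> A `<=` Q -> md (fa Q) Q <= N) -> A `&` A' !=set0 ->
  m A' <= 2 ^+ n * m A -> m A <= L * m A' ->
  `|fa A - fa A'| <= 2 * L ^+ 2 * n.+1%:R * N.
Proof.
elim: n A => [|n IH] A bA bA' HN AA' mA' mA.
  rewrite expr0 mul1r in mA'.
  have A'Q : A' `<=` H A.
    apply: (exp_swallow HE bA bA'); first by rewrite setIC.
    by have := m_gt0 bA; lra.
  have N0 : 0 <= N by apply: le_trans (HN _ bA (@subset_refl _ A)); exact: md_ge0.
  have h1 := average_sub bA (bH bA) (exp_sub HE bA) (exp_le HE bA)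
    (HN _ (bH bA) (exp_sub HE bA)).
  have h2 : `|fa A' - fa (H A)| <= L ^+ 2 * N.
    apply: average_sub => //; first exact: bH.
      apply: (le_trans (exp_le HE bA)); rewrite expr2 -mulrA ler_pM2l //.
    by apply: HN (exp_sub HE bA); exact: bH.
  apply: (le_trans (ler_distD (fa (H A)) _ _)).
  rewrite [`|fa (H A) - _|]distrC mulr1; apply: (le_trans (lerD h1 h2)).
  by rewrite -[leRHS]mulrA mulr_natl mulr2n lerD2r ler_wpM2r.
have N0 : 0 <= N by apply: le_trans (HN _ bA (@subset_refl _ A)); exact: md_ge0.
have [le|lt] := leP (m A') (m A).
  have mA'' : m A' <= 2 ^+ n * m A.
    have p2 : 1 <= 2 ^+ n :> R by apply: exprn_ege1; rewrite ler1n.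
    by apply: (le_trans le); rewrite ler_peMl // ltW // m_gt0.
  apply: (le_trans (IH A bA bA' HN AA' mA'' mA)).
  rewrite ler_wpM2r // ler_pM2l; last by apply: mulr_gt0 (powL0 _).
  by rewrite ler_nat.
have h1 := average_sub bA (bH bA) (exp_sub HE bA) (exp_le HE bA)
  (HN _ (bH bA) (exp_sub HE bA)).
apply: (le_trans (ler_distD (fa (H A)) _ _)).
have LN : L * N <= 2 * L ^+ 2 * N.
  by rewrite ler_wpM2r //; apply: (le_trans LL); rewrite ler_peMl ?(ltW (powL0 _)) // ler1n.
have [big|HT] := exp_double HE bA.
  have h2 : `|fa (H A) - fa A'| <= 2 * L ^+ 2 * n.+1%:R * N.
    apply: IH => //; first exact: bH.
    - by move=> Q bQ HQ; apply: HN => //; apply: subset_trans HQ; exact: exp_sub HE _ bA.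
    - have [x [Ax A'x]] := AA'; exists x; split => //; exact: (exp_sub HE bA).
    - apply: (le_trans mA'); rewrite exprSr -mulrA ler_pM2l ?exprn_gt0 //.
      exact: ltW.
    - apply: (le_trans (exp_le HE bA)); rewrite ler_pM2l //.
      exact: ltW.
  apply: (le_trans (lerD h1 h2)).
  rewrite -[n.+2]addn1 natrD mulrDr mulr1 [leRHS]mulrDl addrC lerD2l //.
(* Here [H A] is the whole space; it contains [A'], and the chain ends in one comparison. *)
have h2 : `|fa A' - fa (H A)| <= L * N.
  apply: average_sub => //; first exact: bH.
  - by rewrite HT.
  - by apply: (le_trans (exp_le HE bA)); rewrite ler_pM2l ?(ltW lt).
  - by apply: HN (exp_sub HE bA); exact: bH.
rewrite [`|fa (H A) - _|]distrC; apply: (le_trans (lerD h1 h2)).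
have n2 : 2 <= n.+2%:R :> R by rewrite ler_nat.
apply: (@le_trans _ _ (2 * L ^+ 2 * N * 2)); first by lra.
rewrite [leRHS]mulrAC ler_wpM2l // mulr_ge0 // mulr_ge0 // ltW //; exact: powL0.
Qed.

Lemma mean_dist_hull S : BB S ->
  m (H S) * md (fa S) (H S) <= 2 * L ^+ 2 * m S * osc S.
Proof.
move=> bS; have mS := m_gt0 bS; have o0 := osc0 bS.
have h1 := md_tri (fa S) (fa (H S)) (bH bS).
have h2 := md_osc bS (bH bS) (exp_sub HE bS).
have h3 := average_sub bS (bH bS) (exp_sub HE bS) (exp_le HE bS) h2.
rewrite distrC in h3.
have h4 : md (fa S) (H S) <= (1 + L) * osc S.
  by rewrite mulrDl mul1r; apply: (le_trans h1); exact: lerD.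
have h5 := exp_le HE bS.
apply: (@le_trans _ _ (L * m S * ((1 + L) * osc S))).
  by apply: ler_pM => //; [apply/ltW/m_gt0/bH|exact/md_ge0/bH].
have -> : L * m S * ((1 + L) * osc S) = (L * (1 + L)) * (m S * osc S) by ring.
by rewrite -[leRHS]mulrA ler_wpM2r ?mulr_ge0 // ?(ltW mS) // LL1.
Qed.

(** The ball [D] need not contain [S], but [H D] does, so [osc S] controls the oscillation on [H D];
    the chain of averages from [S] to [D] contributes the logarithm. *)
Lemma mean_dist_large S D n : BB S -> BB D -> D `&` S !=set0 -> m S <= m D ->
  m D <= 2 ^+ n * m S -> md (fa S) D <= 4 * L ^+ 3 * n.+1%:R * osc S.
Proof.
move=> bS bD DS mSD mD; have mS := m_gt0 bS; have o0 := osc0 bS; have mD0 := m_gt0 bD.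
have SQ : S `<=` H D.
  by apply: (exp_swallow HE bD bS); [rewrite setIC|lra].
have bQ := bH bD.
have h1 := md_osc bS bQ SQ.
have h2 := average_sub bD bQ (exp_sub HE bD) (exp_le HE bD) h1.
have h3 : `|fa S - fa D| <= 2 * L ^+ 2 * n.+1%:R * osc S.
  apply: average_chain => //.
  - by move=> Q bQ' SQ'; exact: md_osc.
  - by rewrite setIC.
  - by apply: (le_trans mSD); rewrite ler_peMl // ltW //.
have h4 := md_tri (fa S) (fa (H D)) bQ.
have h5 := ler_distD (fa D) (fa (H D)) (fa S).
rewrite [`|fa (H D) - fa D|]distrC [`|fa D - fa S|]distrC in h5.
have n1 : 1 <= n.+1%:R :> R by rewrite ler1n.
have h6 : md (fa S) (H D) <= 4 * L ^+ 2 * n.+1%:R * osc S.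
  have : (1 + L) * osc S <= 2 * L ^+ 2 * n.+1%:R * osc S.
    rewrite ler_wpM2r //; apply: (@le_trans _ _ (2 * L ^+ 2)).
      exact: L1L.
    by rewrite ler_peMr //; apply: mulr_ge0; [by []|apply/ltW/powL0].
  move=> h7; apply: (le_trans h4).
  apply: (le_trans (lerD h1 (le_trans h5 (lerD h2 h3)))).
  rewrite addrA -[X in X + _ + _]mul1r -mulrDl.
  have -> : 4 * L ^+ 2 * n.+1%:R * osc S =
    2 * L ^+ 2 * n.+1%:R * osc S + 2 * L ^+ 2 * n.+1%:R * osc S by ring.
  by rewrite lerD2r.
rewrite -(ler_pM2l mD0); apply: (le_trans (md_sub (fa S) bD bQ (exp_sub HE bD))).
apply: (@le_trans _ _ (L * m D * (4 * L ^+ 2 * n.+1%:R * osc S))).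
  apply: ler_pM; [exact/ltW/m_gt0|exact: md_ge0|exact: (exp_le HE bD)|exact: h6].
by rewrite le_eqVlt; apply/orP; left; apply/eqP; ring.
Qed.

(** The value is [2 * L ^+ 2], the constant of [mean_dist_hull], times the [16 * L ^+ 6] demanded by
    [stop_sum]. The further [L] in [bad_level] is the price of passing from [H D] to [D] in
    [mean_dist_near_child]. *)
Definition stop_level : R := 32 * L ^+ 8.
Definition bad_level : R := 32 * L ^+ 9.

(* Maximality up to a factor 2 is what makes the balls larger than a stopping
   ball, and near it, satisfy the reverse inequality. *)
Definition stops S A : Prop :=
  [/\ BB A, A `&` S !=set0, m A <= m S, stop_level * osc S < md (fa S) A &
    forall Q, BB Q -> A `<=` Q -> 2 * m A < m Q -> m Q <= m S ->
      md (fa S) Q <= stop_level * osc S].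

Definition bad_balls S : set (set T) :=
  [set D | [/\ BB D, D `&` S !=set0, m D <= m S & bad_level * osc S < md (fa S) D]].

Definition bad S : set T := \bigcup_(D in bad_balls S) D.

Let stop_level_gt0 : 0 < stop_level. Proof. exact: mulr_gt0 (powL0 _). Qed.
Let bad_levelE : bad_level = L * stop_level.
Proof. by rewrite /bad_level /stop_level; ring. Qed.
Let stop_le_bad : stop_level <= bad_level.
Proof. by rewrite bad_levelE ler_peMl // ltW. Qed.

Let bad_level_ge : L ^+ 2 * (1 + L ^+ 2) <= bad_level.
Proof.
have e : bad_level = L ^+ 4 * (32 * L ^+ 5) by rewrite /bad_level; ring.
have l5 := powL1 5; have l4 := powL1 4; have l24 : L ^+ 2 <= L ^+ 4.
  by rewrite ler_weXn2l.
have e4 : L ^+ 4 = L ^+ 2 * L ^+ 2 by rewrite -exprD.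
rewrite e mulrDr mulr1 -e4.
have : L ^+ 4 * 32 <= L ^+ 4 * (32 * L ^+ 5).
  by rewrite ler_pM2l ?powL0 //; move: l5; move: (L ^+ 5) => a *; lra.
move: l4 l24; move: (L ^+ 2) (L ^+ 4) (L ^+ 4 * (32 * L ^+ 5)) => a b c; lra.
Qed.

Lemma sub_hull_of_meet S D : BB S -> BB D -> D `&` S !=set0 -> m D <= m S -> D `<=` H S.
Proof.
move=> bS bD DS mD; apply: (exp_swallow HE bS bD) => //.
by apply: (le_trans mD); rewrite ler_peMl ?ler1n // ltW // m_gt0.
Qed.

(** Among the balls around [D] above the level, [A] has more than half the supremal size; a ball
    containing [A], still above the level and more than twice as large would exceed the supremum. *)
Lemma stops_extend S D : BB S -> BB D -> D `&` S !=set0 -> m D <= m S ->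
  stop_level * osc S < md (fa S) D -> exists2 A, stops S A & D `<=` A.
Proof.
move=> bS bD [x [Dx Sx]] mD sD.
pose E := [set m A | A in [set A | [/\ BB A, D `<=` A, m A <= m S &
  stop_level * osc S < md (fa S) A]]].
have supE : has_sup E.
  split; first by exists (m D); exists D => //; split.
  by exists (m S) => _ [A [_ _ ? _] <-].
have E0 : 0 < sup E.
  apply: (lt_le_trans (m_gt0 bD)); apply: sup_upper_bound => //.
  by exists D => //; split.
have [|_ [A [bA DA mA sA] <-] Alt] := @sup_adherent _ E (sup E / 2) _ supE.
  by rewrite divr_gt0.
exists A => //; split => //; first by exists x; split => //; exact: DA.
move=> Q bQ AQ mQ mQS; rewrite leNgt; apply/negP => sQ.
have : m Q <= sup E.
  by apply: sup_upper_bound => //; exists Q => //; split => //; exact: subset_trans AQ.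
move: Alt mQ; move: (sup E) (m A) (m Q) => a b c *; lra.
Qed.

Lemma bad_stops S x : BB S -> bad S x -> exists2 D, stops S D & D x.
Proof.
move=> bS [D [bD DS mD sD] Dx].
have [|A sA DA] := stops_extend bS bD DS mD.
  apply: le_lt_trans sD; rewrite ler_wpM2r //; exact: osc0.
by exists A => //; exact: DA.
Qed.

(** If [osc S = 0], then [mean_dist_hull] makes the mean distance to the average of [S] vanish on
    every ball inside [H S], so no level can be exceeded. This justifies cancelling [osc S]. *)
Lemma stops_osc_gt0 S A : BB S -> stops S A -> 0 < osc S.
Proof.
move=> bS [bA AS mA sA _]; rewrite lt_neqAle osc0 // andbT; apply/eqP => o0.
move: sA; rewrite -o0 mulr0; apply/negP; rewrite -leNgt.
have := md_sub (fa S) bA (bH bS) (sub_hull_of_meet bS bA AS mA).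
move=> /le_trans/(_ (mean_dist_hull bS)); rewrite -o0 mulr0 pmulr_rle0 //.
exact: m_gt0.
Qed.

(** Chebyshev's inequality: disjoint stopping balls all lie in [H S], where the integral of the
    distance to the average of [S] is at most [2 * L ^+ 2 * m S * osc S]. *)
Lemma stopping_stops : stopping BB m L stops.
Proof.
split=> [S A bS []//|S A bS sA|S A P n bS sA dA].
  have o0 := stops_osc_gt0 bS sA; have [bA AS mA lA _] := sA.
  have := md_sub (fa S) bA (bH bS) (sub_hull_of_meet bS bA AS mA).
  move=> /le_trans/(_ (mean_dist_hull bS)) h.
  have : m A * (stop_level * osc S) <= 2 * L ^+ 2 * m S * osc S.
    by apply: le_trans h; rewrite ler_pM2l ?m_gt0 // ltW.
  have -> : m A * (stop_level * osc S) =
    (2 * L ^+ 2 * (16 * L ^+ 6 * m A)) * osc S by rewrite /stop_level; ring.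
  rewrite ler_pM2r // ler_pM2l; last exact: mulr_gt0 (powL0 _).
  apply: le_trans.
  have -> : 16 * L ^+ 6 * m A = 16 * L ^+ 2 * (L ^+ 4 * m A) by ring.
  rewrite ler_peMl //; first by apply: mulr_ge0; apply: ltW; [exact: powL0|exact: m_gt0].
  by have := powL1 2; move: (L ^+ 2) => a *; lra.
have [[k [kn Pk]]|no] := pselect (exists k, (k < n)%N /\ P k); last first.
  rewrite big_nat_cond big1 ?mulr0 ?ltW ?m_gt0 // => k /andP[/andP[_ kn] Pk].
  by exfalso; apply: no; exists k.
have o0 := stops_osc_gt0 bS (sA _ kn Pk).
have AQ j : (j < n)%N -> P j -> BB (A j) /\ A j `<=` H S.
  by move=> jn Pj; have [bA AS mA _ _] := sA _ jn Pj; split => //; exact: sub_hull_of_meet.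
have : \sum_(0 <= j < n | P j) mass mu f (fa S) (A j) <= mass mu f (fa S) (H S).
  rewrite -lee_fin -sumEFin -(massE hB r1 Lrf _ (bH bS)).
  rewrite [leLHS](_ : _ = (\sum_(0 <= j < n | P j) \int[mu]_(x in A j) (`|f x - fa S|)%:E)%E).
    apply: disjoint_integral_le => //.
    - exact/(ball_measurable hB)/bH.
    - exact: (measurable_funTS (measurable_dist Lrf _)).
    - move=> j jn Pj; have [bA ?] := AQ _ jn Pj; split => //.
      exact: (ball_measurable hB).
  rewrite big_nat_cond [RHS]big_nat_cond; apply: eq_bigr => j /andP[/andP[_ jn] Pj].
  by have [bA _] := AQ _ jn Pj; rewrite (massE hB r1 Lrf _ bA).
rewrite (mass_mean f hB _ (bH bS)) => /le_trans/(_ (mean_dist_hull bS)) h.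
have : \sum_(0 <= j < n | P j) m (A j) * (stop_level * osc S) <=
    \sum_(0 <= j < n | P j) mass mu f (fa S) (A j).
  rewrite big_nat_cond [leRHS]big_nat_cond; apply: ler_sum => j /andP[/andP[_ jn] Pj].
  have [bA _ _ sj _] := sA _ jn Pj.
  by rewrite (mass_mean f hB _ bA) ler_pM2l ?m_gt0 // ltW.
move=> /le_trans/(_ h); rewrite -mulr_suml; set X := \sum_(_ <= _ < _ | _) _.
have -> : X * (stop_level * osc S) =
  (2 * L ^+ 2 * (16 * L ^+ 6 * X)) * osc S by rewrite /stop_level; ring.
by rewrite ler_pM2r // ler_pM2l //; exact: mulr_gt0 (powL0 _).
Qed.

(** The hull [H D] contains the stopping ball [A] and is more than twice as large. Up to the size of
    [S] the maximality of [A] therefore bounds the mean on [H D], and restricting to [D] costs a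
    factor [L]. *)
Lemma mean_dist_near_child S A D : BB S -> stops S A ->
  L ^+ 2 * m (H (H A)) <= m S -> H (H A) `<=` S -> BB D -> D `&` H (H A) !=set0 ->
  m (H (H A)) <= m D -> m D <= m S -> md (fa S) D <= bad_level * osc S.
Proof.
move=> bS sA mAS AS bD DA mAD mDS; have [bA _ _ _ maxA] := sA.
have bHA := bH bA; have bHHA := bH bHA; have bQ := bH bD.
have o0 := osc0 bS; have mA0 := m_gt0 bA; have mD0 := m_gt0 bD; have mS0 := m_gt0 bS.
have SQ : H (H A) `<=` H D.
  apply: (exp_swallow HE bD bHHA); first by rewrite setIC.
  by apply: (le_trans mAD); rewrite ler_peMl ?ler1n // ltW.
have AQ : A `<=` H D.
  apply: subset_trans SQ; apply: subset_trans (exp_sub HE bHA).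
  exact: (exp_sub HE bA).
(* The exceptional case, in which [H (H A)] is the whole space, would make it at least as large as
   [S], against the size hypothesis. *)
have mAA : 2 * m A < m (H (H A)).
  have mAHA := exp_mono HE bA bHA (exp_sub HE bA).
  have [lt|HT] := exp_double HE bHA.
    by apply: le_lt_trans lt; rewrite ler_pM2l.
  exfalso; have := exp_mono HE bS bHHA; rewrite HT => /(_ (@subsetT _ S)).
  rewrite -HT => le; have := le_trans mAS le.
  apply/negP; rewrite -ltNge ltr_pMl ?m_gt0 //.
  by rewrite expr2; move: L2 => h; nra.
have mQA : 2 * m A < m (H D).
  by apply: (lt_le_trans mAA); exact: (exp_mono HE bHHA bQ).
have mQ := exp_le HE bD.
have [mQS|mSQ] := leP (m (H D)) (m S).
  have h := maxA _ bQ AQ mQA mQS.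
  rewrite -(ler_pM2l mD0); apply: (le_trans (md_sub (fa S) bD bQ (exp_sub HE bD))).
  apply: (@le_trans _ _ (L * m D * (stop_level * osc S))).
    by apply: ler_pM => //; [exact/ltW/m_gt0|exact: md_ge0].
  by rewrite le_eqVlt bad_levelE; apply/orP; left; apply/eqP; ring.
(* Beyond the size of [S] the maximality of [A] is silent; instead [H (H D)] contains [S], and
   [osc S] applies directly. *)
have bQ' := bH bQ.
have SQ' : S `<=` H (H D).
  apply: (exp_swallow HE bQ bS).
    have [x [Dx Ax]] := DA; exists x; split; first exact: AS.
    exact: (exp_sub HE bD).
  by apply: (le_trans (ltW mSQ)); rewrite ler_peMl ?ler1n // ltW // m_gt0.
have DQ' : D `<=` H (H D) by apply: subset_trans (exp_sub HE bQ); exact: (exp_sub HE bD).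
have mQ'D : m (H (H D)) <= L ^+ 2 * m D.
  by apply: (le_trans (exp_le HE bQ)); rewrite expr2 -mulrA ler_pM2l.
have mQ'S : m (H (H D)) <= L ^+ 2 * m S.
  by apply: (le_trans mQ'D); rewrite ler_pM2l // powL0.
have h1 := md_osc bS bQ' SQ'.
have h2 := average_sub bS bQ' SQ' mQ'S h1.
have h3 := md_tri (fa S) (fa (H (H D))) bQ'.
have h4 : md (fa S) (H (H D)) <= (1 + L ^+ 2) * osc S.
  rewrite mulrDl mul1r; apply: (le_trans h3); apply: lerD => //.
  by rewrite distrC.
rewrite -(ler_pM2l mD0); apply: (le_trans (md_sub (fa S) bD bQ' DQ')).
apply: (@le_trans _ _ (L ^+ 2 * m D * ((1 + L ^+ 2) * osc S))).
  by apply: ler_pM => //; [exact/ltW/m_gt0|exact: md_ge0].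
rewrite mulrAC mulrA -mulrA [leRHS]mulrCA [m D * _]mulrC.
by rewrite ler_wpM2r // mulr_ge0 // ltW.
Qed.

(** Produces the logarithmic growth hypothesis of [phi_mass_le]: goodness covers the scales up to
    [S], and [mean_dist_large] those above. *)
Lemma mean_dist_good S D : BB S -> BB D -> D `&` S !=set0 -> m D <= m S ->
  (forall Q, BB Q -> D `<=` Q -> m Q <= m S -> md (fa S) Q <= bad_level * osc S) ->
  forall n Q, BB Q -> D `<=` Q -> m Q <= 2 ^+ n * m D ->
    md (fa S) Q <= bad_level * n.+1%:R * osc S.
Proof.
move=> bS bD [x [Dx Sx]] mDS good n Q bQ DQ mQ; have o0 := osc0 bS.
have bl0 : 0 <= bad_level by apply: le_trans stop_le_bad; exact: ltW.
have [mQS|mSQ] := leP (m Q) (m S).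
  apply: (le_trans (good _ bQ DQ mQS)); rewrite ler_wpM2r //.
  by rewrite ler_peMr // ler1n.
have QS : Q `&` S !=set0 by exists x; split => //; exact: DQ.
have mQ2 : m Q <= 2 ^+ n * m S.
  by apply: (le_trans mQ); rewrite ler_pM2l // exprn_gt0.
apply: (le_trans (mean_dist_large bS bQ QS (ltW mSQ) mQ2)).
rewrite ler_wpM2r // ler_wpM2r //.
have -> : bad_level = 4 * L ^+ 3 * (8 * L ^+ 6) by rewrite /bad_level; ring.
rewrite ler_peMr //; first by apply: mulr_ge0; [by []|apply/ltW/powL0].
by have := powL1 6; move: (L ^+ 6) => a; lra.
Qed.

Lemma measurable_bad S : measurable (bad S).
Proof. by apply: (ball_separable hB) => D []. Qed.

End Stopping.

(** * Sizes of the bad sets and of the generations *)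

(** Recursion on fuel, because [p] is known to decrease at nodes only; there [k] units of fuel
    suffice for [k]. *)
Fixpoint tree_depth_fuel (p : nat -> nat) n k :=
  if n is n'.+1 then if k == 0%N then 0%N else (tree_depth_fuel p n' (p k)).+1 else 0%N.

Definition tree_depth p k := tree_depth_fuel p k k.

Section PathSystem.
Context {d : measure_display} {T : measurableType d} {R : realType}.
Context {U : completeNormedModType R}.
Variables (mu : {measure set T -> \bar R}) (BB : set (set T)) (K r L : R).
Variables (H : set T -> set T) (f : T -> U).
Hypothesis hB : ball_basis mu BB K.
Hypothesis r1 : 1 <= r.
Hypothesis Lrf : in_Lr mu r f.
Hypothesis HE : expansion BB (ball_size mu) H L.
Implicit Types (D Q S : set T) (c : U).
Local Notation m := (ball_size mu).
Local Notation osc := (osc mu BB f).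

Let L2 : 2 <= L := exp_ge2 HE.
Let m_gt0 A (bA : BB A) : 0 < m A := ball_size_gt0 hB bA.
Let bH A (bA : BB A) : BB (H A) := exp_ball HE bA.
Let powL0 n : 0 < L ^+ n. Proof. by rewrite exprn_gt0 //; move: L2; lra. Qed.
Let powL1 n : 1 <= L ^+ n. Proof. by rewrite exprn_ege1 //; move: L2; lra. Qed.
Let L0 : 0 < L. Proof. by move: L2; lra. Qed.
Let meas A (bA : BB A) : measurable A := ball_measurable hB bA.

(** A Vitali covering argument for a possibly uncountable family: the hulls of a greedily chosen
    disjoint sequence cover the union, and the masses of disjoint balls in [Q] add up. *)
Lemma union_size_le (F : set (set T)) c Q (s : R) : 0 < s -> BB Q ->
  (forall A, F A -> [/\ BB A, A `<=` Q & s * m A <= mass mu f c A]) ->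
  (mu (\bigcup_(A in F) A) <= (L / s * mass mu f c Q)%:E)%E.
Proof.
move=> s0 bQ FQ.
pose cand (h : seq (option (set T))) A := F A /\
  forall i B, (i < size h)%N -> nth None h i = Some B -> A `&` B = set0.
have [|u uP] := @greedy_sequence R _ cand m (m Q).
  move=> h A [/FQ[bA AQ _] _]; rewrite m_gt0 //=.
  exact: (exp_mono HE bA bQ AQ).
pose A k := odflt set0 (u k); pose act k := isSome (u k).
have uE k : act k -> u k = Some (A k) by rewrite /act /A; case: (u k).
have actP k : act k -> [/\ F (A k), (forall j, (j < k)%N -> act j -> A k `&` A j = set0) &
    forall B, F B -> (forall j, (j < k)%N -> act j -> B `&` A j = set0) -> m B <= 2 * m (A k)].
  move=> ak; have := uP k; rewrite uE // => -[[Fk dk] mx]; split => //.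
    by move=> j jk aj; apply: (dk j); rewrite ?size_mkseq // nth_mkseq // uE.
  move=> B FB dB; apply: mx; split => // i C; rewrite size_mkseq => ik.
  rewrite nth_mkseq // => ui; have ai : act i by rewrite /act ui.
  by have := dB _ ik ai; rewrite /A ui.
have dis n j k : (j < k)%N -> (k < n)%N -> act j -> act k -> A j `&` A k = set0.
  by move=> jk _ aj ak; rewrite setIC; have [_ h _] := actP _ ak; exact: h.
have sub n k : (k < n)%N -> act k -> BB (A k) /\ A k `<=` Q.
  by move=> _ /actP[/FQ[]].
have sumQ n : \sum_(0 <= k < n | act k) m (A k) <= m Q.
  by apply: (exp_disjoint HE bQ (sub n) (@dis n)).
have cover B : F B -> exists2 k, act k & B `<=` H (A k).
  move=> FB; have [bB BQ _] := FQ _ FB.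
  have [[k [ak ne]]|no] := pselect (exists k, act k /\ B `&` A k !=set0).
    have ex : exists k, act k && `[< B `&` A k !=set0 >].
      by exists k; rewrite ak; apply/asboolP.
    case: (ex_minnP ex) => {k ak ne} k /andP[ak /asboolP ne] kmin.
    exists k => //; have [Fk _ mx] := actP _ ak; have [bk _ _] := FQ _ Fk.
    apply: (exp_swallow HE bk bB) => //; apply: mx => // j jk aj.
    apply: contrapT => /eqP/set0P nej; have := kmin j; rewrite aj leqNgt jk /=.
    by move=> /(_ _)/negP; apply => //; apply/asboolP.
  exfalso.
  (* A ball disjoint from all chosen ones would stay a candidate for ever, so infinitely many
     disjoint balls of size at least [m B / 2] would fit into [Q]. *)
  have dB k : act k -> B `&` A k = set0.
    by move=> ak; apply: contrapT => /eqP/set0P ne; apply: no; exists k.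
  have aa k : act k.
    rewrite /act; have := uP k; case uk : (u k) => [//|] nc; exfalso; apply: (nc B).
    split => // i C; rewrite size_mkseq => ik; rewrite nth_mkseq // => ui.
    have ai : act i by rewrite /act ui.
    by have := dB _ ai; rewrite /A ui.
  have big k : m B / 2 <= m (A k).
    have [_ _ mx] := actP _ (aa k); have := mx _ FB (fun j _ aj => dB j aj).
    by move: (m B) (m (A k)) => a b h; lra.
  have B0 := m_gt0 bB; pose n := (Num.truncn (2 * m Q / m B)).+1.
  have h1 := sumQ n.
  have : \sum_(0 <= k < n | act k) (m B / 2) <= \sum_(0 <= k < n | act k) m (A k).
    exact: ler_sum.
  rewrite (eq_bigl predT); last by move=> k; rewrite aa.
  rewrite sumr_const_nat subn0 -[_ *+ n]mulr_natr => /le_trans/(_ h1).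
  have : 2 * m Q / m B < n%:R by rewrite truncnS_gt.
  rewrite ltr_pdivrMr //.
  move: (n%:R) (m B) (m Q) B0 {h1} => a b c'' *; nra.
pose G k := if act k then H (A k) else set0.
have mG k : measurable (G k).
  rewrite /G; case: ifP => // ak; apply/meas/bH.
  by have [/FQ[]] := actP _ ak.
have mF : measurable (\bigcup_(A in F) A).
  by apply: (ball_separable hB) => B /FQ[].
have FG : \bigcup_(A in F) A `<=` \bigcup_k G k.
  move=> x [B FB Bx]; have [k ak BH] := cover _ FB.
  by exists k => //; rewrite /G ak; exact: BH.
apply: (le_trans (measure_sigma_subadditive mu mG mF FG)).
apply: nneseries_le_bound => // n.
have massQ : \sum_(0 <= k < n | act k) mass mu f c (A k) <= mass mu f c Q.
  rewrite -lee_fin -sumEFin -(massE hB r1 Lrf _ bQ).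
  rewrite [leLHS](_ : _ = (\sum_(0 <= j < n | act j) \int[mu]_(x in A j) (`|f x - c|)%:E)%E).
    apply: disjoint_integral_le => //.
    - exact: meas.
    - exact: (measurable_funTS (measurable_dist Lrf _)).
    - by move=> j jn aj; have [bA ?] := sub _ _ jn aj; split => //; exact: meas.
    - exact: dis.
  apply: eq_bigr => j aj.
  by have [bA _] := sub _ _ (ltnSn j) aj; rewrite (massE hB r1 Lrf _ bA).
have LS0 : 0 <= L / s by apply: divr_ge0; [exact: ltW|exact: ltW].
apply: (@le_trans _ _ (\sum_(0 <= k < n | act k) (L / s * mass mu f c (A k))%:E)%E); last first.
  by rewrite sumEFin lee_fin -mulr_sumr ler_wpM2l.
rewrite [leRHS]big_mkcond /=; apply: lee_sum => k _; rewrite /G; case: ifP => ak; last first.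
  by rewrite measure0.
have [/FQ[bA _ sA] _ _] := actP _ ak.
rewrite (ball_sizeE hB (bH bA)) lee_fin; apply: (le_trans (exp_le HE bA)).
by rewrite -[leRHS]mulrA ler_pM2l // ler_pdivlMl.
Qed.

(** [union_size_le] in [H S] with threshold [bad_level L * osc S] leaves [m S / (16 * L ^+ 6)], and
    [m S] is at most [L ^+ 2 * m A]. *)
Lemma bad_size_le A : BB A -> (mu (bad mu BB L f (H (H A))) <= (m A / 4)%:E)%E.
Proof.
move=> bA; set S := H (H A).
have bS : BB S by do 2 apply: bH.
have mS : m S <= L ^+ 2 * m A.
  have h1 := exp_le HE bA; have h2 := exp_le HE (bH bA).
  by apply: (le_trans h2); rewrite expr2 -mulrA ler_pM2l.
(* The absence of bad balls is treated apart, because [osc S] may then be zero. *)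
have [[D bdD]|no] := pselect (exists D, bad_balls mu BB L f S D); last first.
  rewrite /bad (_ : bad_balls _ _ _ _ _ = set0); last first.
    by apply/seteqP; split => // D bD; apply: no; exists D.
  by rewrite bigcup_set0 measure0 lee_fin divr_ge0 // ltW // m_gt0.
have o0 : 0 < osc S.
  have [_ [x [Dx _]] _ _] := bdD.
  have [A' sA' _] := bad_stops hB r1 Lrf HE bS (ex_intro2 _ _ D bdD Dx).
  exact: (stops_osc_gt0 hB r1 Lrf HE bS sA').
have bl0 : 0 < bad_level L by apply: mulr_gt0 (powL0 _).
apply: (le_trans (@union_size_le _ (average mu S f) (H S) (bad_level L * osc S) _ (bH bS) _)).
- exact: mulr_gt0.
- move=> {bdD} {}D [bD DS mD sD]; split => //.
    by apply: (exp_swallow HE bS bD DS); apply: (le_trans mD); rewrite ler_peMl ?ler1n // ltW // m_gt0.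
  by rewrite (mass_mean f hB _ bD) mulrC ler_pM2l ?m_gt0 // ltW.
rewrite lee_fin (mass_mean f hB _ (bH bS)).
have LS0 : 0 <= L / (bad_level L * osc S).
  by apply: divr_ge0; [exact: ltW|apply/ltW/mulr_gt0].
apply: (@le_trans _ _ (L / (bad_level L * osc S) * (2 * L ^+ 2 * m S * osc S))).
  by rewrite ler_wpM2l // (mean_dist_hull hB r1 Lrf HE bS).
have Ln0 : L != 0 by rewrite gt_eqF.
have -> : L / (bad_level L * osc S) * (2 * L ^+ 2 * m S * osc S) = m S / (16 * L ^+ 6).
  by rewrite /bad_level; field; rewrite Ln0 gt_eqF.
rewrite ler_pdivrMr; last by apply: mulr_gt0 (powL0 _).
apply: (le_trans mS).
have -> : m A / 4 * (16 * L ^+ 6) = (4 * L ^+ 4) * (L ^+ 2 * m A) by field.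
rewrite ler_peMl //; first by apply/ltW/mulr_gt0 => //; exact: m_gt0.
by have := powL1 4; move: (L ^+ 4) => a; lra.
Qed.

Variables (B : set T) (node : pred nat) (A : nat -> set T) (p : nat -> nat).
Hypothesis NT : node_tree BB m H L (stops mu BB L f) B node A p.

Let S k := H (H (A k)).
Let ballA k : node k -> BB (A k) := @node_ball _ _ _ _ _ _ _ _ _ _ _ NT k.
Let ballS k : node k -> BB (S k). Proof. by move=> nk; do 2 apply: bH; apply: ballA. Qed.
Let mSA k : node k -> m (S k) <= L ^+ 2 * m (A k).
Proof.
move=> nk; have bA := ballA nk; have h1 := exp_le HE bA; have h2 := exp_le HE (bH bA).
by apply: (le_trans h2); rewrite expr2 -mulrA ler_pM2l.
Qed.

Definition sparse_core k := A k `\` \bigcup_(t in [set t | (k < t)%N && node t]) A t.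

Lemma measurable_sparse_core k : node k -> measurable (sparse_core k).
Proof.
move=> nk; apply: measurableD; first exact/meas/ballA.
by apply: bigcup_measurable => t /andP[_ nt]; exact/meas/ballA.
Qed.

Lemma sparse_core_size k : node k -> ((3 / 4 * m (A k))%:E <= mu (sparse_core k))%E.
Proof.
move=> nk; have bA := ballA nk; have mA := m_gt0 bA.
set Ut := \bigcup_(t in [set t | (k < t)%N && node t]) A t.
have mUt : measurable Ut.
  by apply: bigcup_measurable => t /andP[_ nt]; exact/meas/ballA.
pose P t := [&& (k < t)%N, node t & `[< A t `&` A k !=set0 >]].
pose G t := if P t then A t else set0.
have mG t : measurable (G t).
  by rewrite /G /P; case: ifP => // /and3P[_ nt _]; exact/meas/ballA.
have AG : A k `&` Ut `<=` \bigcup_t G t.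
  move=> x [Akx [t /andP[kt nt] Atx]]; exists t => //; rewrite /G /P kt nt /= asboolT //.
  by exists x.
have h : (mu (A k `&` Ut) <= (m (A k) / 4)%:E)%E.
  apply: (le_trans (measure_sigma_subadditive mu mG _ AG)).
    by apply: measurableI => //; exact: meas.
  apply: nneseries_le_bound => // n.
  have -> : (\sum_(0 <= t < n) mu (G t) = (\sum_(0 <= t < n | P t) m (A t))%:E)%E.
    rewrite -sumEFin [RHS]big_mkcond /=; apply: eq_bigr => t _; rewrite /G.
    case: ifP => [/and3P[_ nt _]|_]; last by rewrite measure0.
    by rewrite (ball_sizeE hB) //; exact: ballA.
  rewrite lee_fin ler_pdivlMr // mulrC; exact: (node_later NT n nk).
have e : mu (A k) = (mu (A k `&` Ut) + mu (sparse_core k))%E.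
  rewrite /sparse_core -/Ut -measureU ?setUIDK //.
  - by apply: measurableI => //; exact: meas.
  - by apply: measurableD => //; exact: meas.
  - by rewrite setDE setIACA setICr setI0.
have -> : (3 / 4 * m (A k))%:E = ((m (A k))%:E - (m (A k) / 4)%:E)%E.
  by rewrite -EFinB; congr EFin; field.
rewrite leeBlDr // -(ball_sizeE hB bA) e addeC leeD2l //.
Qed.

Let bad S := bad mu BB L f S.

Lemma sparse_core_not_bad k : node k ->
  A k `\` (\bigcup_(t in [set t | (k < t)%N && node t]) A t `|` bad (S k)) !=set0.
Proof.
move=> nk; have bA := ballA nk; have mA := m_gt0 bA.
have h1 := sparse_core_size nk; have h2 := bad_size_le bA.
apply/set0P/eqP; rewrite setDUr => e.
have sub : sparse_core k `<=` bad (S k).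
  move=> x cx; apply: contrapT => nb.
  have : set0 x by rewrite -e; split => //; split => //; have [] := cx.
  by [].
have : (mu (sparse_core k) <= mu (bad (S k)))%E.
  apply: le_measure => //; rewrite inE; first exact: measurable_sparse_core.
  exact: (measurable_bad L f hB).
move=> /(le_trans h1)/le_trans/(_ h2); rewrite lee_fin.
by apply/negP; rewrite -ltNge; move: (m (A k)) mA => a; lra.
Qed.

(** Let [D] be a bad ball of [S k] through [x]. A child around [x] no larger than [D] would make [D]
    good by [mean_dist_near_child], and only finitely many nodes have larger balls. *)
Lemma bad_finite_children k x : node k -> bad (S k) x ->
  exists n, forall i, (n <= i)%N -> (0 < i)%N -> node i -> p i = k -> ~ S i x.
Proof.
move=> nk [D [bD DS mD sD] Dx].
have [|n nP] := node_small NT (e := m D / L ^+ 2).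
  by apply: divr_gt0 (powL0 _); exact: m_gt0.
exists n => i ni i0 noi pi Si.
have [_ _ st] := node_parent NT i0 noi; have nst := node_nested NT i0 noi.
have hs := node_step NT i0 noi; rewrite pi in st nst hs.
have le : m (S i) <= m D.
  apply: (le_trans (mSA noi)); have := nP _ ni noi; rewrite ltr_pdivlMr ?powL0 //.
  by rewrite mulrC => /ltW.
have := mean_dist_near_child hB r1 Lrf HE (ballS nk) st hs nst bD _ le mD.
move=> /(_ _)/le_gtF; rewrite sD => h.
by have : true = false by apply: h; exists x.
Qed.

Local Notation dep := (tree_depth p).

Lemma depth_fuel n k : (k <= n)%N -> node k -> tree_depth_fuel p n k = dep k.
Proof.
rewrite /tree_depth; elim/ltn_ind: k n => k IH n; case: (posnP k) => [-> _ _|k0].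
  by case: n.
case: n => [|n]; first by case: k IH k0.
move=> kn nk; have [pk np _] := node_parent NT k0 nk.
rewrite /= gtn_eqF //; case: k IH k0 kn nk pk np => // k IH _ kn nk pk np /=.
congr _.+1; rewrite (IH _ pk n) //; last exact: (leq_trans pk kn).
by rewrite (IH _ pk k).
Qed.

Lemma depth_parent k : (0 < k)%N -> node k -> dep k = (dep (p k)).+1.
Proof.
move=> k0 nk; have [pk np _] := node_parent NT k0 nk.
case: k k0 nk pk np => // k _ nk pk np.
by rewrite {1}/tree_depth /= depth_fuel.
Qed.

(** By [node_children], passing to the children shrinks the total hull size by a factor
    [16 * L ^+ 4], of which only 2 is kept. *)
Lemma depth_sum n M : \sum_(0 <= k < M | node k && (dep k == n)) m (S k) <= 2^-1 ^+ n * m (S 0%N).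
Proof.
have n0 := node0 NT; have S0 := m_gt0 (ballS n0).
elim: n M => [|n IH] M.
  rewrite expr0 mul1r; case: M => [|M]; first by rewrite big_geq // ltW.
  rewrite big_mkcond big_nat_recl //= n0 /= big1 ?addr0 //.
  by move=> k _; case: ifP => // /andP[nk]; rewrite depth_parent.
apply: (@le_trans _ _ (2^-1 * \sum_(0 <= j < M | node j && (dep j == n)) m (S j))); last first.
  by rewrite exprS -mulrA ler_pM2l ?invr_gt0.
rewrite [in leLHS]big_mkord.
rewrite (partition_big (fun k : 'I_M => insubd k (p k))
  (fun j : 'I_M => node j && (dep j == n))); last first.
  move=> k /andP[nk]; case: (posnP k) => [->//|k0].
  have [pk np _] := node_parent NT k0 nk.
  by rewrite depth_parent // eqSS val_insubd (ltn_trans pk) // np.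
rewrite big_mkord mulr_sumr; apply: ler_sum => j /andP[nj _].
have h := node_children NT M nj; rewrite big_mkord -/(S j) in h.
apply: (@le_trans _ _ (\sum_(k < M | [&& (0 < k)%N, node k & p k == j]) L ^+ 2 * m (A k))).
  apply: (@le_trans _ _ (\sum_(k < M | [&& (0 < k)%N, node k & p k == j]) m (S k))).
    apply: ler_sum_subpred => k; last by case/and3P => _ nk _; apply/ltW/m_gt0/ballS.
    case/andP => /andP[nk dk] /eqP <-; case: (posnP k) => [k0|k0]; first by rewrite k0 in dk.
    have [pk np _] := node_parent NT k0 nk.
    by rewrite nk /= val_insubd (ltn_trans pk).
  by apply: ler_sum => k /and3P[_ nk _]; exact: mSA.
rewrite -mulr_sumr; set X := \sum_(_ | _) _ in h *.
have X0 : 0 <= X by apply: sumr_ge0 => k /and3P[_ nk _]; apply/ltW/m_gt0/ballA.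
rewrite ler_pdivlMl //; apply: le_trans h; rewrite mulrA ler_wpM2r //.
have -> : 16 * L ^+ 6 = 16 * L ^+ 4 * L ^+ 2 by ring.
rewrite ler_pM2r //; have := powL1 4; move: (L ^+ 4) => a; lra.
Qed.

Definition depth_union n := \bigcup_(k in [set k | node k && (dep k == n)]) S k.

Lemma measurable_depth_union n : measurable (depth_union n).
Proof. by apply: bigcup_measurable => k /andP[nk _]; exact/meas/ballS. Qed.

Lemma depth_union_size n : (mu (depth_union n) <= (2^-1 ^+ n * m (S 0%N))%:E)%E.
Proof.
pose G k := if node k && (dep k == n) then S k else set0.
have mG k : measurable (G k).
  by rewrite /G; case: ifP => // /andP[nk _]; exact/meas/ballS.
have sub : depth_union n `<=` \bigcup_k G k.
  by move=> x [k /= nk Sx]; exists k => //; rewrite /G nk.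
apply: (le_trans (measure_sigma_subadditive mu mG (measurable_depth_union n) sub)).
apply: nneseries_le_bound => // M.
have -> : (\sum_(0 <= k < M) mu (G k) =
    (\sum_(0 <= k < M | node k && (dep k == n)) m (S k))%:E)%E.
  rewrite -sumEFin [RHS]big_mkcond /=; apply: eq_bigr => t _; rewrite /G.
  case: ifP => [/andP[nt _]|_]; last by rewrite measure0.
  by rewrite (ball_sizeE hB) //; exact: ballS.
by rewrite lee_fin depth_sum.
Qed.

Local Notation bar := (bar H B bad node A p).

Lemma bar_at_depth n k x : node k -> bar k x -> (n <= dep k)%N ->
  exists j, [/\ node j, dep j = n & bar j x].
Proof.
elim/ltn_ind: k => k IH nk bk; rewrite leq_eqVlt => /orP[/eqP e|lt]; first by exists k.
case: (posnP k) => [k0|k0]; first by rewrite k0 in lt.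
have [pk np _] := node_parent NT k0 nk.
apply: (IH _ pk np); first exact: bar_parent k0 nk _ bk.
by rewrite -ltnS -depth_parent.
Qed.

Lemma depth_lt_ancestor j k : node k -> ancestor p j k -> j <> k -> (dep j < dep k)%N.
Proof.
elim/ltn_ind: k => k IH nk jk ne; have [//|[k0 jp]] := ancestorP jk.
have [pk np _] := node_parent NT k0 nk; rewrite (depth_parent k0 nk) ltnS.
have [->//|/eqP ne'] := eqVneq j (p k).
by apply/ltnW/IH.
Qed.

(** Bars through [x] form a chain of ancestors, so their depths are distinct; a depth of [n] or more
    would put [x] into [depth_union n]. *)
Lemma bar_count n x (s : seq nat) : ~ depth_union n x -> uniq s ->
  (forall k, k \in s -> node k /\ bar k x) -> (size s <= n)%N.
Proof.
move=> nx us sP.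
have lt k : k \in s -> (dep k < n)%N.
  move=> /sP[nk bk]; rewrite ltnNge; apply/negP => le.
  have [j [nj dj bj]] := bar_at_depth nk bk le; apply: nx; exists j.
    by rewrite /= nj dj eqxx.
  exact: (bar_sub_hull HE NT nj bj).
have ud : uniq (map dep s).
  rewrite map_inj_in_uniq // => j k js ks e.
  have [nj bj] := sP _ js; have [nk bk] := sP _ ks.
  case: (ltngtP j k) => // h; exfalso.
    have := depth_lt_ancestor nk (bar_ancestor NT nj nk (ltnW h) bj bk).
    by rewrite e ltnn => /(_ _)/notF; apply => jk; rewrite jk ltnn in h.
  have := depth_lt_ancestor nj (bar_ancestor NT nk nj (ltnW h) bk bj).
  by rewrite e ltnn => /(_ _)/notF; apply => jk; rewrite jk ltnn in h.
rewrite -(size_map dep) -(size_iota 0 n); apply: uniq_leq_size => // i /mapP[k ks ->].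
by rewrite mem_iota /= lt.
Qed.

End PathSystem.

(** * Regular families *)

Section ModulusSum.
Context {R : realType}.
Variable w : R -> R.
Hypothesis hw : modulus w.
Local Notation mu := (@lebesgue_measure R).

Let h (t : R) : \bar R := (w t * ln t^-1 / t)%:E.

(** A monotone extension to the line, whose measurability follows from monotonicity. *)
Let w_ext (t : R) : R := if t <= 0 then 0 else if t <= 1 then w t else 1.

Let measurable_w_ext : measurable_fun setT w_ext.
Proof.
apply: nondecreasing_measurable => // s t st; rewrite /w_ext.
case: (leP t 0) => t0; first by rewrite (le_trans st t0).
have rt : t <= 1 -> 0 < w t <= 1 by move=> t1; apply: (modulus_range hw); rewrite t0.
case: (leP s 0) => s0; first by case: (leP t 1) => [/rt/andP[/ltW]|].
case: (leP t 1) => t1.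
  by rewrite (le_trans st t1); exact: (modulus_mono hw).
case: (leP s 1) => s1 //.
by have /andP[] : 0 < w s <= 1 by apply: (modulus_range hw); rewrite s0.
Qed.

Let measurable_h : measurable_fun (`]0%R, 1%R]%classic : set R) h.
Proof.
apply: (eq_measurable_fun (fun t => (w_ext t * - ln t * expR (- ln t))%:E)).
  move=> t; rewrite inE /= in_itv /= => /andP[t0 t1].
  by rewrite /h /w_ext leNgt t0 /= t1 expRN lnK ?posrE // lnV ?posrE.
apply: measurable_funTS; apply/measurable_EFinP.
have mln : measurable_fun setT (fun t : R => - ln t).
  exact: measurable_funN (@measurable_ln R).
apply: measurable_funM; first exact: measurable_funM.
exact: (measurableT_comp (@measurable_expR R)).
Qed.

Let h_ge0 t : (`]0%R, 1%R]%classic : set R) t -> (0 <= h t)%E.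
Proof.
rewrite /= in_itv /= => /andP[t0 t1]; rewrite lee_fin.
apply: divr_ge0; last exact: ltW.
apply: mulr_ge0.
  by have /andP[/ltW] : 0 < w t <= 1 by apply: (modulus_range hw); rewrite t0.
by apply: ln_ge0; rewrite invf_ge1.
Qed.

Let ln2_ge : 1 / 2 <= ln 2 :> R.
Proof.
have : ln (1 + - (1 / 2)) <= - (1 / 2) :> R by apply: le_ln1Dx; lra.
have -> : 1 + - (1 / 2) = 2^-1 :> R by field.
by rewrite lnV ?posrE //; move: (ln 2) => a; lra.
Qed.

Let w_pow_ge0 k : 0 <= w (2^-1 ^+ k).
Proof.
have /andP[/ltW//] : 0 < w (2^-1 ^+ k) <= 1.
apply: (modulus_range hw); rewrite exprn_gt0 ?invr_gt0 //=.
by apply: exprn_ile1; lra.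
Qed.

Let w_pow_le1 k : w (2^-1 ^+ k) <= 1.
Proof.
have /andP[_] // : 0 < w (2^-1 ^+ k) <= 1.
apply: (modulus_range hw); rewrite exprn_gt0 ?invr_gt0 //=.
by apply: exprn_ile1; lra.
Qed.

(** On the dyadic interval from [2^-1 ^+ k.+1] to [2^-1 ^+ k] the integrand is at least
    [w (2^-1 ^+ k.+1) * (k / 2) * 2 ^+ k], because [ln 2 >= 1 / 2]; the length of the interval gives
    the other factor 2. *)
Let sum_le_integral n :
  ((\sum_(0 <= k < n) w (2^-1 ^+ k.+1) * k%:R / 4)%:E <= \int[mu]_(t in `]0%R, 1%R]) h t)%E.
Proof.
pose I k : set R := [set` Interval (BRight (2^-1 ^+ k.+1)) (BRight (2^-1 ^+ k))].
have p0 k : 0 < 2^-1 ^+ k :> R by rewrite exprn_gt0 // invr_gt0.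
have p1 k : 2^-1 ^+ k <= 1 :> R by apply: exprn_ile1; lra.
have I01 k : I k `<=` (`]0%R, 1%R]%classic : set R).
  move=> t; rewrite /I /= !in_itv /= => /andP[t0 t1].
  by rewrite (lt_trans (p0 _) t0) (le_trans t1).
have low k t : I k t -> ((w (2^-1 ^+ k.+1) * (k%:R / 2) * 2 ^+ k)%:E <= h t)%E.
  rewrite /I /= in_itv /= => /andP[t0 t1]; rewrite lee_fin.
  have tp : 0 < t by apply: lt_trans t0.
  have t1' : t <= 1 by apply: le_trans t1 _.
  have it : 2 ^+ k <= t^-1.
    by rewrite -[2]invrK exprVn lef_pV2 // posrE.
  apply: ler_pM => //.
  - by apply: mulr_ge0; [exact: w_pow_ge0|exact: divr_ge0].
  - apply: ler_pM => //.
      by apply: (modulus_mono hw) => //; exact: ltW.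
    have : ln (2 ^+ k) <= ln t^-1 :> R.
      by rewrite ler_ln // posrE ?invr_gt0 // exprn_gt0.
    rewrite lnXn // -[_ *+ k]mulr_natr => /(le_trans _); apply.
    by rewrite mulrC ler_wpM2r //; move: ln2_ge; lra.
have mI k : measurable (I k) by exact: measurable_itv.
apply: (@le_trans _ _ (\sum_(0 <= k < n | predT k) \int[mu]_(t in I k) h t)%E); last first.
  apply: disjoint_integral_le => //; first by move=> k _ _; split; [exact: mI|exact: I01].
  move=> j k jk _ _ _; apply/seteqP; split => // t; rewrite /I /= !in_itv /=.
  move=> [/andP[t1 t2] /andP[t3 t4]].
  have : 2^-1 ^+ k <= 2^-1 ^+ j.+1 :> R.
    by apply: ler_wiXn2l => //; lra.
  by move=> /(le_trans t4); rewrite leNgt t1.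
rewrite -sumEFin; apply: lee_sum => k _.
apply: (@le_trans _ _ (\int[mu]_(t in I k) (cst (w (2^-1 ^+ k.+1) * (k%:R / 2) * 2 ^+ k)%:E t))%E).
  have lt : 2^-1 ^+ k.+1 < 2^-1 ^+ k :> R by rewrite exprS gtr_pMl //; lra.
  have mIE : mu (I k) = (2^-1 ^+ k - 2^-1 ^+ k.+1)%:E.
    by apply: (etrans (lebesgue_measure_itv _)); rewrite /= lte_fin lt.
  rewrite integral_cst; last exact: mI.
  rewrite [X in (_ * X)%E](mIE) -EFinM lee_fin le_eqVlt; apply/orP; left; apply/eqP.
  rewrite exprS exprVn; have : 2 ^+ k != 0 :> R by rewrite expf_neq0.
  by move=> k0; field.
apply: ge0_le_integral => //; first exact: mI.
- move=> t _; rewrite /= lee_fin; apply: mulr_ge0; last by rewrite exprn_ge0.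
  by apply: mulr_ge0; [exact: w_pow_ge0|exact: divr_ge0].
- by apply: measurable_funS measurable_h; [exact: measurable_itv|exact: I01].
- exact: low.
Qed.

(** The terms of index 0 and 1, invisible to the logarithm, are at most 1 and 2 and are charged to
    the summand 1 of the norm. For the others [k + 2 <= 3 * k], and [12 = 3 * 4]. *)
Lemma modulus_sum_le n :
  ((\sum_(0 <= k < n) w (2^-1 ^+ k) * k.+1%:R)%:E <= 12%:E * modulus_norm w)%E.
Proof.
have I0 : (0 <= \int[mu]_(t in `]0%R, 1%R]) h t)%E by apply: integral_ge0.
have split_sum : \sum_(0 <= k < n) w (2^-1 ^+ k) * k.+1%:R <=
    3 + 12 * \sum_(0 <= k < n) w (2^-1 ^+ k.+1) * k%:R / 4.
  have pt k : w (2^-1 ^+ k.+1) * k.+2%:R <=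
      (if k == 0%N then 2 else 0) + 12 * (w (2^-1 ^+ k.+1) * k%:R / 4).
    have := w_pow_ge0 k.+1; have := w_pow_le1 k.+1.
    case: k => [|k] /=; first by move: (w _) => a; lra.
    move: (w _) => a a1 a0; rewrite add0r.
    have -> : 12 * (a * k.+1%:R / 4) = a * (3 * k.+1%:R) by field.
    rewrite ler_wpM2l // -[k.+3]addn2 -[in leLHS]addn1 !natrD -[k.+1]addn1 natrD.
    have : 0 <= k%:R :> R by [].
    by move: k%:R => b; lra.
  case: n => [|n].
    by rewrite !big_geq // mulr0 addr0.
  rewrite big_nat_recl // expr0 mulr1.
  apply: (@le_trans _ _ (1 + \sum_(0 <= k < n.+1)
    ((if k == 0%N then 2 else 0) + 12 * (w (2^-1 ^+ k.+1) * k%:R / 4)))).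
    apply: lerD; first by have := w_pow_le1 0; rewrite expr0.
    apply: (@le_trans _ _ (\sum_(0 <= k < n.+1) w (2^-1 ^+ k.+1) * k.+2%:R)).
      by rewrite [leRHS]big_nat_recr //= lerDl mulr_ge0.
    by apply: ler_sum => k _; exact: pt.
  rewrite big_split /= -mulr_sumr big_nat_recl //= big1 // addr0 addrA.
  by rewrite lerD2r; lra.
apply: (@le_trans _ _ (3 + 12 * \sum_(0 <= k < n) w (2^-1 ^+ k.+1) * k%:R / 4)%:E).
  by rewrite lee_fin.
rewrite EFinD EFinM /modulus_norm -/h.
rewrite ge0_muleDr // mule1; apply: leeD; first by rewrite lee_fin; lra.
by rewrite lee_wpmul2l // lee_fin.
Qed.

Lemma modulus_norm_ge1 : (1 <= modulus_norm w)%E.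
Proof. by rewrite /modulus_norm -/h leeDl //; apply: integral_ge0. Qed.

End ModulusSum.

(** * Integrals against a regular family *)

Section PhiAverage.
Context {d : measure_display} {T : measurableType d} {R : realType}.
Context {U : completeNormedModType R}.
Variables (mu : {measure set T -> \bar R}) (BB : set (set T)) (K r L : R).
Variables (H : set T -> set T) (f : T -> U).
Variables (w gam : R -> R) (c1 c2 : R) (phi : set T -> T -> R).
Hypothesis hB : ball_basis mu BB K.
Hypothesis r1 : 1 <= r.
Hypothesis Lrf : in_Lr mu r f.
Hypothesis HE : expansion BB (ball_size mu) H L.
Hypothesis hw : modulus w.
Hypothesis wfin : (modulus_norm w < +oo)%E.
Hypothesis c20 : 0 < c2.
Hypothesis reg : regular_family mu BB w gam c1 c2 phi.
Implicit Types (A D Q : set T) (c : U).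
Local Notation m := (ball_size mu).

Let L2 : 2 <= L := exp_ge2 HE.
Let m_gt0 A (bA : BB A) : 0 < m A := ball_size_gt0 hB bA.
Let bH A (bA : BB A) : BB (H A) := exp_ball HE bA.
Let meas A (bA : BB A) : measurable A := ball_measurable hB bA.

Lemma common_ball A x : BB A -> exists Q, [/\ BB Q, A `<=` Q & Q x].
Proof.
move=> bA; have [y Ay] := basis_nonempty hB bA.
have [C bC [Cx Cy]] := ball_pair hB x y.
have [le|lt] := leP (m C) (2 * m A).
  exists (H A); split; [exact: bH|exact: (exp_sub HE bA)|].
  by apply: (exp_swallow HE bA bC) => //; exists y.
exists (H C); split; [exact: bH| |exact: (exp_sub HE bC)].
apply: (exp_swallow HE bC bA); first by exists y.
by have := m_gt0 bA; have := m_gt0 bC; move: (m A) (m C) lt => a b; lra.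
Qed.

Let vset x A : set (\bar R) := [set mu Q | Q in [set Q | [/\ BB Q, A `<=` Q & Q x]]].

Let vol_distE x A : BB A -> ereal_inf (vset x A) = (vol_dist mu BB x A)%:E.
Proof.
move=> bA; rewrite /vol_dist fineK //; have [Q [bQ AQ Qx]] := common_ball x bA.
apply/fin_numP; split.
  rewrite gt_eqF //; apply: (@lt_le_trans _ _ (0 : \bar R)%E); first exact: ltNy0.
  by apply: le_ereal_inf_tmp => _ [A' _ <-].
rewrite lt_eqF //; apply: (@le_lt_trans _ _ (mu Q)).
  by apply: ereal_inf_lbound; exists Q.
by rewrite (ball_sizeE hB bQ) ltry.
Qed.

Lemma vol_dist_ge x A : BB A -> m A <= vol_dist mu BB x A.
Proof.
move=> bA; rewrite -lee_fin -vol_distE //; apply: le_ereal_inf_tmp => _ [Q [bQ AQ _] <-].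
by rewrite (ball_sizeE hB bQ) lee_fin (ball_size_mono hB).
Qed.

Lemma vol_dist_lt x A (s : R) : BB A -> vol_dist mu BB x A < s ->
  exists Q, [/\ BB Q, A `<=` Q, Q x & m Q < s].
Proof.
move=> bA; rewrite -lte_fin -vol_distE // => /ereal_inf_lt[_ [Q [bQ AQ Qx] <-]].
by rewrite (ball_sizeE hB bQ) lte_fin => ?; exists Q.
Qed.

(** A sublevel set of the volume distance fits into one ball: [Q] has more than half the supremal
    size among the balls around [A] smaller than [s], so [H Q] swallows all of them. *)
Lemma dist_ball A (s : R) : BB A -> m A < s -> exists D, [/\ BB D, A `<=` D,
  m D <= L * s & forall x, vol_dist mu BB x A < s -> D x].
Proof.
move=> bA As.
pose E := [set m Q | Q in [set Q | [/\ BB Q, A `<=` Q & m Q < s]]].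
have supE : has_sup E.
  split; first by exists (m A); exists A => //; split.
  by exists s => _ [Q [_ _ /ltW ?] <-].
have E0 : 0 < sup E.
  apply: (lt_le_trans (m_gt0 bA)); apply: sup_upper_bound => //.
  by exists A => //; split.
have [|_ [Q [bQ AQ Qs] <-] Qlt] := @sup_adherent _ E (sup E / 2) _ supE.
  by rewrite divr_gt0.
exists (H Q); split; first exact: bH.
- exact: subset_trans (exp_sub HE bQ).
- apply: (le_trans (exp_le HE bQ)); rewrite ler_pM2l ?(ltW Qs) //.
  by move: L2; lra.
move=> x /(vol_dist_lt bA)[Q' [bQ' AQ' Q'x Q's]].
apply: (exp_swallow HE bQ bQ') => //.
  by have [y Ay] := basis_nonempty hB bA; exists y; split; [exact: AQ'|exact: AQ].
have : m Q' <= sup E by apply: sup_upper_bound => //; exists Q'.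
by move: Qlt; move: (sup E) (m Q) (m Q') => a b c; lra.
Qed.

Lemma phi_pointwise A x : BB A -> exists k, vol_dist mu BB x A < 2 ^+ k.+1 * m A /\
  phi A x <= c2 * w (2^-1 ^+ k) / (2 ^+ k * m A).
Proof.
move=> bA; have mA := m_gt0 bA; have dA := vol_dist_ge x bA.
set D := vol_dist mu BB x A in dA *; have D0 : 0 < D by apply: lt_le_trans dA.
(* The least such [n] is positive since [D >= m A]; its predecessor [k] is the dyadic level of
   [x]. *)
have ex : exists n, D < 2 ^+ n * m A.
  exists (Num.truncn (D / m A)).+1; rewrite -ltr_pdivrMr //.
  apply: (@lt_le_trans _ _ (Num.truncn (D / m A)).+1%:R); first by rewrite truncnS_gt.
  by rewrite -natrX ler_nat ltnW // ltn_expl.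
case: (ex_minnP ex) => -[|k] Dk kmin.
  by move: Dk; rewrite expr0 mul1r ltNge dA.
exists k; split => //.
have Dk' : 2 ^+ k * m A <= D.
  by rewrite leNgt; apply/negP => /kmin; rewrite ltnn.
have p0 : 0 < 2 ^+ k * m A by rewrite mulr_gt0 // exprn_gt0.
have /andP[_] := regular_bounds reg x bA; rewrite -/(m A) -/D => /le_trans; apply.
have ratio : m A / D <= 2^-1 ^+ k.
  rewrite ler_pdivrMr // exprVn ler_pdivlMl ?exprn_gt0 //.
have q1 : 2^-1 ^+ k <= 1 :> R by apply: exprn_ile1; lra.
have w1 : 0 < w (m A / D) <= 1.
  by apply: (modulus_range hw); rewrite divr_gt0 //= (le_trans ratio).
have w2 : w (m A / D) <= w (2^-1 ^+ k).
  by apply: (modulus_mono hw) => //; rewrite divr_gt0.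
apply: ler_pM => //.
- by apply: mulr_ge0; [exact: ltW|case/andP: w1 => /ltW].
- by rewrite invr_ge0 ltW.
- by rewrite ler_pM2l.
- by rewrite lef_pV2 ?posrE.
Qed.

Let W := fine (modulus_norm w).

Lemma modulus_normE : modulus_norm w = W%:E.
Proof. by rewrite /W fineK // ge0_fin_numE // (le_trans _ (modulus_norm_ge1 hw)). Qed.

Lemma measurable_phi A : BB A -> measurable_fun setT (phi A).
Proof.
move=> bA; apply/measurable_EFinP.
by have /integrableP[] := regular_integrable reg bA.
Qed.

(** Here [24 = 2 * 12], with 12 from [modulus_sum_le] and 2 from the upper end of a dyadic level;
    [q] absorbs [2 * L], the growth from a level to its enclosing ball. *)
Definition phi_const (C1 : R) (q : nat) : R := 24 * c2 * C1 * L * q.+1%:R.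

(** The function [phi A] is dominated by step functions on the enclosing balls [D k] of the dyadic
    levels. The mean over [D k] grows linearly in [k], and the factor [k + 1] is what the logarithm
    in the modulus norm sums up. *)
Lemma phi_mass_le A c (N C1 : R) q : BB A -> 0 <= N -> 0 <= C1 -> 2 * L <= 2 ^+ q ->
  (forall n Q, BB Q -> A `<=` Q -> m Q <= 2 ^+ n * m A ->
    mean_dist mu f c Q <= C1 * n.+1%:R * N) ->
  (\int[mu]_x (`|f x - c| * phi A x)%:E <= (phi_const C1 q * W * N)%:E)%E.
Proof.
move=> bA N0 C10 Lq HQ; have mA := m_gt0 bA.
have exD k : exists D, [/\ BB D, A `<=` D, m D <= L * (2 ^+ k.+1 * m A) &
    forall x, vol_dist mu BB x A < 2 ^+ k.+1 * m A -> D x].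
  apply: dist_ball => //; rewrite ltr_pMl //.
  by apply: exprn_egt1 => //; rewrite ltr1n.
have [D DP] := choice exD.
pose a k := c2 * w (2^-1 ^+ k) / (2 ^+ k * m A).
have w0 k : 0 <= w (2^-1 ^+ k).
  have /andP[/ltW//] : 0 < w (2^-1 ^+ k) <= 1.
  apply: (modulus_range hw); rewrite exprn_gt0 ?invr_gt0 //=.
  by apply: exprn_ile1; lra.
have a0 k : 0 <= a k.
  apply: divr_ge0; first by apply: mulr_ge0; [exact: ltW|exact: w0].
  by apply: mulr_ge0; [exact: exprn_ge0|exact: ltW].
pose h (x : T) := (`|f x - c|)%:E.
have mh : measurable_fun setT h := measurable_dist Lrf c.
pose g k x := ((a k)%:E * ((h \_ (D k)) x))%E.
have g0 k x : (0 <= g k x)%E.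
  rewrite /g; apply: mule_ge0; first by rewrite lee_fin.
  by rewrite patchE; case: ifP => // _; rewrite lee_fin.
have mg k : measurable_fun setT (g k).
  have [bD _ _ _] := DP k.
  apply: measurable_funeM; apply/(measurable_restrictT _ (meas bD)).
  exact: measurable_funTS.
have mhphi : measurable_fun setT (fun x => (`|f x - c| * phi A x)%:E).
  apply/measurable_EFinP; apply: measurable_funM; last exact: measurable_phi.
  exact/measurable_EFinP.
apply: (@le_trans _ _ (\int[mu]_x (\sum_(0 <= k <oo) g k x))%E).
  apply: ge0_le_integral => //.
  - by move=> x _; rewrite lee_fin; apply: mulr_ge0 => //; exact: (regular_ge0 reg).
  - by apply: ge0_emeasurable_sum => k *; [exact: g0|exact: mg].
  move=> x _; have [k [Dk pk]] := phi_pointwise x bA.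
  apply: (@le_trans _ _ (g k x)).
    rewrite /g patchE mem_set; last by have [_ _ _] := DP k; apply.
    rewrite /h -EFinM lee_fin mulrC ler_wpM2r //.
  apply: (@le_trans _ _ (\sum_(0 <= j < k.+1) g j x)%E).
    by rewrite big_nat_recr //= leeDr // sume_ge0.
  exact: nneseries_lim_ge.
rewrite integral_nneseries //.
apply: nneseries_le_bound => [k|n]; first exact: integral_ge0.
apply: (@le_trans _ _ (\sum_(0 <= k < n)
  ((2 * c2 * C1 * L * q.+1%:R * N) * (w (2^-1 ^+ k) * k.+1%:R))%:E)%E).
  apply: lee_sum => k _; have [bD AD mD _] := DP k.
  rewrite ge0_integralZl_EFin //; first last.
  - apply/(measurable_restrictT _ (meas bD)); exact: measurable_funTS.
  - by move=> x _; rewrite patchE; case: ifP => // _; rewrite lee_fin.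
  rewrite -integral_mkcond (massE hB r1 Lrf c bD) -EFinM lee_fin (mass_mean f hB c bD).
  have p0 : 0 < 2 ^+ k :> R by rewrite exprn_gt0.
  have L0 : 0 < L by move: L2; lra.
  have md : mean_dist mu f c (D k) <= C1 * (k + q).+1%:R * N.
    apply: HQ => //; apply: (le_trans mD).
    rewrite exprS exprD; have -> : L * (2 * 2 ^+ k * m A) = (2 * L) * (2 ^+ k * m A) by ring.
    have -> : 2 ^+ k * 2 ^+ q * m A = 2 ^+ q * (2 ^+ k * m A) by ring.
    by rewrite ler_pM2r // mulr_gt0.
  have kq : (k + q).+1%:R <= k.+1%:R * q.+1%:R :> R.
    rewrite -natrM ler_nat mulnS mulSn addSn ltnS.
    by rewrite leq_add2l leq_addr.
  have md' : mean_dist mu f c (D k) <= C1 * (k.+1%:R * q.+1%:R) * N.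
    by apply: (le_trans md); rewrite ler_wpM2r // ler_wpM2l.
  apply: (@le_trans _ _ (a k * (L * (2 ^+ k.+1 * m A) * (C1 * (k.+1%:R * q.+1%:R) * N)))).
    rewrite ler_wpM2l //; apply: ler_pM => //; first exact/ltW/m_gt0.
    exact: (mean_dist_ge0 f hB c bD).
  rewrite /a exprS le_eqVlt; apply/orP; left; apply/eqP; field.
  by rewrite !gt_eqF.
rewrite sumEFin -mulr_sumr EFinM.
have c0 : (0 <= (2 * c2 * C1 * L * q.+1%:R * N)%:E)%E.
  have L0 : 0 <= L by move: L2; lra.
  by rewrite lee_fin !mulr_ge0 // ltW.
apply: (le_trans (lee_wpmul2l c0 (modulus_sum_le hw n))).
rewrite modulus_normE -!EFinM lee_fin le_eqVlt; apply/orP; left; apply/eqP.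
by rewrite /phi_const; ring.
Qed.

Lemma phi_average_le A c : BB A ->
  (phi_average mu phi f A <= (`|c|)%:E + \int[mu]_x (`|f x - c| * phi A x)%:E)%E.
Proof.
move=> bA; have mp := measurable_phi bA.
have p0 x : 0 <= phi A x := regular_ge0 reg x bA.
have -> : ((`|c|)%:E = \int[mu]_x ((`|c|)%:E * (phi A x)%:E))%E.
  rewrite ge0_integralZl_EFin //; first by rewrite (regular_norm1 reg bA) mule1.
    by move=> x _; rewrite lee_fin.
  exact/measurable_EFinP.
have mn : measurable_fun setT (fun x => `|f x|).
  by have /measurable_EFinP := measurable_dist Lrf 0; under eq_fun do rewrite subr0.
rewrite -ge0_integralD //; first last.
- apply/measurable_EFinP; apply: measurable_funM => //.
  exact/measurable_EFinP/(measurable_dist Lrf).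
- by move=> x _; rewrite lee_fin mulr_ge0.
- by apply: measurable_funeM; exact/measurable_EFinP.
- by move=> x _; rewrite -EFinM lee_fin mulr_ge0.
apply: ge0_le_integral => //.
- by move=> x _; rewrite lee_fin mulr_ge0.
- by apply/measurable_EFinP; exact: measurable_funM.
- apply: emeasurable_funD; first by apply: measurable_funeM; exact/measurable_EFinP.
  apply/measurable_EFinP; apply: measurable_funM => //.
  exact/measurable_EFinP/(measurable_dist Lrf).
move=> x _; rewrite -EFinM -EFinD lee_fin -mulrDl ler_wpM2r //.
by rewrite -[X in `|X| <= _](subrK c) addrC ler_normD.
Qed.

Lemma phi_average_ge A c : BB A ->
  ((`|c|)%:E <= phi_average mu phi f A + \int[mu]_x (`|f x - c| * phi A x)%:E)%E.
Proof.
move=> bA; have mp := measurable_phi bA.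
have p0 x : 0 <= phi A x := regular_ge0 reg x bA.
have -> : ((`|c|)%:E = \int[mu]_x ((`|c|)%:E * (phi A x)%:E))%E.
  rewrite ge0_integralZl_EFin //; first by rewrite (regular_norm1 reg bA) mule1.
    by move=> x _; rewrite lee_fin.
  exact/measurable_EFinP.
have mn : measurable_fun setT (fun x => `|f x|).
  by have /measurable_EFinP := measurable_dist Lrf 0; under eq_fun do rewrite subr0.
have md : measurable_fun setT (fun x => `|f x - c|).
  exact/measurable_EFinP/(measurable_dist Lrf).
rewrite -ge0_integralD //; first last.
- by apply/measurable_EFinP; exact: measurable_funM.
- by move=> x _; rewrite lee_fin mulr_ge0.
- by apply/measurable_EFinP; exact: measurable_funM.
- by move=> x _; rewrite lee_fin mulr_ge0.
apply: ge0_le_integral => //.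
- by move=> x _; rewrite -EFinM lee_fin mulr_ge0.
- by apply: measurable_funeM; exact/measurable_EFinP.
- by apply: emeasurable_funD; apply/measurable_EFinP; exact: measurable_funM.
move=> x _; rewrite -EFinM -EFinD lee_fin -mulrDl ler_wpM2r //.
by rewrite [`|f x - c|]distrC -[X in `|X| <= _](subrK (f x)) addrC ler_normD.
Qed.

End PhiAverage.

(** * Estimates of the maximal function *)

Section MaximalEstimates.
Context {d : measure_display} {T : measurableType d} {R : realType}.
Context {U : completeNormedModType R}.
Variables (mu : {measure set T -> \bar R}) (BB : set (set T)) (K eta r L : R).
Variables (H : set T -> set T) (f : T -> U).
Variables (w gam : R -> R) (c1 c2 : R) (phi : set T -> T -> R) (G : T -> set (set T)).
Hypothesis hB : ball_basis mu BB K.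
Hypothesis r1 : 1 <= r.
Hypothesis Lrf : in_Lr mu r f.
Hypothesis HE : expansion BB (ball_size mu) H L.
Hypothesis etaL : eta <= L.
Hypothesis hw : modulus w.
Hypothesis wfin : (modulus_norm w < +oo)%E.
Hypothesis c20 : 0 < c2.
Hypothesis hgam : growth_fun gam.
Hypothesis reg : regular_family mu BB w gam c1 c2 phi.
Hypothesis hG : forall x, complete_at mu BB eta (G x) x.
Variable q : nat.
Hypothesis Lq : 2 * L <= 2 ^+ q.
Variables (B : set T) (node : pred nat) (A : nat -> set T) (p : nat -> nat).
Hypothesis bB : BB B.
Hypothesis NT : node_tree BB (ball_size mu) H L (stops mu BB L f) B node A p.
Local Notation m := (ball_size mu).
Local Notation fa A := (average mu A f).
Local Notation md c A := (mean_dist mu f c A).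
Local Notation osc := (osc mu BB f).
Local Notation bad S := (bad mu BB L f S).
Local Notation g := (maximal mu phi G f).

Let S k := H (H (A k)).
Let W := fine (modulus_norm w).
Let L2 : 2 <= L := exp_ge2 HE.
Let m_gt0 A (bA : BB A) : 0 < m A := ball_size_gt0 hB bA.
Let bH A (bA : BB A) : BB (H A) := exp_ball HE bA.
Let ballA k : node k -> BB (A k) := @node_ball _ _ _ _ _ _ _ _ _ _ _ NT k.
Let ballS k : node k -> BB (S k). Proof. by move=> nk; do 2 apply: bH; apply: ballA. Qed.
Let powL0 n : 0 < L ^+ n. Proof. by rewrite exprn_gt0 //; move: L2; lra. Qed.
Let powL1 n : 1 <= L ^+ n. Proof. by rewrite exprn_ege1 //; move: L2; lra. Qed.
Let n0 : node 0%N := node0 NT.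
Let bS0 : BB (S 0%N) := ballS n0.
Let osc0 S (bS : BB S) : 0 <= osc S := osc_ge0 hB r1 Lrf bS.
Let lev := bad_level L.
Let lev0 : 0 < lev. Proof. exact: mulr_gt0 (powL0 _). Qed.
Let Cphi := phi_const L c2 lev q.

Let Cphi0 : 0 <= Cphi.
Proof.
have L0 : 0 <= L by move: L2; lra.
by rewrite /Cphi /phi_const !mulr_ge0 // ltW.
Qed.

Let W1 : 1 <= W.
Proof. by rewrite -lee_fin -(modulus_normE hw wfin) (modulus_norm_ge1 hw). Qed.

Let gamL : 1 <= gam L. Proof. by apply: (proj1 hgam); move: L2; lra. Qed.

Let gCW0 : 0 <= gam L * Cphi * W.
Proof.
apply: mulr_ge0; last by move: W1; lra.
by apply: mulr_ge0 => //; move: gamL; lra.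
Qed.

(** The summand [lev] pays for telescoping along a path, [L] for replacing a ball by one of [G x],
    [Cphi] for averaging against [phi], and [gam L] for replacing [phi D] by [phi (H D)]. *)
Definition maximal_const : R := lev + L + (1 + gam L) * Cphi.
Local Notation Ct := maximal_const.

Let Ct_ge_lev_phi : lev + Cphi * W <= Ct * W.
Proof.
rewrite /maximal_const !mulrDl mul1r.
have h1 : lev <= lev * W by rewrite ler_peMr // ltW.
have h2 : 0 <= L * W by apply: mulr_ge0; [move: L2; lra|move: W1; lra].
have h3 := gCW0.
by move: h1 h2 h3; move: (lev * W) (L * W) (gam L * Cphi * W) (Cphi * W) => ? ? ? ?; lra.
Qed.

Let Ct_ge_gam : gam L * Cphi * W <= Ct * W.
Proof.
have W0 : 0 <= W by move: W1; lra.
rewrite ler_wpM2r // /maximal_const mulrDl mul1r.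
by move: (ltW lev0) L2 Cphi0; move: (gam L * Cphi) => ?; lra.
Qed.

Let Ct_ge_low : L + Cphi * W <= Ct * W.
Proof.
rewrite /maximal_const !mulrDl mul1r.
have L0 : 0 <= L by move: L2; lra.
have h1 : L <= L * W by rewrite ler_peMr.
have h2 : 0 <= lev * W by apply: mulr_ge0; [exact: ltW|move: W1; lra].
have h3 := gCW0.
by move: h1 h2 h3; move: (lev * W) (L * W) (gam L * Cphi * W) (Cphi * W) => ? ? ? ?; lra.
Qed.

(** Balls larger than the top ball contribute this value up to the error allowed, whatever the point
    of [B]; it is the reference for [g] and its medians. *)
Definition base_value : R := sup [set `|fa Q| | Q in [set Q | BB Q /\ S 0%N `<=` Q]].
Local Notation a := base_value.

Lemma average_le_base Q : BB Q -> S 0%N `<=` Q -> `|fa Q| <= a.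
Proof.
move=> bQ SQ; apply: sup_upper_bound; last by exists Q => //; split.
split; first by exists (`|fa Q|), Q.
exists (1 + Lr_mass mu r f / m (S 0%N)) => _ [Q' [bQ' SQ'] <-].
exact: (average_norm_le hB r1 Lrf bQ' bS0 SQ').
Qed.

Lemma phi_mass_self Q : BB Q ->
  (\int[mu]_x (`|f x - fa Q| * phi Q x)%:E <= (Cphi * W * osc Q)%:E)%E.
Proof.
move=> bQ; apply: (phi_mass_le hB r1 Lrf HE hw wfin c20 reg bQ) => //.
- exact: osc0.
- exact: ltW.
move=> n Q' bQ' QQ' mQ'.
have [x Qx] := basis_nonempty hB bQ.
apply: (le_trans (mean_dist_large hB r1 Lrf HE bQ bQ' _ _ mQ')).
- by exists x; split => //; exact: QQ'.
- exact: (ball_size_mono hB).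
rewrite ler_wpM2r ?osc0 // ler_wpM2r //.
have -> : lev = 4 * L ^+ 3 * (8 * L ^+ 6) by rewrite /lev /bad_level; ring.
rewrite ler_peMr //; first by apply: mulr_ge0; [by []|apply/ltW/powL0].
by have := powL1 6; move: (L ^+ 6) => b; lra.
Qed.

(** A large ball [D] need not contain the top ball, so its oscillation is not controlled by
    [osc (S 0)]. The estimate is made on [H D], and the growth condition brings it back to
    [phi D]. *)
Lemma phi_average_large x D : B x -> BB D -> D x -> m (S 0%N) < m D ->
  (phi_average mu phi f D <= (a + Ct * W * osc (S 0%N))%:E)%E.
Proof.
move=> Bx bD Dx mD; have bQ := bH bD; have mD0 := m_gt0 bD.
have S0x : S 0%N x.
  have BS : B `<=` S 0%N.
    have bA := ballA n0; rewrite -(node_root NT).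
    by apply: subset_trans (exp_sub HE (bH bA)); exact: (exp_sub HE bA).
  exact: BS.
have SQ : S 0%N `<=` H D.
  apply: (exp_swallow HE bD bS0); first by exists x.
  by move: mD mD0; move: (m D) (m (S 0%N)) => ? ?; lra.
apply: (le_trans (phi_average_le Lrf reg (fa (H D)) bD)).
rewrite EFinD; apply: leeD; first by rewrite lee_fin average_le_base.
have DQ := exp_sub HE bD.
have pt x' : phi D x' <= gam L * phi (H D) x'.
  apply: (le_trans (regular_growth reg x' bQ bD DQ)).
  apply: ler_wpM2r; first exact: (regular_ge0 reg).
  apply: (proj2 hgam); last by rewrite -/(m _) -/(m D) ler_pdivrMr // (exp_le HE bD).
  by rewrite ler_pdivlMr // mul1r; exact: (exp_mono HE bD bQ).
have mphi A' : BB A' -> measurable_fun setT (fun x => (`|f x - fa (H D)| * phi A' x)%:E).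
  move=> bA'; apply/measurable_EFinP; apply: measurable_funM; last exact: (measurable_phi reg).
  exact/measurable_EFinP/(measurable_dist Lrf).
have gam0 : 0 <= gam L by move: gamL; lra.
apply: (@le_trans _ _ (\int[mu]_x ((gam L)%:E * (`|f x - fa (H D)| * phi (H D) x)%:E))%E).
  apply: ge0_le_integral => //.
  - by move=> x' _; rewrite lee_fin mulr_ge0 // (regular_ge0 reg).
  - exact: mphi.
  - by apply: measurable_funeM; exact: mphi.
  - by move=> x' _; rewrite -EFinM lee_fin mulrCA ler_wpM2l.
rewrite ge0_integralZl_EFin //; last 2 first.
- by move=> x' _; rewrite lee_fin mulr_ge0 // (regular_ge0 reg).
- exact: mphi.
apply: (@le_trans _ _ ((gam L)%:E * (Cphi * W * osc (H D))%:E)%E).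
  by rewrite lee_wpmul2l ?lee_fin // phi_mass_self.
rewrite -EFinM lee_fin mulrA [gam L * (Cphi * W)]mulrA.
apply: (@le_trans _ _ (gam L * Cphi * W * osc (S 0%N))).
  by rewrite ler_wpM2l //; exact: (osc_anti hB r1 Lrf bS0 bQ SQ).
by rewrite ler_wpM2r ?osc0.
Qed.

Lemma phi_average_small k x D : node k -> S k x -> BB D -> D x -> m D <= m (S k) ->
  (forall Q, BB Q -> D `<=` Q -> m Q <= m (S k) ->
    md (fa (S k)) Q <= lev * osc (S k)) ->
  (phi_average mu phi f D <= (`|fa (S k)| + Cphi * W * osc (S k))%:E)%E.
Proof.
move=> nk Skx bD Dx mD good.
apply: (le_trans (phi_average_le Lrf reg (fa (S k)) bD)).
rewrite EFinD leeD2l //.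
apply: (phi_mass_le hB r1 Lrf HE hw wfin c20 reg bD) => //.
- exact/osc0/ballS.
- exact: ltW.
apply: (mean_dist_good hB r1 Lrf HE (ballS nk) bD _ mD good).
by exists x.
Qed.

(** Each link of the telescoping sum is [mean_dist_near_child] with [D] the ball of the child
    itself; the list [s] collects the proper ancestors. *)
Lemma average_path k x : node k -> bar H B (fun S => bad S) node A p k x ->
  exists s : seq nat, [/\ uniq s,
    forall j, j \in s -> [/\ node j, bar H B (fun S => bad S) node A p j x & (j < k)%N] &
    `|fa (S k)| <= a + lev * \sum_(j <- s) osc (S j)].
Proof.
elim/ltn_ind: k => k IH nk bk; case: (posnP k) => [->|k0].
  by exists [::]; split => //; rewrite big_nil mulr0 addr0 average_le_base.
have [pk np st] := node_parent NT k0 nk.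
have [s [us sP le]] := IH _ pk np (bar_parent k0 nk bk).
exists (p k :: s); split.
- rewrite /= us andbT; apply/negP => /sP[_ _]; by rewrite ltnn.
- move=> j; rewrite inE => /orP[/eqP ->|/sP[nj bj jp]].
    by split => //; exact: bar_parent k0 nk _ bk.
  by split => //; exact: ltn_trans pk.
have mS : m (S k) <= m (S (p k)).
  exact: (exp_mono HE (ballS nk) (ballS np) (node_nested NT k0 nk)).
have [y Sy] := basis_nonempty hB (ballS nk).
have h := mean_dist_near_child hB r1 Lrf HE (ballS np) st (node_step NT k0 nk)
  (node_nested NT k0 nk) (ballS nk) (ex_intro _ y (conj Sy Sy)) (lexx _) mS.
have h2 := le_trans (average_dist hB r1 Lrf (fa (S (p k))) (ballS nk)) h.
rewrite big_cons mulrDr addrCA.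
have := ler_normD (fa (S k) - fa (S (p k))) (fa (S (p k))); rewrite subrK.
by move=> /le_trans; apply; apply: lerD.
Qed.

Lemma descent x D : BB D -> m D <= m (S 0%N) ->
  forall k, node k -> bar H B (fun S => bad S) node A p k x -> m (S k) < m D ->
  exists i, [/\ (0 < i)%N, node i, bar H B (fun S => bad S) node A p i x,
    m (S i) < m D & m D <= m (S (p i))].
Proof.
move=> bD mD0; elim/ltn_ind => k IH nk bk mk; case: (posnP k) => [k0|k0].
  by move: mk; rewrite k0 ltNge mD0.
have [pk np _] := node_parent NT k0 nk.
have [le|lt] := leP (m D) (m (S (p k))); first by exists k.
by apply: (IH _ pk np) => //; exact: bar_parent k0 nk _ bk.
Qed.

(** If the path of [x] ends before reaching sizes below [m D], its end is not bad at [x]. Otherwise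
    [descent] finds a link crossing the size of [D], and nearness to the smaller ball makes the
    larger one good. An infinite path always has such a link, as sizes tend to zero. *)
Lemma good_node x D : B x -> BB D -> D x -> m D <= m (S 0%N) ->
  exists k, [/\ node k, bar H B (fun S => bad S) node A p k x, m D <= m (S k) &
    forall Q, BB Q -> D `<=` Q -> m Q <= m (S k) ->
      md (fa (S k)) Q <= lev * osc (S k)].
Proof.
move=> Bx bD Dx mD0.
have small k : node k -> bar H B (fun S => bad S) node A p k x -> m (S k) < m D ->
  exists k, [/\ node k, bar H B (fun S => bad S) node A p k x, m D <= m (S k) &
    forall Q, BB Q -> D `<=` Q -> m Q <= m (S k) ->
      md (fa (S k)) Q <= lev * osc (S k)].
  move=> nk bk mk; have [i [i0 ni bi mi mpi]] := descent bD mD0 nk bk mk.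
  have [pi np st] := node_parent NT i0 ni; exists (p i); split => //.
    exact: bar_parent i0 ni _ bi.
  move=> Q bQ DQ mQ.
  apply: (mean_dist_near_child hB r1 Lrf HE (ballS np) st (node_step NT i0 ni)
    (node_nested NT i0 ni) bQ _ _ mQ).
    exists x; split; first exact: DQ.
    exact: (bar_sub_hull HE NT ni bi).
  by apply: (le_trans (ltW mi)); exact: (ball_size_mono hB).
have bst k y : node k -> S k y -> (forall D, stops mu BB L f (S k) D -> ~ D y) ->
    ~ bad (S k) y.
  move=> nk Sy nst /(bad_stops hB r1 Lrf HE (ballS nk))[Q sQ Qy].
  exact: nst sQ Qy.
have bfin := bad_finite_children hB r1 Lrf HE NT.
have [[k [nk bk nb]]|inf] := bar_path HE NT bst bfin Bx.
  have [le|lt] := leP (m D) (m (S k)); last exact: small lt.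
  exists k; split => // Q bQ DQ mQ; rewrite leNgt; apply/negP => lt; apply: nb.
  exists Q; last exact: DQ.
  split => //; exists x; split; first exact: DQ.
  exact: (bar_sub_hull HE NT nk bk).
have [|n nP] := node_small NT (e := m D / L ^+ 2).
  by apply: divr_gt0 (powL0 _); exact: m_gt0.
have [k [nk' nk bk]] := inf n; apply: (small k nk bk).
have bA := ballA nk; have h1 := exp_le HE bA; have h2 := exp_le HE (bH bA).
have h3 := nP _ nk' nk; rewrite ltr_pdivlMr ?powL0 // in h3.
apply: le_lt_trans h3; apply: (le_trans h2); rewrite [leRHS]mulrC expr2 -mulrA.
by rewrite ler_pM2l //; move: L2; lra.
Qed.

Lemma phi_average_upper x D : B x -> G x D -> exists s : seq nat, [/\ uniq s,
    forall j, j \in s -> node j /\ bar H B (fun S => bad S) node A p j x &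
    (phi_average mu phi f D <= (a + Ct * W * \sum_(j <- s) osc (S j))%:E)%E].
Proof.
move=> Bx GD; have [GB Gx _] := hG x; have bD := GB _ GD; have Dx := Gx _ GD.
have [mD|mD] := leP (m D) (m (S 0%N)); last first.
  exists [:: 0%N]; split => //; last first.
    by rewrite big_seq1; exact: (phi_average_large Bx bD Dx mD).
  by move=> j; rewrite inE => /eqP ->; split => //; exact: (bar_root (fun S => bad S) NT Bx).
have [k [nk bk mDk good]] := good_node Bx bD Dx mD.
have Skx := bar_sub_hull HE NT nk bk.
have [s [us sP le]] := average_path nk bk.
exists (k :: s); split.
- by rewrite /= us andbT; apply/negP => /sP[_ _]; rewrite ltnn.
- by move=> j; rewrite inE => /orP[/eqP ->|/sP[]].
apply: (le_trans (phi_average_small nk Skx bD Dx mDk good)).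
rewrite lee_fin big_cons.
set X := \sum_(_ <- _) _ in le *.
have X0 : 0 <= X by rewrite /X big_seq; apply: sumr_ge0 => j /sP[nj _ _]; exact/osc0/ballS.
have o0 := osc0 (ballS nk).
have h1 : lev * X <= Ct * W * X.
  rewrite ler_wpM2r //; apply: le_trans Ct_ge_lev_phi; rewrite lerDl.
  by apply: mulr_ge0 => //; move: W1; lra.
have h2 : Cphi * W * osc (S k) <= Ct * W * osc (S k).
  by rewrite ler_wpM2r //; apply: le_trans Ct_ge_lev_phi; rewrite lerDr ltW.
rewrite mulrDr; apply: (le_trans (lerD le h2)).
by rewrite -addrA lerD2l addrC lerD2l.
Qed.

(** Completeness replaces any ball around the top ball by a comparable member of [G x]; its average
    of [f] changes by at most [L * osc (S 0)]. *)
Lemma maximal_lower x : B x -> ((a - Ct * W * osc (S 0%N))%:E <= g x)%E.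
Proof.
move=> Bx; have S0x := bar_sub_hull HE NT n0 (bar_root (fun S => bad S) NT Bx).
have o0 := osc0 bS0.
have low Q : BB Q -> S 0%N `<=` Q -> ((`|fa Q| - Ct * W * osc (S 0%N))%:E <= g x)%E.
  move=> bQ SQ; have [GB _ GC] := hG x; have [Q' [GQ' QQ' mQ']] := GC _ bQ (SQ _ S0x).
  have bQ' := GB _ GQ'; have mQ0 := m_gt0 bQ.
  apply: (@le_trans _ _ (phi_average mu phi f Q')); last first.
    by apply: ereal_sup_ubound; exists Q'.
  have SQ' : S 0%N `<=` Q' by exact: subset_trans QQ'.
  have mQ'L : m Q' <= L * m Q.
    move: mQ'; rewrite !(ball_sizeE hB) // -EFinM lee_fin => /le_trans; apply.
    by rewrite ler_wpM2r // ltW.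
  have h1 := average_sub hB r1 Lrf bQ bQ' QQ' mQ'L
    (mean_dist_le_osc hB r1 Lrf bS0 bQ' SQ').
  have h2 := phi_average_ge Lrf reg (fa Q') bQ'.
  have h3 := phi_mass_self bQ'.
  have h4 : Cphi * W * osc Q' <= Cphi * W * osc (S 0%N).
    rewrite ler_wpM2l //; last exact: (osc_anti hB r1 Lrf bS0 bQ' SQ').
    by apply: mulr_ge0 => //; move: W1; lra.
  have h5 : ((`|fa Q'|)%:E <= phi_average mu phi f Q' + (Cphi * W * osc (S 0%N))%:E)%E.
    apply: (le_trans h2); rewrite leeD2l //; apply: (le_trans h3); by rewrite lee_fin.
  rewrite -(leeD2rE (x := (Cphi * W * osc (S 0%N))%:E)) //.
  apply: le_trans h5; rewrite -EFinD lee_fin.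
  have h6 := ler_normD (fa Q - fa Q') (fa Q'); rewrite subrK in h6.
  have h7 : (L + Cphi * W) * osc (S 0%N) <= Ct * W * osc (S 0%N) by rewrite ler_wpM2r.
  rewrite mulrDl in h7.
  move: h1 h6 h7; move: (Cphi * W * osc _) (Ct * W * osc _) (L * osc _) => u v z.
  by move: `|fa Q - fa Q'| `|fa Q| `|fa Q'| => ? ? ?; lra.
case gE : (g x) => [z| |]; [|by rewrite leey|]; last first.
  by have := low _ bS0 (@subset_refl _ _); rewrite gE.
rewrite lee_fin lerBlDr; apply: ge_sup; first by exists (`|fa (S 0%N)|); exists (S 0%N) => //; split.
by move=> _ [Q [bQ SQ] <-]; rewrite -lerBlDr -lee_fin -gE low.
Qed.

(** Off the bad set all scales below the top ball are handled by the root alone; together with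
    [maximal_lower] this locates [g] on most of [B]. *)
Lemma maximal_good x : B x -> ~ bad (S 0%N) x ->
  (g x <= (a + Ct * W * osc (S 0%N))%:E)%E.
Proof.
move=> Bx nb; apply: ge_ereal_sup => _ [D GD <-].
have [GB Gx _] := hG x; have bD := GB _ GD; have Dx := Gx _ GD.
have S0x := bar_sub_hull HE NT n0 (bar_root (fun S => bad S) NT Bx).
have [mD|mD] := leP (m D) (m (S 0%N)); last exact: (phi_average_large Bx bD Dx mD).
apply: (le_trans (phi_average_small n0 S0x bD Dx mD _)).
  move=> Q bQ DQ mQ; rewrite leNgt; apply/negP => lt; apply: nb.
  exists Q; last exact: DQ.
  by split => //; exists x; split => //; exact: DQ.
rewrite lee_fin; apply: lerD; first exact: average_le_base.
rewrite ler_wpM2r ?osc0 //; apply: le_trans Ct_ge_lev_phi.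
by rewrite lerDr ltW.
Qed.

End MaximalEstimates.

Lemma maximal_const_gt0 (R : realType) (L c2 : R) (gam : R -> R) q :
  2 <= L -> 0 < c2 -> growth_fun gam -> 0 < maximal_const L gam c2 q.
Proof.
move=> L2 c20 hgam; have L0 : 0 < L by lra.
have lev0 : 0 < bad_level L by apply: mulr_gt0 => //; exact: exprn_gt0.
rewrite /maximal_const; apply: ltr_wpDr; last exact: addr_gt0.
apply: mulr_ge0; last by rewrite /phi_const !mulr_ge0 // ltW.
by have := proj1 hgam L; move: (gam L) => x h; have := h _; lra.
Qed.

(** * Medians *)

Section Median.
Context {d : measure_display} {T : measurableType d} {R : realType}.
Variables (mu : {measure set T -> \bar R}) (g : T -> \bar R) (B D : set T) (a M : R).
Hypothesis mB : measurable B.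
Hypothesis finB : (0 < mu B < +oo)%E.
Hypothesis mD : measurable D.
Hypothesis DB : D `<=` B.
Hypothesis Dbig : ((2^-1)%:E * mu B < mu D)%E.
Hypothesis M0 : 0 <= M.
Hypothesis gD : forall x, D x -> (`|g x - a%:E| <= M%:E)%E.
Implicit Types E N : set T.

Lemma dist_le_real (u : \bar R) (b e : R) : (`|u - b%:E| <= e%:E)%E ->
  exists2 s, u = s%:E & `|s - b| <= e.
Proof. by case: u => [s| |] //=; rewrite lee_fin; exists s. Qed.

Lemma OSC_beta_le : (OSC_beta mu 2^-1 g B <= (2 * M)%:E)%E.
Proof.
apply: (@le_trans _ _ (OSC mu g D)); first by apply: ereal_inf_lbound; exists D.
apply: (@le_trans _ _ (ereal_sup [set `|g xx.1 - g xx.2|%E | xx in (D `\` set0) `*` (D `\` set0)])).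
  apply: ereal_inf_lbound; exists set0 => //; exact: negligible_set0.
apply: ge_ereal_sup => _ [[x y] /= [[Dx _] [Dy _]] <-].
have [s -> hs] := dist_le_real (gD Dx); have [t -> ht] := dist_le_real (gD Dy).
rewrite -EFinB abse_EFin lee_fin.
have := ler_distD a s t; rewrite [`|a - t|]distrC.
by move: hs ht; move: `|s - a| `|t - a| `|s - t| => *; lra.
Qed.

(* The infimum defining [OSC] is attained, since a countable union of null sets
   is null. *)
Lemma OSC_attained E (e : R) : (OSC mu g E <= e%:E)%E -> exists2 N, mu.-negligible N &
  forall x y, E x -> ~ N x -> E y -> ~ N y -> (`|g x - g y| <= e%:E)%E.
Proof.
move=> Ee.
have ex n : exists N, mu.-negligible N /\ forall x y, E x -> ~ N x -> E y -> ~ N y ->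
    (`|g x - g y| <= (e + n.+1%:R^-1)%:E)%E.
  have : (OSC mu g E < (e + n.+1%:R^-1)%:E)%E.
    by apply: (le_lt_trans Ee); rewrite lte_fin ltrDl invr_gt0.
  move=> /ereal_inf_lt[_ [N nN <-] /ltW le]; exists N; split => // x y Ex Nx Ey Ny.
  apply: le_trans le; apply: ereal_sup_ubound; exists (x, y) => //.
have [N NP] := choice ex.
exists (\bigcup_n N n); first by apply: negligible_bigcup => n; have [] := NP n.
move=> x y Ex Nx Ey Ny; apply/lee_addgt0Pr => t t0.
have [_ h] := NP (Num.truncn t^-1).
apply: (le_trans (h x y Ex _ Ey _)).
- by move=> Nk; apply: Nx; exists (Num.truncn t^-1).
- by move=> Nk; apply: Ny; exists (Num.truncn t^-1).
rewrite -EFinD lee_fin lerD2l -[leRHS]invrK lef_pV2 ?posrE ?invr_gt0 //.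
by apply/ltW; rewrite truncnS_gt.
Qed.

Lemma cell_near_base E : median_cell mu g B E -> exists2 N, mu.-negligible N &
  (exists2 z, E z & ~ N z) /\
  forall y, E y -> ~ N y -> (`|g y - a%:E| <= (5 * M)%:E)%E.
Proof.
move=> [mE EB Ebig Eosc].
have [|N nN NP] := @OSC_attained E (4 * M).
  apply: (le_trans Eosc).
  apply: (@le_trans _ _ (2%:E * (2 * M)%:E)%E); first by rewrite lee_wpmul2l ?OSC_beta_le.
  by rewrite -EFinM lee_fin mulrA; move: M0; lra.
have [z [Ez Nz Dz]] : exists z, [/\ E z, ~ N z & D z].
  apply: contrapT => no.
  have sub : E `&` D `<=` N.
    by move=> x [Ex Dx]; apply: contrapT => Nx; apply: no; exists x.
  have ED0 : mu (E `&` D) = 0%E.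
    apply: measure_negligible; first exact: measurableI.
    exact: negligibleS sub nN.
  have mED : measurable (E `\` D) by exact: measurableD.
  have e1 : mu E = mu (E `\` D).
    have disj : E `&` D `&` (E `\` D) = set0 by rewrite setDE setIACA setICr setI0.
    have := measureU mu (measurableI _ _ mE mD) mED disj.
    rewrite setUIDK => ->; rewrite [X in (X + _)%E](_ : _ = 0%E) ?add0e //.
  have le : (mu (E `\` D) + mu D <= mu B)%E.
    rewrite -measureU //; last by rewrite setDE -setIA setICl setI0.
    apply: le_measure; rewrite ?inE //; first exact: measurableU.
    by move=> x [[Ex _]|Dx]; [exact: EB|exact: DB].
  move: le; rewrite -e1; apply/negP; rewrite -ltNge.
  have fB : mu B = (fine (mu B))%:E.
    by case/andP: finB => h1 h2; rewrite fineK // ge0_fin_numE // ltW.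
  apply: (@le_lt_trans _ _ ((2^-1)%:E * mu B + (2^-1)%:E * mu B)%E); last exact: lteD.
  by rewrite fB -EFinM -EFinD lee_fin; lra.
exists N => //; split; first by exists z.
move=> y Ey Ny; have [s gz hs] := dist_le_real (gD Dz).
have := NP y z Ey Ny Ez Nz; rewrite gz => /dist_le_real[t -> ht].
rewrite -EFinB abse_EFin lee_fin.
have := ler_distD s t a.
by move: hs ht; move: `|s - a| `|t - s| `|t - a| => *; lra.
Qed.

End Median.

(** * Sums over the family and proof of the theorem *)

Lemma esum_image (R : realType) (T : choiceType) (node : pred nat) (S : nat -> T)
    (F : T -> \bar R) : (forall j k, node j -> node k -> S j = S k -> j = k) ->
  (\esum_(Q in [set S k | k in [set k | node k]]) F Q =
   \esum_(k in [set k | node k]) F (S k))%E.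
Proof.
move=> Sinj; apply: reindex_esum; split.
- by move=> k nk; exists k.
- by move=> j k; rewrite !inE => nj nk; exact: Sinj.
- by move=> _ [k nk <-]; exists k.
Qed.

Lemma esum_ge_seq (R : realType) (node : pred nat) (F : nat -> \bar R) (s : seq nat) :
  uniq s -> (forall k, k \in s -> node k) ->
  (\sum_(k <- s) F k <= \esum_(k in [set k | node k]) F k)%E.
Proof.
move=> us sn; apply: esum_ge; exists [set` s]; last by rewrite fsbig_seq.
by split; [exact: finite_seq|move=> k /= /sn].
Qed.

(** Rounding [lam] down costs one power of 2, hence the factor 2. *)
Lemma half_expn_le (R : realType) (lam : R) : 0 < lam ->
  2^-1 ^+ Num.truncn lam <= 2 * expR (- (ln 2 * lam)).
Proof.
move=> lam0; set n := Num.truncn lam.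
have : expR (- (ln 2 * n.+1%:R)) <= expR (- (ln 2 * lam)) :> R.
  rewrite ler_expR lerN2 ler_wpM2l //; first by apply: ln_ge0; rewrite ler1n.
  by apply/ltW; rewrite truncnS_gt.
have -> : expR (- (ln 2 * n.+1%:R)) = 2^-1 * 2^-1 ^+ n :> R.
  by rewrite -exprS -mulNr expRM_natr expRN lnK ?posrE.
by move: (2^-1 ^+ n) (expR _) => u v; lra.
Qed.

Local Open Scope ereal_scope.

Theorem corollary1p1 (R : realType) (K eta r : R) (hr : (1 <= r)%R) :
  exists gam0 C c : R,
    [/\ (0 < gam0 < 1)%R, (0 < C)%R & (0 < c)%R] /\
  forall (gam : R -> R) (c1 c2 : R),
    growth_fun gam -> (0 < c1)%R -> (0 < c2)%R ->
  exists2 C' : R, (0 < C')%R &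
  forall (d : measure_display) (X : measurableType d)
    (mu : {measure set X -> \bar R}) (BB : set (set X))
    (U : completeNormedModType R) (w : R -> R)
    (phi : set X -> X -> R) (G : X -> set (set X)),
    ball_basis mu BB K ->
    doubling mu BB eta ->
    modulus w ->
    modulus_norm w < +oo ->
    regular_family mu BB w gam c1 c2 phi ->
    (forall x, complete_at mu BB eta (G x) x) ->
    (forall f : X -> U, in_Lr mu r f ->
       measurable_fun [set: X] (maximal mu phi G f)) ->
  forall (f : X -> U) (B : set X), in_Lr mu r f -> BB B ->
  exists (B' : set X) (A Abar : set (set X)) (bar : set X -> set X),
    [/\ BB B', B `<=` B', A `<=` BB & sparse mu gam0 A] /\
    [/\ Abar `<=` measurable, martingale_type Abar & shrinking bar A Abar] /\
    [/\ \bigcup_(S in A) S `<=` B',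
        mu B' <= C%:E * mu B &
        forall lam : R, (0 < lam)%R ->
          mu [set x | lam%:E < \esum_(S in A) (\1_(bar S) x)%:E]
            <= (C * expR (- (c * lam)))%:E * mu B] /\
    let g := maximal mu phi G f in
    let dominated (m : R) := forall x, B x ->
      `|g x - m%:E| <=
        C'%:E * modulus_norm w *
        \esum_(S in A) (sharp_star mu BB r f S * (\1_(bar S) x)%:E) in
    ((exists m, is_median mu g B m) ->
       exists2 m, is_median mu g B m & dominated m) /\
    (forall E, median_cell mu g B E ->
       {ae mu, forall y, E y -> forall m, g y = m%:E -> dominated m}).
Proof.
pose L := expansion_factor K eta.
have L02 : (2 <= ball_growth K eta)%R by rewrite /ball_growth le_max lexx.
have L2 : (2 <= L)%R by rewrite /L /expansion_factor expr2; nra.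
have etaL : (eta <= L)%R.
  have : (eta <= ball_growth K eta)%R by rewrite /ball_growth !le_max lexx !orbT.
  by rewrite /L /expansion_factor expr2; nra.
have L0 : (0 < L)%R by lra.
have L20 : (0 < L ^+ 2)%R by rewrite exprn_gt0.
have L22 : (0 < 2 * L ^+ 2)%R by exact: mulr_gt0.
have L21 : (4 <= L ^+ 2)%R by rewrite expr2; nra.
(* The sparse core has at least [3 / 4] of the size of the core, itself at least [L ^- 2] times the
   hull. The top ball has size at most [L ^+ 2 * m B], and the 2 in [C] comes from [half_expn_le].
   Generations halve, whence [c = ln 2]. *)
exists ((2 * L ^+ 2)^-1)%R, (2 * L ^+ 2)%R, (ln 2); split.
  split; last by rewrite ln_gt0 // ltr1n.
    by rewrite invr_gt0 mulr_gt0 //= invf_lt1 ?mulr_gt0 //; lra.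
  by rewrite mulr_gt0.
move=> gam c1 c2 hgam c10 c20.
have [q Lq] : exists q : nat, (2 * L <= 2 ^+ q)%R.
  exists (Num.truncn (2 * L)).+1; apply: (@le_trans _ _ (Num.truncn (2 * L)).+1%:R)%R.
    by apply/ltW; rewrite truncnS_gt.
  by rewrite -natrX ler_nat ltnW // ltn_expl.
(* Here [6 = 5 + 1]: a median is within five error units of the base value, and [g x] within one
   unit of the path sum. *)
exists (6 * maximal_const L gam c2 q)%R.
  by apply: mulr_gt0 => //; exact: maximal_const_gt0.
move=> d X mu BB U w phi G hB hD hw wfin reg hG _ f B Lrf bB.
have [H HE] := expansion_exists hB hD.
have [node [A [p NT]]] := node_tree_exists HE (stopping_stops hB hr Lrf HE) bB.
pose m := ball_size mu; pose S k := H (H (A k)).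
pose nbar := bar H B (fun Q => bad mu BB L f Q) node A p.
have ballA k : node k -> BB (A k) := @node_ball _ _ _ _ _ _ _ _ _ _ _ NT k.
have ballS k : node k -> BB (S k) by move=> nk; do 2 apply: (exp_ball HE); exact: ballA.
have m_gt0 Q : BB Q -> (0 < m Q)%R := fun bQ => ball_size_gt0 hB bQ.
have n0 := node0 NT; have bS0 := ballS _ n0.
have mSA k : node k -> (m (S k) <= L ^+ 2 * m (A k))%R.
  move=> nk; have bA := ballA _ nk; have h1 := exp_le HE bA.
  have h2 := exp_le HE (exp_ball HE bA).
  by apply: (le_trans h2); rewrite expr2 -mulrA ler_pM2l.
have bad_meas k : node k -> measurable (bad mu BB L f (S k)).
  by move=> _; exact: (measurable_bad L f hB).
have measB C : BB C -> measurable C := ball_measurable hB (B := C).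
have Sinj j k : node j -> node k -> S j = S k -> j = k := @node_inj _ _ _ _ _ _ _ _ _ _ _ NT j k.
have mbar k (nk : node k) : measurable (nbar k) := measurable_bar HE NT measB bad_meas nk.
have barS k (nk : node k) : nbar k `<=` S k := bar_sub_hull HE NT nk.
have bar0 : B `<=` nbar 0%N := bar_root _ NT.
have core_nb k (nk : node k) := sparse_core_not_bad hB hr Lrf HE NT nk.
have bar_injective := bar_inj NT core_nb.
(* On the family [idx] inverts [S], by [Sinj]; the default 0 concerns other sets only. *)
pose idx Q := xget 0%N [set k | node k /\ S k = Q].
have idxK k : node k -> idx (S k) = k.
  move=> nk; rewrite /idx; case: xgetP => [j _ [nj Sj]|/(_ k)]; first exact: Sinj.
  by move=> h; exfalso; apply: h; split.
pose fam := [set S k | k in [set k | node k]].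
pose tbar Q := nbar (idx Q).
have nested j k x : node j -> node k -> (j <= k)%N -> nbar j x -> nbar k x ->
    nbar k `<=` nbar j.
  move=> nj nk jk bj bk; have : ancestor p j k := bar_ancestor NT nj nk jk bj bk.
  elim/ltn_ind: k nk {jk bk} => k IH nk jk; have [->//|[k0 jp]] := ancestorP jk.
  have [pk np _] := node_parent NT k0 nk.
  apply: subset_trans (IH _ pk np jp); exact: (bar_parent k0 nk).
exists (S 0%N), fam, [set nbar k | k in [set k | node k]], tbar.
split; first split => //.
- by rewrite -(node_root NT); apply: subset_trans (exp_sub HE (exp_ball HE (ballA _ n0)));
    exact: (exp_sub HE (ballA _ n0)).
- by move=> _ [k nk <-]; exact: ballS.
- exists (fun Q => sparse_core node A (idx Q)); split.
    move=> _ [k nk <-]; rewrite idxK //; split.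
    + exact: (measurable_sparse_core hB NT nk).
    + apply: (@subset_trans _ (A k)); first by move=> x [].
      apply: subset_trans (exp_sub HE (exp_ball HE (ballA _ nk))).
      exact: (exp_sub HE (ballA _ nk)).
    apply: le_trans (sparse_core_size hB NT nk).
    rewrite (ball_sizeE hB (ballS _ nk)) -EFinM lee_fin -/(m _) -/(m (A k)).
    have mA := m_gt0 _ (ballA _ nk).
    rewrite ler_pdivrMl //; apply: (le_trans (mSA _ nk)).
    by move: L20 mA; move: (L ^+ 2)%R (m (A k)) => u v *; nra.
  move=> _ _ [j nj <-] [k nk <-]; rewrite !idxK // => -[x [xj xk]].
  case: (ltngtP j k) => [jk|kj|->//]; exfalso.
    by case: xj => _; apply; exists k; [rewrite /= jk|case: xk].
  by case: xk => _; apply; exists j; [rewrite /= kj|case: xj].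
split; first split.
- by move=> _ [k nk <-]; exact: mbar.
- move=> _ _ [j nj <-] [k nk <-].
  have [->|/set0P[x [xj xk]]] := eqVneq (nbar j `&` nbar k) set0; first by constructor.
  have [jk|kj] := leqP j k.
    by constructor 3; exact: nested jk xj xk.
  by constructor 2; apply: nested (ltnW kj) xk xj.
- split; last by move=> _ [k nk <-]; rewrite /tbar idxK //; exact: barS.
  split.
  + by move=> _ [k nk <-]; rewrite /tbar idxK //; exists k.
  + move=> Q Q'; rewrite !inE => -[j nj <-] [k nk <-]; rewrite /tbar !idxK // => e.
    by rewrite (bar_injective _ _ nj nk e).
  + by move=> _ [k nk <-]; exists (S k); [exists k|rewrite /tbar idxK].
have bB0 : (0 < m B)%R := m_gt0 _ bB.
have S0B : (m (S 0%N) <= L ^+ 2 * m B)%R by have := mSA _ n0; rewrite (node_root NT).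
split; first split.
- by move=> x [_ [k nk <-] Skx]; apply: (ancestor_nested NT nk (ancestor0 NT nk)).
- rewrite (ball_sizeE hB bS0) (ball_sizeE hB bB) -EFinM lee_fin; apply: (le_trans S0B).
  by rewrite ler_wpM2r ?(ltW bB0) //; lra.
- move=> lam lam0; set n := Num.truncn lam.
  pose cnt x := (\sum_(k <oo | node k) (\1_(nbar k) x)%:E : \bar R).
  have cntE x : \esum_(Q in fam) (\1_(tbar Q) x)%:E = cnt x.
    rewrite (esum_image _ Sinj) /cnt nneseries_esum //.
    by apply: eq_esum => k nk; rewrite /tbar idxK.
  have -> : [set x | lam%:E < \esum_(Q in fam) (\1_(tbar Q) x)%:E] = [set x | lam%:E < cnt x].
    by apply/seteqP; split => x /=; rewrite cntE.
  have mcnt : measurable_fun setT cnt.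
    apply: ge0_emeasurable_sum => // k nk.
    by apply/measurable_EFinP; exact: measurable_indic (mbar _ nk).
  (* Outside this union every partial sum counts bars through [x], hence is at most [n], which does
     not exceed [lam]. *)
  have msub : [set x | lam%:E < cnt x] `<=` depth_union H node A p n.
    move=> x /=; apply: contraPP => nx; apply/negP; rewrite -leNgt.
    apply: (@le_trans _ _ (n%:R)%:E); last by rewrite lee_fin truncn_le ltW.
    apply: lime_le; first by apply: is_cvg_nneseries_cond.
    apply: nearW => M.
    pose s := [seq k <- index_iota 0 M | node k && `[< nbar k x >]].
    have -> : (\sum_(0 <= k < M | node k) (\1_(nbar k) x)%:E = (size s)%:R%:E :> \bar R).
      rewrite sumEFin -sum1_size natr_sum /s big_filter [in RHS]big_mkcondr /=.
      congr EFin; apply: eq_bigr => k _; rewrite indicE.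
      have [h|h] := pselect (nbar k x); first by rewrite mem_set // asboolT.
      by rewrite memNset // asboolF.
    rewrite lee_fin ler_nat; apply: (bar_count HE NT nx).
      by rewrite filter_uniq // iota_uniq.
    by move=> k; rewrite mem_filter => /andP[/andP[nk /asboolP]].
  apply: (@le_trans _ _ (mu (depth_union H node A p n))).
    apply: le_measure => //; rewrite inE; last exact: (measurable_depth_union hB HE NT).
    by rewrite -[X in measurable X]setTI; apply: emeasurable_fun_o_infty.
  apply: (le_trans (depth_union_size hB HE NT n)).
  rewrite (ball_sizeE hB bB) -EFinM lee_fin -/(m _) -/(m B).
  have h := half_expn_le lam0.
  apply: (@le_trans _ _ (2 * expR (- (ln 2 * lam)) * (L ^+ 2 * m B))%R).
    by apply: ler_pM; [rewrite exprn_ge0 // invr_ge0|exact/ltW/m_gt0|exact: h|exact: S0B].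
  by rewrite le_eqVlt; apply/orP; left; apply/eqP; ring.
move=> g dominated.
pose W := fine (modulus_norm w); pose Ct := maximal_const L gam c2 q.
pose a := base_value mu BB H f A; pose N0 := osc mu BB f (S 0%N).
pose E x := \esum_(Q in fam) (sharp_star mu BB r f Q * (\1_(tbar Q) x)%:E).
have WE : modulus_norm w = W%:E := modulus_normE hw wfin.
have W1 : (1 <= W)%R by rewrite -lee_fin -WE (modulus_norm_ge1 hw).
have Ct0 : (0 < Ct)%R by exact: maximal_const_gt0.
have CW0 : (0 <= Ct * W)%R by rewrite mulr_ge0 // ltW //; lra.
have N00 : (0 <= N0)%R := osc_ge0 hB hr Lrf bS0.
have sharp0 k : node k -> 0 <= sharp_star mu BB r f (S k).
  move=> nk; apply: le_trans (osc_le_sharp_star hB hr Lrf (ballS _ nk)).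
  by rewrite lee_fin (osc_ge0 hB hr Lrf (ballS _ nk)).
have Ege x (s : seq nat) : uniq s -> (forall k, k \in s -> node k /\ nbar k x) ->
    (\sum_(k <- s) osc mu BB f (S k))%:E <= E x.
  move=> us sP; rewrite /E (esum_image _ Sinj).
  apply: le_trans (esum_ge_seq _ us (fun k ks => (sP k ks).1)).
  rewrite -sumEFin big_seq [leRHS]big_seq; apply: lee_sum => k /sP[nk bk].
  rewrite /tbar idxK // indicE mem_set // mule1.
  exact: (osc_le_sharp_star hB hr Lrf (ballS _ nk)).
have E0 x : B x -> N0%:E <= E x.
  move=> Bx; have := Ege x [:: 0%N] isT; rewrite big_seq1; apply => k.
  by rewrite inE => /eqP ->; split => //; exact: bar0.
have gE x : B x -> `|g x - a%:E| <= (Ct * W)%:E * E x.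
  move=> Bx.
  have low := maximal_lower hB hr Lrf HE etaL hw wfin c20 hgam reg hG Lq NT Bx.
  have up D : G x D -> phi_average mu phi f D <= a%:E + (Ct * W)%:E * E x.
    move=> GD; have [s [us sP le]] := phi_average_upper hB hr Lrf HE hw wfin c20 hgam reg hG Lq NT Bx GD.
    apply: (le_trans le); rewrite EFinD leeD2l // EFinM lee_wpmul2l ?lee_fin //.
    exact: Ege.
  have gup : g x <= a%:E + (Ct * W)%:E * E x by apply: ge_ereal_sup => _ [D GD <-]; exact: up.
  have Elow := E0 _ Bx; rewrite -/g in low.
  case EE : (E x) => [e| |]; last by move: Elow; rewrite EE.
    rewrite EE in gup Elow; rewrite -EFinM -EFinD in gup; rewrite lee_fin in Elow.
    have h : (Ct * W * N0 <= Ct * W * e)%R by rewrite ler_wpM2l.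
    case gxE : (g x) low gup => [z| |] // low gup.
    rewrite -EFinB abse_EFin -EFinM lee_fin ler_norml.
    rewrite !lee_fin -/Ct -/W -/a -/N0 in low gup.
    by move: low gup h; move: (Ct * W * e)%R (Ct * W * N0)%R => u v *; apply/andP; split; lra.
  have CWp : (0 < Ct * W)%R by rewrite mulr_gt0 //; lra.
  by rewrite gt0_muley ?lte_fin // leey.
(* The root alone already gives [N0 <= E x], so the distance of [m0] to the base value is absorbed
   by the same sum. *)
have dom_of m0 : (`|m0 - a| <= 5 * (Ct * W * N0))%R -> dominated m0.
  move=> hm x Bx; have h1 := gE _ Bx; have h2 := E0 _ Bx.
  rewrite WE -EFinM -/(E x).
  case EE : (E x) => [e| |]; last by move: h2; rewrite EE.
    rewrite EE in h1 h2; rewrite lee_fin in h2; rewrite -EFinM in h1.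
    have [z -> hz] := dist_le_real h1.
    rewrite -EFinB abse_EFin -EFinM lee_fin.
    have h : (Ct * W * N0 <= Ct * W * e)%R by rewrite ler_wpM2l.
    have h3 := ler_distD a z m0; rewrite [`|a - m0|%R]distrC in h3.
    have -> : (6 * Ct * W * e = 6 * (Ct * W * e))%R by ring.
    by move: h hz hm h3; move: (Ct * W * e)%R (Ct * W * N0)%R => u v *; lra.
  rewrite gt0_muley ?leey // lte_fin -mulrA mulr_gt0 // mulr_gt0 //; lra.
pose D := B `\` bad mu BB L f (S 0%N).
have mBad := measurable_bad L f hB (S 0%N).
have mB := measB _ bB; have mD : measurable D by exact: measurableD.
have Dbig : (2^-1)%:E * mu B < mu D.
  have hbad : mu (bad mu BB L f (S 0%N)) <= (m B / 4)%:E.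
    have -> : S 0%N = H (H B) by rewrite /S (node_root NT).
    exact: (bad_size_le hB hr Lrf HE bB).
  have : mu B <= mu D + (m B / 4)%:E.
    apply: (@le_trans _ _ (mu D + mu (bad mu BB L f (S 0%N)))); last by rewrite leeD2l.
    apply: (@le_trans _ _ (mu (D `|` bad mu BB L f (S 0%N)))).
      apply: le_measure; rewrite ?inE //; first exact: measurableU.
      by move=> x Bx; have [b|nb] := pselect (bad mu BB L f (S 0%N) x); [right|left].
    exact: measureU2.
  rewrite (ball_sizeE hB bB) -/(m B) -EFinM => h.
  case DE : (mu D) h => [z| |] // h; last by rewrite ltry.
  by move: h; rewrite -EFinD lee_fin lte_fin; move: bB0; move: (m B) => u; lra.
have gD x : D x -> `|g x - a%:E| <= (Ct * W * N0)%:E.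
  move=> [Bx nb].
  have low := maximal_lower hB hr Lrf HE etaL hw wfin c20 hgam reg hG Lq NT Bx.
  have up := maximal_good hB hr Lrf HE hw wfin c20 hgam reg hG Lq NT Bx nb.
  rewrite -/g in low up; case gxE : (g x) low up => [z| |] // low up.
  rewrite -EFinB abse_EFin lee_fin ler_norml.
  rewrite !lee_fin -/Ct -/W -/a -/N0 in low up.
  by move: low up; move: (Ct * W * N0)%R => u *; apply/andP; split; lra.
have finB := ball_measure hB bB.
have DB : D `<=` B by move=> x [].
have M0 : (0 <= Ct * W * N0)%R by rewrite mulr_ge0.
have cell := cell_near_base mB finB mD DB Dbig M0 gD.
split.
  (* The given median may be taken at a point of the exceptional null set. Its cell also has a point
     [z] off that set, where [g] is finite and near the base value; this value is the median
     returned. *)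
  move=> [m0 [x [E' cE' E'x] _]]; have [N nN [[z Ez Nz] near]] := cell _ cE'.
  have [s gz hs] := dist_le_real (near _ Ez Nz).
  by exists s; [exists z => //; exists E'|exact: dom_of].
move=> E' cE'; have [N nN [_ near]] := cell _ cE'.
apply: negligibleS nN => y /= ny; apply: contrapT => Ny; apply: ny => Ey m0 gy.
have := near _ Ey Ny; rewrite -/g gy -EFinB abse_EFin lee_fin; exact: dom_of.
Qed.
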